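(* Let $\Omega\subset\mathbb{R}^4$ be a bounded smooth domain, $\lambda_1,\lambda_2\in\mathbb{R}$, $\mu_1,\mu_2>0$, $\theta_1,\theta_2<0$ and $\beta\ne0$. Assume: - if $\beta<0$: $(\lambda_1,\mu_1,\theta_1;\lambda_2,\mu_2,\theta_2)$ belongs to one of the sets $A_1$, $A_2$, $A_3$; - if $\beta>0$: there exists $\epsilon>0$ such that $(\lambda_1,\mu_1+\beta\epsilon,\theta_1;\lambda_2,\mu_2+\frac{\beta}{\epsilon},\theta_2)$ belongs to one of the sets $A_1$, $A_2$, $A_3$. Assume that $\beta\in(-\infty,0)\cup(0,\min\{\mu_1,\mu_2\})\cup(\max\{\mu_1,\mu_2\},+\infty)$, and further that $$\frac{32e^{\lambda_i/\theta_i}}{\mu_iR_{\max}^2}<1\quad\text{for } i=1,2,\qquad\text{where } R_{\max}:=\sup\{r>0:\exists x\in\Omega\text{ s.t. }B_r(x)\subset\Omega\}.$$ Then the system $$-\Delta u=\lambda_1u+\mu_1|u|^2u+\beta|v|^2u+\theta_1u\log u^2,\quad -\Delta v=\lambda_2v+\mu_2|v|^2v+\beta|u|^2v+\theta_2v\log v^2\ \text{ in }\Omega,\quad u=v=0\ \text{ on }\partial\Omega$$ possesses a nonnegative solution $(\bar u,\bar v)\ne(0,0)$.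
   Context: Convention: $s\log s^2:=0$ at $s=0$; $|\Omega|$ is the Lebesgue measure of $\Omega$; $\lambda_1(\Omega)$ is the first eigenvalue of $-\Delta$ on $\Omega$ with Dirichlet boundary conditions; $B_r(x)$ is the ball of radius $r$ centred at $x$ in $\mathbb{R}^4$. Solutions are weak solutions in $H_0^1(\Omega)\times H_0^1(\Omega)$, and a solution $(u,v)$ is nonnegative if $u\ge0$ and $v\ge0$. $S$ is the best Sobolev constant $S=\inf_{u\in\mathcal{D}^{1,2}(\mathbb{R}^4)\setminus\{0\}}\frac{\int_{\mathbb{R}^4}|\nabla u|^2}{(\int_{\mathbb{R}^4}|u|^4)^{1/2}}$, where $\mathcal{D}^{1,2}(\mathbb{R}^4)=\{u\in L^4(\mathbb{R}^4):|\nabla u|\in L^2(\mathbb{R}^4)\}$. The sets $A_1,A_2,A_3$ of tuples $(\lambda_1,\mu_1,\theta_1;\lambda_2,\mu_2,\theta_2)$ are: $A_1$: $\lambda_1,\lambda_2\in[0,\lambda_1(\Omega))$, $\mu_1,\mu_2>0$, $\theta_1,\theta_2<0$, and $\frac{(\min\{\lambda_1(\Omega)-\lambda_1,\lambda_1(\Omega)-\lambda_2\})^2}{\lambda_1(\Omega)^2\max\{\mu_1,\mu_2\}}S^2+2(\theta_1+\theta_2)|\Omega|>0$; $A_2$: $\lambda_1\in[0,\lambda_1(\Omega))$, $\lambda_2\in\mathbb{R}$, $\mu_1,\mu_2>0$, $\theta_1,\theta_2<0$, and $\frac{(\lambda_1(\Omega)-\lambda_1)^2}{\lambda_1(\Omega)^2\max\{\mu_1,\mu_2\}}S^2+2(\theta_1+\theta_2e^{-\lambda_2/\theta_2})|\Omega|>0$;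 $A_3$: $\lambda_1,\lambda_2\in\mathbb{R}$, $\mu_1,\mu_2>0$, $\theta_1,\theta_2<0$, and $\frac{1}{\max\{\mu_1,\mu_2\}}S^2+2(\theta_1e^{-\lambda_1/\theta_1}+\theta_2e^{-\lambda_2/\theta_2})|\Omega|>0$. *)

(* Defs.v *)
From HB Require Import structures.
From mathcomp Require Export all_boot all_order all_algebra.
From mathcomp Require Export all_classical all_reals all_analysis.

Set Implicit Arguments.
Unset Strict Implicit.
Unset Printing Implicit Defensive.

Import Order.TTheory GRing.Theory Num.Theory.
Import numFieldNormedType.Exports.

Local Open Scope classical_set_scope.
Local Open Scope ring_scope.

(* The nested product carries both the Borel structure and Lebesgue measure
   (as a product) and the normed module structure; the library norm on it is
   the max norm, so the Euclidean norm is defined apart. *)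
Notation R4 R := (R * R * R * R)%type.

Section Space.
Variable R : realType.

Definition leb4 : {measure set (measurableTypeR R * measurableTypeR R *
    measurableTypeR R * measurableTypeR R) -> \bar R} :=
  ((@lebesgue_measure R \x @lebesgue_measure R)
     \x @lebesgue_measure R \x @lebesgue_measure R)%E.

Definition vol (Om : set (R4 R)) : R := fine (leb4 Om).

Definition coord (i : 'I_4) (x : R4 R) : R :=
  tnth [tuple x.1.1.1; x.1.1.2; x.1.2; x.2] i.

Definition basis (i : 'I_4) : R4 R :=
  ((i == 0 :> nat)%:R, (i == 1 :> nat)%:R, (i == 2 :> nat)%:R,
   (i == 3 :> nat)%:R).

Definition enorm (x : R4 R) : R := Num.sqrt (\sum_(i < 4) coord i x ^+ 2).

Definition eball (x : R4 R) (r : R) : set (R4 R) :=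
  [set y | enorm (y - x) < r].

Definition partial (i : 'I_4) (f : R4 R -> R) : R4 R -> R :=
  fun x => 'D_(basis i) f x.

(* C^oo: all iterated partial derivatives exist and are continuous. *)
Definition smooth (f : R4 R -> R) : Prop :=
  forall s : seq 'I_4, let g := foldr partial f s in
    continuous g /\ forall i x, derivable g x (basis i).

(* Near each boundary point and after relabelling and reorienting the axes,
   Om is the set above the graph of a C^oo function gam of the other three
   coordinates; gam is given on R^4 and does not depend on coordinate i. *)
Definition smooth_boundary (Om : set (R4 R)) : Prop :=
  forall x, (closure Om `\` interior Om) x ->
    exists (r : R) (i : 'I_4) (s : bool) (gam : R4 R -> R),
      [/\ 0 < r, smooth gam,
          forall y t, gam (y + t *: basis i) = gam y &
          Om `&` eball x r =
          eball x r `&` [set y | 0 < (-1) ^+ s * (coord i y - gam y)]].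

Definition bounded_smooth_domain (Om : set (R4 R)) : Prop :=
  [/\ open Om, connected Om, Om !=set0, bounded_set Om & smooth_boundary Om].

Definition inradius (Om : set (R4 R)) : R :=
  sup [set r | 0 < r /\ exists2 x, Om x & eball x r `<=` Om].

End Space.

Section Sobolev.
Variable R : realType.
Implicit Types (Om : set (R4 R)) (u v w f : R4 R -> R).
Implicit Types (gu gw : 'I_4 -> R4 R -> R).

Definition ae_zero Om u : Prop :=
  {ae (@leb4 R), forall x, Om x -> u x = 0}.

Definition ae_nonneg Om u : Prop :=
  {ae (@leb4 R), forall x, Om x -> 0 <= u x}.

Definition inL Om (p : nat) u : Prop :=
  measurable_fun Om u /\
  (@leb4 R).-integrable Om (fun x => (`|u x| ^+ p)%:E).

Definition test_function Om (phi : R4 R -> R) : Prop :=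
  let K := closure [set x | phi x != 0] in
  [/\ smooth phi, compact K & K `<=` Om].

(* Only used for u and gu locally integrable on Om. *)
Definition weak_gradient Om u gu : Prop :=
  forall (i : 'I_4) phi, test_function Om phi ->
    \int[@leb4 R]_(x in Om) (u x * partial i phi x) =
    - \int[@leb4 R]_(x in Om) (gu i x * phi x).

Definition H1 Om u gu : Prop :=
  [/\ inL Om 2 u, forall i, inL Om 2 (gu i) & weak_gradient Om u gu].

(* H^1_0(Om) is the closure of the test functions in H^1(Om); gu is the weak
   gradient of u. *)
Definition H10 Om u gu : Prop :=
  H1 Om u gu /\
  forall eps : R, 0 < eps -> exists2 phi, test_function Om phi &
    \int[@leb4 R]_(x in Om) (u x - phi x) ^+ 2 +
    \sum_(i < 4) \int[@leb4 R]_(x in Om) (gu i x - partial i phi x) ^+ 2 < eps.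

Definition D12 u gu : Prop :=
  [/\ inL setT 4 u, forall i, inL setT 2 (gu i) & weak_gradient setT u gu].

Definition sobolev_constant : R :=
  inf [set q | exists u gu, [/\ D12 u gu, ~ ae_zero setT u &
    q = (\int[@leb4 R]_x (\sum_(i < 4) gu i x ^+ 2)) /
        Num.sqrt (\int[@leb4 R]_x `|u x| ^+ 4)]].

(* u in H^1_0(Om) is a weak solution of - Laplacian u = f in Om, u = 0 on the
   boundary, tested against all of H^1_0(Om). *)
Definition dirichlet_weak_solution Om u f : Prop :=
  exists2 gu, H10 Om u gu & forall w gw, H10 Om w gw ->
    (@leb4 R).-integrable Om (fun x => (f x * w x)%:E) /\
    \int[@leb4 R]_(x in Om) (\sum_(i < 4) gu i x * gw i x) =
    \int[@leb4 R]_(x in Om) (f x * w x).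

Definition dirichlet_eigenvalue Om (l : R) : Prop :=
  exists2 u, ~ ae_zero Om u &
    dirichlet_weak_solution Om u (fun x => l * u x).

Definition first_eigenvalue Om : R := inf [set l | dirichlet_eigenvalue Om l].

(* The convention s log s^2 = 0 at s = 0 holds since s is a factor. *)
Definition slogs2 (s : R) : R := s * ln (s ^+ 2).

Definition system_weak_solution Om (l1 m1 t1 l2 m2 t2 b : R) u v : Prop :=
  dirichlet_weak_solution Om u (fun x =>
    l1 * u x + m1 * `|u x| ^+ 2 * u x + b * `|v x| ^+ 2 * u x
    + t1 * slogs2 (u x)) /\
  dirichlet_weak_solution Om v (fun x =>
    l2 * v x + m2 * `|v x| ^+ 2 * v x + b * `|u x| ^+ 2 * v x
    + t2 * slogs2 (v x)).

End Sobolev.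

Section Admissible.
Variables (R : realType) (Om : set (R4 R)).
Let L1 : R := first_eigenvalue Om.
Let S : R := sobolev_constant R.

Definition A1 (l1 m1 t1 l2 m2 t2 : R) : Prop :=
  [/\ 0 <= l1 < L1 /\ 0 <= l2 < L1, 0 < m1 /\ 0 < m2, t1 < 0 /\ t2 < 0 &
      0 < Num.min (L1 - l1) (L1 - l2) ^+ 2 / (L1 ^+ 2 * Num.max m1 m2) * S ^+ 2
          + 2 * (t1 + t2) * vol Om].

Definition A2 (l1 m1 t1 l2 m2 t2 : R) : Prop :=
  [/\ 0 <= l1 < L1, 0 < m1 /\ 0 < m2, t1 < 0 /\ t2 < 0 &
      0 < (L1 - l1) ^+ 2 / (L1 ^+ 2 * Num.max m1 m2) * S ^+ 2
          + 2 * (t1 + t2 * expR (- (l2 / t2))) * vol Om].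

Definition A3 (l1 m1 t1 l2 m2 t2 : R) : Prop :=
  [/\ 0 < m1 /\ 0 < m2, t1 < 0 /\ t2 < 0 &
      0 < 1 / Num.max m1 m2 * S ^+ 2
          + 2 * (t1 * expR (- (l1 / t1)) + t2 * expR (- (l2 / t2))) * vol Om].

Definition admissible (l1 m1 t1 l2 m2 t2 : R) : Prop :=
  [\/ A1 l1 m1 t1 l2 m2 t2, A2 l1 m1 t1 l2 m2 t2 | A3 l1 m1 t1 l2 m2 t2].

End Admissible.

(* Main.v *)
From HB Require Import structures.
Require Import Defs.
From mathcomp Require Import measurable_realfun ring lra.
Import Order.TTheory GRing.Theory Num.Theory.
Import numFieldNormedType.Exports.
Local Open Scope classical_set_scope.
Local Open Scope ring_scope.

Set Implicit Arguments.
Unset Strict Implicit.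
Unset Printing Implicit Defensive.

(** One component of the solution can be taken to be 0: then its equation holds, the
    coupling term disappears from the other one, and it remains to find a nonnegative
    nonzero weak solution of the single critical equation
    [- Laplacian u = l * u + m * u ^+ 3 + t * slogs2 u] with [t < 0]. In each of the three
    admissible sets the condition on the parameters, weakened by dropping the other
    component, is what one of the two equations needs. For positive [b] the condition is
    imposed on larger coefficients than [m1] and [m2], which is stronger.

    The single equation is solved by minimization on a ball ([log_critical_solution]). Let
    [A] be the Dirichlet energy. The logarithmic term is bounded below by a constant
    proportional to the volume, the linear term is absorbed either in the energy, below
    the first eigenvalue ([first_eigenvalue_le]), or in the logarithm
    ([integral_logprim_le]), and the Sobolev inequality controls the quartic term. The
    action is therefore at least [c * A / 2 - m * A ^+ 2 / (4 * S ^+ 2) - kappa], which the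
    threshold condition makes positive at its maximum ([barrier]). Small multiples of a
    test function have negative action, because the logarithm tends to minus infinity at
    0 ([action_neg]). A sequence minimizing the action on the ball thus stays strictly
    inside it; replacing functions by smoothed absolute values makes it nonnegative
    ([nonneg_competitor]).

    By Rellich's theorem the sequence converges in L2 to some [u]. The critical power is
    not continuous for this convergence, but its increments in the direction of a fixed
    test function are ([prim_shift_close]), and this suffices for [u] to solve the
    equation against test functions ([variational_limit]). If [u] were 0, the terms of the
    action other than the energy and the quartic term would not be positive in the limit
    while the energy dominates the quartic term on the ball, so that the action would not
    stay below a negative constant ([action_liminf]).

    All functionals are evaluated at test functions only. That [u] lies in H10 is shown at
    the end by minimizing the energy among the test functions close to [u]
    ([H10_closure]), and the equation extends from test functions to H10 because these
    functions lie in L4 ([L4_bound], [distributional_weak_solution]). The same variational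
    limit shows that the infimum of the Rayleigh quotient over test functions is an
    eigenvalue. Rellich's theorem is proved from a Poincare inequality on small cubes,
    whose double integral form reduces to lines by Tonelli's theorem. *)

(** * Integrals of real functions and the space L2 *)

Section L2.
Context d (T : measurableType d) (R : realType).
Variables (mu : {measure set T -> \bar R}) (D : set T).
Hypothesis mD : measurable D.
Implicit Types f g h : T -> R.

(** Real-valued integrability and integrals: inequalities between integrals are then
    combined by linear arithmetic, without extended reals. *)
Definition intg f := mu.-integrable D (fun x => (f x)%:E).
Notation I f := (\int[mu]_(x in D) f x).
Notation mf f := (measurable_fun D f).

Lemma intg_mf f : intg f -> mf f.
Proof. by move=> /integrableP[/measurable_EFinP]. Qed.

Lemma intgD f g : intg f -> intg g -> intg (fun x => f x + g x).
Proof. by move=> hf hg; have := integrableD mD hf hg. Qed.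

Lemma intgZ a f : intg f -> intg (fun x => a * f x).
Proof. by move=> hf; have := integrableZl mD a hf. Qed.

Lemma intgB f g : intg f -> intg g -> intg (fun x => f x - g x).
Proof. by move=> hf hg; have := integrableB mD hf hg. Qed.

Lemma intg0 : intg (fun=> 0).
Proof. exact: integrable0. Qed.

Lemma intg_norm f : intg f -> intg (fun x => `|f x|).
Proof. by move=> hf; have := integrable_norm hf. Qed.

Lemma intg_sum n (F : 'I_n -> T -> R) : (forall i, intg (F i)) ->
  intg (fun x => \sum_(i < n) F i x).
Proof.
move=> hF; have := @integrable_sum _ _ _ mu D mD _ (index_enum 'I_n) xpredT
  (fun i x => (F i x)%:E) (fun i _ => hF i).
by apply: eq_integrable => // x _; rewrite /= sumEFin.
Qed.

Lemma intg_le f g : mf f -> intg g -> (forall x, D x -> `|f x| <= g x) -> intg f.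
Proof.
move=> mf hg fg; apply: le_integrable hg => //; first exact/measurable_EFinP.
by move=> x Dx /=; rewrite lee_fin (le_trans (fg x Dx))// ler_norm.
Qed.

Lemma intg_eq f g : (forall x, D x -> f x = g x) -> intg f -> intg g.
Proof.
by move=> fg; apply: eq_integrable => // x /set_mem Dx; rewrite fg.
Qed.

Lemma Ieq f g : (forall x, D x -> f x = g x) -> I f = I g.
Proof. by move=> fg; apply: eq_Rintegral => x /set_mem; exact: fg. Qed.

Lemma I0 : I (fun=> 0) = 0.
Proof. by rewrite Rintegral_cst// mul0r. Qed.

Lemma ID f g : intg f -> intg g -> I (fun x => f x + g x) = I f + I g.
Proof. exact: RintegralD. Qed.

Lemma IB f g : intg f -> intg g -> I (fun x => f x - g x) = I f - I g.
Proof. exact: RintegralB. Qed.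

Lemma IZ a f : intg f -> I (fun x => a * f x) = a * I f.
Proof. by move=> hf; exact: RintegralZl. Qed.

Lemma IN f : intg f -> I (fun x => - f x) = - I f.
Proof.
by move=> hf; rewrite -mulN1r -IZ//; apply: Ieq => x _; rewrite mulN1r.
Qed.

Lemma Isum n (F : 'I_n -> T -> R) : (forall i, intg (F i)) ->
  I (fun x => \sum_(i < n) F i x) = \sum_(i < n) I (F i).
Proof.
elim: n F => [|n IH] F hF.
  by rewrite big_ord0 -[RHS]I0; apply: Ieq => x _; rewrite big_ord0.
rewrite big_ord_recr /= -IH// -ID//; last exact: intg_sum.
by apply: Ieq => x _; rewrite big_ord_recr.
Qed.

Lemma Ile f g : intg f -> intg g -> (forall x, D x -> f x <= g x) -> I f <= I g.
Proof. by move=> hf hg; exact: le_Rintegral. Qed.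

Lemma Ige0 f : (forall x, D x -> 0 <= f x) -> 0 <= I f.
Proof. exact: Rintegral_ge0. Qed.

Lemma Inorm f : intg f -> `|I f| <= I (fun x => `|f x|).
Proof. by move=> hf; exact: le_normr_Rintegral. Qed.

Lemma I_EFin f : intg f -> (I f)%:E = (\int[mu]_(x in D) (f x)%:E)%E.
Proof. by move=> hf; rewrite /Rintegral fineK//; exact: integrable_fin_num. Qed.

(** How a bound on an extended integral, as monotone limits give, yields
    integrability. *)
Lemma intg_ge0_bound f M : mf f -> (forall x, D x -> 0 <= f x) ->
  (\int[mu]_(x in D) (f x)%:E <= M%:E)%E -> intg f /\ I f <= M.
Proof.
move=> mf f0 h.
have hf : intg f.
  apply/integrableP; split; first exact/measurable_EFinP.
  under eq_integral.
    by move=> x /set_mem Dx; rewrite /= ger0_norm ?f0//; over.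
  exact: le_lt_trans h (ltry _).
by split => //; rewrite -lee_fin I_EFin.
Qed.

Definition L2 f := mf f /\ intg (fun x => f x ^+ 2).

Lemma L2_mul f g : L2 f -> L2 g -> intg (fun x => f x * g x).
Proof.
move=> [mf hf] [mg hg]; apply: (intg_le _ (intgD hf hg)).
  exact: measurable_funM.
move=> x _; rewrite ler_norml; apply/andP; split.
  by have := sqr_ge0 (f x + g x); nra.
by have := sqr_ge0 (f x - g x); nra.
Qed.

Lemma L2D f g : L2 f -> L2 g -> L2 (fun x => f x + g x).
Proof.
move=> hf hg; split; first exact: measurable_funD hf.1 hg.1.
apply: (@intg_eq (fun x => f x ^+ 2 + (2 * (f x * g x) + g x ^+ 2))).
  by move=> x _; ring.
apply: intgD hf.2 _; apply: intgD hg.2; exact/intgZ/L2_mul.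
Qed.

Lemma L2Z a f : L2 f -> L2 (fun x => a * f x).
Proof.
move=> hf; split; first by apply: measurable_funM => //; exact: hf.1.
apply: (@intg_eq (fun x => a ^+ 2 * f x ^+ 2)).
  by move=> x _; rewrite exprMn.
exact: intgZ hf.2.
Qed.

Lemma L2N f : L2 f -> L2 (fun x => - f x).
Proof.
move=> /(L2Z (-1)) hf; suff -> : (fun x => - f x) = (fun x => -1 * f x) by [].
by apply/funext => x; rewrite mulN1r.
Qed.

Lemma L2B f g : L2 f -> L2 g -> L2 (fun x => f x - g x).
Proof. by move=> hf /L2N; exact: L2D. Qed.

Lemma L2_0 : L2 (fun=> 0).
Proof.
split => //.
by apply: (@intg_eq (fun=> 0)); [move=> x _; rewrite expr0n | exact: intg0].
Qed.

Lemma L2_norm f : L2 f -> L2 (fun x => `|f x|).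
Proof.
move=> [mf hf]; split; first exact: measurableT_comp.
by apply: (intg_eq _ hf) => x _; rewrite real_normK ?num_real.
Qed.

Lemma L2_eq f g : (forall x, D x -> f x = g x) -> L2 f -> L2 g.
Proof.
move=> fg [mf hf]; split.
  by apply: eq_measurable_fun mf => x /set_mem; exact: fg.
by apply: intg_eq hf => x Dx; rewrite fg.
Qed.

Lemma I_sqrD a f g : L2 f -> L2 g ->
  I (fun x => (f x + a * g x) ^+ 2) =
  I (fun x => f x ^+ 2) + (2 * a) * I (fun x => f x * g x) +
  a ^+ 2 * I (fun x => g x ^+ 2).
Proof.
move=> hf hg; have hfg := L2_mul hf hg.
rewrite -!IZ ?hg.2// -ID ?hf.2//; last exact: intgZ.
rewrite -ID; last 2 first.
- by apply: intgD hf.2 _; exact: intgZ.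
- exact: intgZ hg.2.
by apply: Ieq => x _; ring.
Qed.

(** The quadratic polynomial [a |-> I ((f + a * g) ^+ 2)] is nonnegative, so its
    discriminant is not positive. *)
Lemma I_CS f g : L2 f -> L2 g ->
  I (fun x => f x * g x) ^+ 2 <=
  I (fun x => f x ^+ 2) * I (fun x => g x ^+ 2).
Proof.
move=> hf hg.
have key a : 0 <= I (fun x => f x ^+ 2) + (2 * a) * I (fun x => f x * g x) +
    a ^+ 2 * I (fun x => g x ^+ 2).
  by rewrite -I_sqrD//; apply: Ige0 => x _; exact: sqr_ge0.
set F' := Rintegral _ _ (fun x => f x ^+ 2) in key *.
set P := Rintegral _ _ (fun x => f x * g x) in key *.
set G := Rintegral _ _ (fun x => g x ^+ 2) in key *.
have G0 : 0 <= G by apply: Ige0 => x _; exact: sqr_ge0.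
have F0 : 0 <= F' by apply: Ige0 => x _; exact: sqr_ge0.
(* When the quadratic coefficient G vanishes the polynomial is affine and bounded
   below, hence constant; otherwise it is evaluated at its minimum - P / G. *)
have [G0'|Gn0] := eqVneq G 0.
  have [->|P0] := eqVneq P 0; first by rewrite expr0n G0' mulr0.
  have := key (- (F' + 1) / P).
  have -> : 2 * (- (F' + 1) / P) * P = - 2 * (F' + 1) by field.
  by rewrite G0' mulr0; lra.
have Gp : 0 < G by rewrite lt_def Gn0.
have := key (- P / G).
have -> : F' + 2 * (- P / G) * P + (- P / G) ^+ 2 * G = (F' * G - P ^+ 2) / G.
  by field; rewrite Gn0.
by rewrite pmulr_lge0 ?invr_gt0// subr_ge0.
Qed.

Definition N2 f := Num.sqrt (I (fun x => f x ^+ 2)).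

Lemma N2_ge0 f : 0 <= N2 f. Proof. exact: sqrtr_ge0. Qed.

Lemma N2_sqr f : N2 f ^+ 2 = I (fun x => f x ^+ 2).
Proof. by rewrite sqr_sqrtr//; apply: Ige0 => x _; exact: sqr_ge0. Qed.

Lemma I_CS_N2 f g : L2 f -> L2 g -> `|I (fun x => f x * g x)| <= N2 f * N2 g.
Proof.
move=> hf hg; rewrite -(@ler_pXn2r _ 2)// ?nnegrE ?mulr_ge0 ?N2_ge0//.
by rewrite exprMn !N2_sqr real_normK ?num_real// I_CS.
Qed.

Lemma I_CS_norm f g : L2 f -> L2 g -> I (fun x => `|f x * g x|) <= N2 f * N2 g.
Proof.
move=> hf hg; have := I_CS_N2 (L2_norm hf) (L2_norm hg).
have -> : N2 (fun x => `|f x|) = N2 f.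
  by congr Num.sqrt; apply: Ieq => x _; rewrite real_normK ?num_real.
have -> : N2 (fun x => `|g x|) = N2 g.
  by congr Num.sqrt; apply: Ieq => x _; rewrite real_normK ?num_real.
move=> h; apply: le_trans h; rewrite le_eqVlt; apply/orP; left; apply/eqP.
rewrite ger0_norm; last by apply: Ige0 => x _; rewrite mulr_ge0.
by apply: Ieq => x _; rewrite normrM.
Qed.

Lemma N2D f g : L2 f -> L2 g -> N2 (fun x => f x + g x) <= N2 f + N2 g.
Proof.
move=> hf hg; rewrite -(@ler_pXn2r _ 2)// ?nnegrE ?addr_ge0 ?N2_ge0//.
have -> : N2 (fun x => f x + g x) ^+ 2 =
    N2 f ^+ 2 + 2 * I (fun x => f x * g x) + N2 g ^+ 2.
  rewrite !N2_sqr; have := I_sqrD 1 hf hg.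
  rewrite mulr1 expr1n mul1r => <-; apply: Ieq => x _; by rewrite mul1r.
by have /ler_normlP[_] := I_CS_N2 hf hg; rewrite sqrrD mulr2n; lra.
Qed.

Lemma N2B f g h : L2 f -> L2 g -> L2 h ->
  N2 (fun x => f x - h x) <= N2 (fun x => f x - g x) + N2 (fun x => g x - h x).
Proof.
move=> hf hg hh; apply: le_trans (N2D (L2B hf hg) (L2B hg hh)).
by rewrite le_eqVlt; apply/orP; left; apply/eqP; congr Num.sqrt;
   apply: Ieq => x _; ring.
Qed.

Lemma N2Z a f : L2 f -> N2 (fun x => a * f x) = `|a| * N2 f.
Proof.
move=> hf; rewrite /N2 -sqrtr_sqr -sqrtrM ?sqr_ge0// -IZ ?hf.2//.
by congr Num.sqrt; apply: Ieq => x _; rewrite exprMn.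
Qed.

Lemma N2C f g : N2 (fun x => f x - g x) = N2 (fun x => g x - f x).
Proof. by congr Num.sqrt; apply: Ieq => x _; ring. Qed.

End L2.

(** * Completeness of L2 *)

(** The increments are summable, and the tail of a geometric series is of the order
    of its first term. *)
Lemma fast_cauchy_cvg (R : realType) (a : nat -> R) (s : R) :
  (forall k, `|a k.+1 - a k| <= s * 2^-1 ^+ k) ->
  exists l, a @ \oo --> l /\ forall k, `|a k - l| <= 2 * s * 2^-1 ^+ k.
Proof.
move=> ha.
have s0 : 0 <= s by have := ha 0; rewrite expr0 mulr1; apply: le_trans.
have p k : 0 <= 2^-1 ^+ k :> R by rewrite exprn_ge0// invr_ge0.
have hjk k j : `|a (k + j)%N - a k| <= 2 * s * (2^-1 ^+ k - 2^-1 ^+ (k + j)).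
  elim: j => [|j IH]; first by rewrite addn0 !subrr normr0 mulr0.
  have := ha (k + j)%N; rewrite -addnS.
  have -> : a (k + j.+1)%N - a k =
    (a (k + j.+1)%N - a (k + j)%N) + (a (k + j)%N - a k) by ring.
  move=> h; apply: le_trans (ler_normD _ _) _.
  apply: le_trans (lerD h IH) _.
  rewrite (addnS k j) exprS; have := p (k + j)%N; set q := _ ^+ (k + j); nra.
have hb k j : `|a (k + j)%N - a k| <= 2 * s * 2^-1 ^+ k.
  apply: le_trans (hjk k j) _; apply: ler_wpM2l; first by rewrite mulr_ge0.
  by rewrite gerBl.
have q0 : (fun k => 2 * s * 2^-1 ^+ k : R) @ \oo --> (0 : R).
  rewrite -[X in _ --> X](mulr0 (2 * s)); apply: cvgMr.
  by apply: cvg_expr; rewrite ger0_norm ?invr_ge0// invf_lt1// ltr1n.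
have hc : cvgn a.
  apply/cauchy_cvgP/cauchy_exP => e e0.
  have [N _ hN] : \forall k \near \oo, 2 * s * 2^-1 ^+ k < e.
    have := cvgr_lt _ q0; exact.
  exists (a N); exists N => // n /= Nn.
  rewrite /ball /= distrC -(subnKC Nn).
  by apply: le_lt_trans (hb _ _) _; apply: hN => /=.
exists (limn a); split => // k.
have hl : (fun j => `|a k - a (k + j)%N|) @ \oo --> `|a k - limn a|.
  apply: cvg_norm; apply: cvgB; first exact: cvg_cst.
  have : a @ \oo --> limn a by [].
  by rewrite -(cvg_shiftn k); under eq_fun do rewrite addnC.
rewrite -(cvg_lim _ hl)//; apply: limr_le; first by apply/cvg_ex; exists `|a k - limn a|.
by near=> j; rewrite distrC.
Unshelve. all: end_near. Qed.

Section complete.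
Context d (T : measurableType d) (R : realType).
Variables (mu : {measure set T -> \bar R}) (D : set T).
Hypothesis mD : measurable D.
Notation I f := (\int[mu]_(x in D) f x).

(** Weighting the squared increments by [4 ^+ k] before summing makes the sum
    [h] integrable while its finiteness at a point still forces geometric
    convergence there. *)
Lemma L2_complete (f : nat -> T -> R) : (forall k, L2 mu D (f k)) ->
  (forall k, I (fun x => (f k.+1 x - f k x) ^+ 2) <= 16^-1 ^+ k) ->
  exists u, L2 mu D u /\
    forall k, I (fun x => (f k x - u x) ^+ 2) <= 8 * 4^-1 ^+ k.
Proof.
move=> hf hI.
pose g k x := 4 ^+ k * (f k.+1 x - f k x) ^+ 2.
have g0 k x : 0 <= g k x by rewrite mulr_ge0 ?sqr_ge0 ?exprn_ge0.
have ig k : intg mu D (g k) by apply: intgZ (L2B mD (hf k.+1) (hf k)).2.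
have mg k : measurable_fun D (fun x => (g k x)%:E).
  exact/measurable_EFinP/intg_mf/ig.
pose h x := (\sum_(0 <= k <oo) (g k x)%:E)%E.
have h0 x : (0 <= h x)%E by apply: nneseries_ge0 => k _ _; rewrite lee_fin.
have mh : measurable_fun D h.
  by apply: ge0_emeasurable_sum => // k x _ _; rewrite lee_fin.
have geo n : \sum_(0 <= k < n) 4^-1 ^+ k <= 2 - 2 * 4^-1 ^+ n :> R.
  elim: n => [|n IH]; first by rewrite big_nil expr0; lra.
  rewrite big_nat_recr//= exprS.
  have : 4^-1 ^+ n <= 1 :> R by rewrite exprn_ile1 //; lra.
  have : 0 <= 4^-1 ^+ n :> R by rewrite exprn_ge0; lra.
  by move: IH; lra.
have Ih : (\int[mu]_(x in D) h x <= 2%:E)%E.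
  rewrite integral_nneseries//; last by move=> k x _; rewrite lee_fin.
  apply: lime_le.
    by apply: is_cvg_nneseries => k _ _; apply: integral_ge0 => x _; rewrite lee_fin.
  near=> n.
  apply: (@le_trans _ _ (\sum_(0 <= k < n) (4^-1 ^+ k)%:E)%E).
    apply: lee_sum => k _; rewrite -I_EFin// lee_fin /g IZ//; last first.
      exact: (L2B mD (hf k.+1) (hf k)).2.
    apply: le_trans (ler_wpM2l _ (hI k)) _; first exact: exprn_ge0.
    rewrite -exprMn; apply: lerXn2r; rewrite ?nnegrE; lra.
  rewrite sumEFin lee_fin.
  by apply: le_trans (geo n) _; rewrite gerBl mulr_ge0// exprn_ge0// invr_ge0.
have key x : (h x < +oo)%E -> exists l, f ^~ x @ \oo --> l /\
    forall k, (f k x - l) ^+ 2 <= 4 * 4^-1 ^+ k * fine (h x).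
  move=> hx; have fx : h x \is a fin_num by rewrite ge0_fin_numE.
  have H0 : 0 <= fine (h x) by rewrite fine_ge0.
  have gk k : g k x <= fine (h x).
    rewrite -lee_fin fineK//.
    apply: (@le_trans _ _ (\sum_(0 <= i < k.+1) (g i x)%:E)%E).
      by rewrite big_nat_recr//= leeDr// sume_ge0// => i _; rewrite lee_fin.
    by apply: nneseries_lim_ge => i _; rewrite lee_fin.
  have [k|l [hl1 hl2]] := @fast_cauchy_cvg _ (f ^~ x) (Num.sqrt (fine (h x))).
    rewrite -(@ler_pXn2r _ 2)// ?nnegrE ?mulr_ge0 ?sqrtr_ge0 ?exprn_ge0 ?invr_ge0//.
    rewrite real_normK ?num_real// exprMn sqr_sqrtr// -exprM mulnC exprM.
    have -> : 2^-1 ^+ 2 = 4^-1 :> R by field.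
    have := gk k; rewrite /g exprVn mulrC.
    by rewrite -ler_pdivlMr ?exprn_gt0.
  exists l; split=> // k; rewrite -real_normK ?num_real//.
  have -> : 4 * 4^-1 ^+ k * fine (h x) =
     (2 * Num.sqrt (fine (h x)) * 2^-1 ^+ k) ^+ 2.
    rewrite !exprMn sqr_sqrtr// -exprM mulnC exprM.
    have -> : 2^-1 ^+ 2 = 4^-1 :> R by field.
    by ring.
  apply: lerXn2r => //; rewrite nnegrE.
  by rewrite mulr_ge0 ?exprn_ge0 ?invr_ge0// mulr_ge0// sqrtr_ge0.
pose u x := if (h x < +oo)%E then lim (f ^~ x @ \oo) else 0.
have mhb : measurable_fun D (fun x => (h x < +oo)%E).
  exact: measurable_fun_lte.
have mu_ : measurable_fun D u.
  apply: (@measurable_fun_cvg _ _ _ _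
     (fun k x => if (h x < +oo)%E then f k x else 0)) => [k|x Dx].
    apply: measurable_fun_if => //.
    by apply: measurable_funS mD _ (hf k).1 => x [].
  rewrite /u; case: ifPn => hx; last exact: cvg_cst.
  have [l [hl _]] := key _ hx; exact: (cvgP _ hl).
have hb k : intg mu D (fun x => (f k x - u x) ^+ 2) /\
    I (fun x => (f k x - u x) ^+ 2) <= 8 * 4^-1 ^+ k.
  apply: intg_ge0_bound => //.
  - by apply: measurable_funX; apply: measurable_funB => //; exact: (hf k).1.
  - by move=> x _; exact: sqr_ge0.
  have c0 : (0 <= (4 * 4^-1 ^+ k : R)%:E)%E.
    by rewrite lee_fin mulr_ge0// exprn_ge0// invr_ge0.
  apply: (@le_trans _ _ (\int[mu]_(x in D) ((4 * 4^-1 ^+ k)%:E * h x))%E).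
    apply: ge0_le_integral => //.
    - by move=> x _; rewrite lee_fin sqr_ge0.
    - apply/measurable_EFinP; apply: measurable_funX.
      by apply: measurable_funB => //; exact: (hf k).1.
    - exact: measurable_funeM.
    move=> x _; have [hx|hx] := ltP (h x) +oo%E; last first.
      have -> : h x = +oo%E by apply/eqP; rewrite -leye_eq.
      rewrite gt0_muley ?leey// lte_fin mulr_gt0// exprn_gt0// invr_gt0//.
    have [l [hl1 hl2]] := key _ hx.
    rewrite /u hx (cvg_lim _ hl1)//.
    have <- : (fine (h x))%:E = h x by rewrite fineK// ge0_fin_numE.
    by rewrite -EFinM lee_fin.
  rewrite ge0_integralZl//.
  apply: (le_trans (lee_wpmul2l c0 Ih)) => //.
  by rewrite -EFinM lee_fin; lra.
exists u; split; last by move=> k; exact: (hb k).2.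
have h0u : L2 mu D (fun x => f 0%N x - u x).
  by split; [apply: measurable_funB => //; exact: (hf 0%N).1|exact: (hb 0%N).1].
by apply: (L2_eq mD _ (L2B mD (hf 0%N) h0u)) => x _; ring.
Unshelve. all: end_near. Qed.

End complete.

(** * Measurability of open sets and continuous functions *)

(** Lebesgue measure lives on a product sigma-algebra while open sets come from a
    product topology; a countable base of measurable sets, a property that passes
    to products, links the two. The neighbourhoods are a parameter because the
    measurable types carry no topology. *)
Definition countable_base T (nb : T -> set_system T) (M : set (set T)) :=
  exists (I : countType) (B : I -> set T), (forall i, M (B i)) /\
    forall x U, nb x U -> exists i, B i x /\ B i `<=` U.

Lemma countable_base_real (R : realType) :
  countable_base (@nbhs R R) (@measurable _ (measurableTypeR R)).
Proof.
exists (rat * rat)%type, (fun q => `]ratr q.1, ratr q.2[%classic); split.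
  by move=> i; exact: measurable_itv.
move=> x U /nbhs_ballP[e /= e0 eU].
have [a] : exists q : rat, ratr q \in `]x - e, x[.
  by apply: rat_in_itvoo; rewrite gtrBl.
rewrite in_itv /= => /andP[a1 a2].
have [b] : exists q : rat, ratr q \in `]x, x + e[.
  by apply: rat_in_itvoo; rewrite ltrDl.
rewrite in_itv /= => /andP[b1 b2].
exists (a, b) => /=; split; first by rewrite in_itv /= a2 b1.
move=> y; rewrite /= in_itv /= => /andP[y1 y2]; apply: eU; rewrite /ball /=.
by rewrite ltr_norml; apply/andP; split; lra.
Qed.

Lemma countable_base_prod d1 d2 (T1 : measurableType d1) (T2 : measurableType d2)
    (nb1 : T1 -> set_system T1) (nb2 : T2 -> set_system T2)
    (nb : T1 * T2 -> set_system (T1 * T2)) :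
  (forall x U, nb x U -> exists2 A, nb1 x.1 A.1 /\ nb2 x.2 A.2 & A.1 `*` A.2 `<=` U) ->
  countable_base nb1 measurable -> countable_base nb2 measurable ->
  countable_base nb (@measurable _ (T1 * T2)%type).
Proof.
move=> hnb [I1 [B1 [m1 b1]]] [I2 [B2 [m2 b2]]].
exists (I1 * I2)%type, (fun i => B1 i.1 `*` B2 i.2); split.
  by move=> i; exact: measurableX.
move=> x U /hnb[A [/b1[i1 [h1 s1]] /b2[i2 [h2 s2]]] AU].
exists (i1, i2); split; first by split.
by move=> y [/= y1 y2]; apply: AU; split; [exact: s1|exact: s2].
Qed.

Section R4.
Variable R : realType.
Notation mR4 := (measurableTypeR R * measurableTypeR R *
    measurableTypeR R * measurableTypeR R)%type.

Lemma countable_base_R4 : countable_base (@nbhs (R4 R) (R4 R)) (@measurable _ mR4).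
Proof.
have c1 := countable_base_real R.
have c2 := @countable_base_prod _ _ _ _ _ _ (@nbhs (R * R)%type (R * R)%type)
  (fun x U h => h) c1 c1.
have c3 := @countable_base_prod _ _ _ _ _ _ (@nbhs (R * R * R)%type (R * R * R)%type)
  (fun x U h => h) c2 c1.
exact: (@countable_base_prod _ _ _ _ _ _ (@nbhs (R4 R) (R4 R)) (fun x U h => h) c3 c1).
Qed.

Lemma open_measurable_R4 (U : set (R4 R)) : open U -> @measurable _ mR4 U.
Proof.
have [I [B [mB bB]]] := countable_base_R4.
move=> oU.
have -> : U = \bigcup_(i in [set: I]) (if `[< B i `<=` U >] then B i else set0).
  apply/seteqP; split => [x Ux|x [i _]].
    have [i [Bi BU]] := bB x U (open_nbhs_nbhs (conj oU Ux)).
    by exists i => //; rewrite asboolT.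
  by case: ifPn => // /asboolP; exact.
by apply: countable_bigcupT_measurable => [|i]; [exact: countableP|case: ifPn].
Qed.

Lemma continuous_measurable_R4 (f : R4 R -> R) : continuous f ->
  @measurable_fun _ _ mR4 (measurableTypeR R) setT f.
Proof.
move=> /continuousP cf; apply: (measurability _ (RGenOpens.measurableE R)).
move=> _ [_ [a [b ->] <-]]; rewrite setTI; apply: open_measurable_R4.
exact/cf/interval_open.
Qed.

End R4.

(** * Smooth functions *)

Section slices.
Variables (R : realType) (V : normedModType R).

(** Directional derivatives reduce to derivatives of functions of one variable, where
    the chain rule applies. *)
Lemma is_derive_slice (f : V -> R) (x v : V) (df : R) :
  is_derive x v f df <-> is_derive (0 : R) 1 (fun h : R => f (h *: v + x)) df.
Proof.
have E : 'D_v f x = 'D_1 (fun h : R => f (h *: v + x)) 0.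
  rewrite /derive /=; under [in RHS]eq_fun do
    rewrite scale0r add0r addr0 [X in X *: v]/GRing.scale /= mulr1.
  by [].
split => -[h1 h2]; split.
- exact: (derivable1P f x v).1.
- by rewrite -E.
- exact: (derivable1P f x v).2.
- by rewrite E.
Qed.

Lemma is_derive_comp (g : R -> R) (f : V -> R) (x v : V) (dg df : R) :
  is_derive (f x) 1 g dg -> is_derive x v f df ->
  is_derive x v (g \o f) (dg * df).
Proof.
move=> hg /is_derive_slice hf; apply/is_derive_slice.
by apply: is_derive1_comp; rewrite ?scale0r ?add0r.
Qed.

End slices.

Lemma is_derive_slice_at (R : realType) (V : normedModType R) (f : V -> R) (x v : V) (t : R) (df : R) :
  is_derive (t *: v + x) v f df -> is_derive t 1 (fun h : R => f (h *: v + x)) df.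
Proof.
move=> /is_derive_slice; rewrite [X in _ -> X]is_derive_slice.
suff -> : (fun h : R => f (h *: v + (t *: v + x))) =
  (fun h : R => f ((h *: 1 + t) *: v + x)) by [].
by apply/funext => h; rewrite addrA -scalerDl /GRing.scale /= mulr1.
Qed.


Section smooth.
Variable R : realType.
Implicit Types (f g : R4 R -> R).

(** Smooth functions are the largest class of continuous functions with partial
    derivatives in the class, so that smoothness can be proved by coinduction. *)
Lemma smooth_coind (P : (R4 R -> R) -> Prop) :
  (forall f, P f -> continuous f /\
     forall i, (forall x, derivable f x (basis R i)) /\ P (partial i f)) ->
  forall f, P f -> smooth f.
Proof.
move=> hP f Pf s; have {Pf}: P (foldr (@partial R) f s).
  by elim: s => //= i s /hP[_ /(_ i)[]].
by move=> /hP[h1 h2]; split => // i x; have [] := h2 i.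
Qed.

Lemma smooth_continuous f : smooth f -> continuous f.
Proof. by move=> /(_ [::]) []. Qed.

Lemma smooth_derivable f i x : smooth f -> derivable f x (basis R i).
Proof. by move=> /(_ [::]) []. Qed.

Lemma smooth_partial f i : smooth f -> smooth (partial i f).
Proof. by move=> hf s; have := hf (rcons s i); rewrite foldr_rcons. Qed.

Lemma smooth_is_derive f i x : smooth f -> is_derive x (basis R i) f (partial i f x).
Proof. by move=> hf; split => //; exact: smooth_derivable. Qed.

Lemma is_derive_partial f i (df : R4 R -> R) :
  (forall x, is_derive x (basis R i) f (df x)) -> partial i f = df.
Proof. by move=> h; apply/funext => x; rewrite /partial derive_val. Qed.

(** By the product rule it is enough to differentiate the generators: if their partial
    derivatives stay in the algebra, the whole algebra is smooth. *)
Inductive generated (B : (R4 R -> R) -> Prop) : (R4 R -> R) -> Prop :=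
| gen_base f : B f -> generated B f
| gen_cst c : generated B (fun=> c)
| gen_add f g : generated B f -> generated B g -> generated B (fun x => f x + g x)
| gen_mul f g : generated B f -> generated B g -> generated B (fun x => f x * g x).

Lemma smooth_generated (B : (R4 R -> R) -> Prop) :
  (forall f, B f -> continuous f /\ forall i, exists df : R4 R -> R,
     (forall x, is_derive x (basis R i) f (df x)) /\ generated B df) ->
  forall f, generated B f -> smooth f.
Proof.
move=> hB; apply: smooth_coind => f gf.
suff [cf hf] : continuous f /\ forall i, exists df : R4 R -> R,
     (forall x, is_derive x (basis R i) f (df x)) /\ generated B df.
  split => // i; have [df [h1 h2]] := hf i; split; first by move=> x; have [] := h1 x.
  by rewrite (is_derive_partial h1).
elim: f / gf => [f Bf|c|f g gf [cf hf] gg [cg hg]|f g gf [cf hf] gg [cg hg]].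
- exact: hB.
- split; first exact: cst_continuous.
  by move=> i; exists (fun=> 0); split; [move=> x; exact: is_derive_cst | exact: gen_cst].
- split; first by move=> x; apply: continuousD; [exact: cf|exact: cg].
  move=> i; have [df [h1 h2]] := hf i; have [dg [k1 k2]] := hg i.
  by exists (fun x => df x + dg x); split; [move=> x; exact: is_deriveD|exact: gen_add].
- split; first by move=> x; apply: continuousM; [exact: cf|exact: cg].
  move=> i; have [df [h1 h2]] := hf i; have [dg [k1 k2]] := hg i.
  exists (fun x => f x * dg x + g x * df x); split; first by move=> x; exact: is_deriveM.
  by apply: gen_add; exact: gen_mul.
Qed.

Lemma smooth_algebra f : generated (@smooth R) f -> smooth f.
Proof.
apply: smooth_generated => {}f sf; split; first exact: smooth_continuous.
move=> i; exists (partial i f); split; first by move=> x; exact: smooth_is_derive.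
exact/gen_base/smooth_partial.
Qed.

Lemma smooth_cst c : smooth (fun _ : R4 R => c).
Proof. exact/smooth_algebra/gen_cst. Qed.

Lemma smoothD f g : smooth f -> smooth g -> smooth (fun x => f x + g x).
Proof. by move=> sf sg; apply/smooth_algebra/gen_add; exact: gen_base. Qed.

Lemma smoothM f g : smooth f -> smooth g -> smooth (fun x => f x * g x).
Proof. by move=> sf sg; apply/smooth_algebra/gen_mul; exact: gen_base. Qed.

Lemma smoothZ a f : smooth f -> smooth (fun x => a * f x).
Proof. by apply: smoothM; exact: smooth_cst. Qed.

Lemma partialD i f g : smooth f -> smooth g ->
  partial i (fun x => f x + g x) = (fun x => partial i f x + partial i g x).
Proof.
move=> sf sg; apply: is_derive_partial => x.
by apply: is_deriveD; exact: smooth_is_derive.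
Qed.

Lemma partialZ i a f : smooth f ->
  partial i (fun x => a * f x) = (fun x => a * partial i f x).
Proof.
move=> sf; apply: is_derive_partial => x.
by apply: is_deriveZ; exact: smooth_is_derive.
Qed.

(** The smooth approximation of [|f|] by [sqrt (f ^+ 2 + e ^+ 2) - e], which does
    not increase the gradient and vanishes where [f] does. *)
Definition sabs (e : R) f x : R := Num.sqrt (f x ^+ 2 + e ^+ 2) - e.

Section sabs.
Variables (e : R) (e0 : 0 < e) (f : R4 R -> R) (sf : smooth f).
Let r x : R := Num.sqrt (f x ^+ 2 + e ^+ 2).

Let r2_gt0 x : 0 < f x ^+ 2 + e ^+ 2.
Proof. by rewrite ltr_wpDl ?sqr_ge0// exprn_gt0. Qed.

Let r_gt0 x : 0 < r x. Proof. by rewrite sqrtr_gt0. Qed.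

Let dr i x : is_derive x (basis R i) r (f x * partial i f x * (r x)^-1).
Proof.
have h1 : is_derive x (basis R i) (fun x => f x ^+ 2 + e ^+ 2)
    (2 * f x * partial i f x).
  have hf := smooth_is_derive i x sf.
  have h2 := is_deriveD (is_deriveM hf hf) (is_derive_cst (e ^+ 2) x (basis R i)).
  apply: is_derive_eq h2 _.
  by rewrite addr0 /GRing.scale /=; ring.
have := @is_derive_comp _ _ Num.sqrt (fun x => f x ^+ 2 + e ^+ 2) x _ _ _
  (is_derive1_sqrt (r2_gt0 x)) h1.
move=> h2; apply: is_derive_eq h2 _.
have := r_gt0 x; rewrite /r; set q := Num.sqrt _ => q0.
by field; rewrite lt0r_neq0.
Qed.

Lemma partial_sabs i :
  partial i (sabs e f) = (fun x => f x * partial i f x * (r x)^-1).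
Proof.
apply: is_derive_partial => x.
have h2 := is_deriveD (dr i x) (is_derive_cst (- e) x (basis R i)).
by apply: is_derive_eq h2 _; rewrite addr0.
Qed.

(** With [r] the square root of [f ^+ 2 + e ^+ 2], the algebra generated by the smooth
    functions and [1 / r] is stable under partial derivatives, and it contains [r]
    because [r = (f ^+ 2 + e ^+ 2) / r]. *)
Lemma smooth_sabs : smooth (sabs e f).
Proof.
pose B g := smooth g \/ g = (fun x => (r x)^-1).
have sV : generated B (fun x => (r x)^-1) by apply: gen_base; right.
have sB g : smooth g -> generated B g by move=> sg; apply: gen_base; left.
have cr : continuous r.
  move=> x; apply: continuous_comp; last exact: sqrt_continuous.
  apply: (@continuousD _ _ _ (fun x => f x ^+ 2) (cst (e ^+ 2))).
    apply: (@continuous_comp _ _ _ f (fun y => y ^+ 2)); last exact: exprn_continuous.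
    exact: smooth_continuous.
  exact: cst_continuous.
apply: (@smooth_generated B); last first.
  have -> : sabs e f = (fun x => (f x * f x + e ^+ 2) * (r x)^-1 + - e).
    apply/funext => x; rewrite /sabs; congr (_ - _).
    rewrite -expr2 -[in RHS](sqr_sqrtr (ltW (r2_gt0 x))) -/(r x).
    by rewrite expr2 mulfK// lt0r_neq0.
  apply: gen_add; last exact: gen_cst.
  apply: gen_mul => //; apply: gen_add; last exact: gen_cst.
  by apply: gen_mul; exact: sB.
move=> g [sg|->].
  split; first exact: smooth_continuous.
  move=> i; exists (partial i g); split; first by move=> x; exact: smooth_is_derive.
  exact/sB/smooth_partial.
split.
  by move=> x; apply: continuousV; [rewrite lt0r_neq0|exact: cr].
move=> i; exists (fun x => -1 * ((r x)^-1 * (r x)^-1) * (f x * partial i f x * (r x)^-1)).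
split.
  move=> x; have h1 := dr i x.
  have h2 : is_derive (r x) 1 (fun y : R => y^-1) (- (r x) ^- 2 *: 1).
    by apply: is_deriveV; rewrite lt0r_neq0.
  apply: is_derive_eq (is_derive_comp h2 h1) _.
  rewrite /GRing.scale /=; field; by rewrite lt0r_neq0.
apply: gen_mul; first by apply: gen_mul; [exact: gen_cst|exact: gen_mul].
apply: gen_mul => //; apply: gen_mul; apply: sB => //; exact: smooth_partial.
Qed.

Lemma sabs_ge0 x : 0 <= sabs e f x.
Proof.
rewrite /sabs subr_ge0 -{1}(ger0_norm (ltW e0)) -sqrtr_sqr ler_wsqrtr//.
by rewrite lerDr sqr_ge0.
Qed.

Lemma sabs_norm x : `|sabs e f x - `|f x| | <= e.
Proof.
rewrite /sabs -/(r x) ler_norml.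
have h1 : `|f x| <= r x by rewrite -sqrtr_sqr ler_wsqrtr// lerDl sqr_ge0.
suff h2 : r x <= `|f x| + e.
  by move: h1 h2; move: (r x) `|f x| => p q h1 h2; apply/andP; split; lra.
rewrite -(@ler_pXn2r _ 2)// ?nnegrE ?addr_ge0// ?(ltW (r_gt0 x)) ?(ltW e0)//.
rewrite sqr_sqrtr ?(ltW (r2_gt0 x))// sqrrD real_normK ?num_real//.
by rewrite lerD2r lerDl mulrn_wge0// mulr_ge0// ltW.
Qed.

Lemma sabs_eq0 x : f x = 0 -> sabs e f x = 0.
Proof.
by move=> fx; rewrite /sabs fx expr0n add0r sqrtr_sqr ger0_norm ?subrr// ltW.
Qed.

Lemma partial_sabs_le i x : partial i (sabs e f) x ^+ 2 <= partial i f x ^+ 2.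
Proof.
rewrite partial_sabs mulrAC exprMn ler_piMl ?sqr_ge0//.
rewrite exprMn exprVn ler_pdivrMr ?exprn_gt0// mul1r.
by rewrite sqr_sqrtr ?(ltW (r2_gt0 x))// lerDl sqr_ge0.
Qed.

End sabs.

(** The multiples of the functions [h (x0 + c *: x)], with [h] smooth, form a class
    stable under partial derivatives. *)
Lemma smooth_affine f (x0 : R4 R) (c : R) : smooth f ->
  smooth (fun x => f (x0 + c *: x)).
Proof.
move=> sf.
pose P g := exists h a, smooth h /\ g = (fun x => a * h (x0 + c *: x)).
apply: (@smooth_coind P); last by exists f, 1; split => //; apply/funext => x; rewrite mul1r.
move=> _ [h [a [sh ->]]]; split.
  move=> x; apply: continuousM; first exact: cst_continuous.
  apply: (@continuous_comp _ _ _ (fun x : R4 R => x0 + c *: x) h).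
    apply: (@continuousD _ _ _ (fun=> x0) (fun x => c *: x)); first exact: cst_continuous.
    exact: scaler_continuous.
  exact: smooth_continuous.
move=> i.
have H x : is_derive x (basis R i) (fun x => a * h (x0 + c *: x))
    (a * c * partial i h (x0 + c *: x)).
  have h0 : is_derive x (basis R i) (fun x => h (x0 + c *: x))
      (c * partial i h (x0 + c *: x)).
    apply/is_derive_slice.
    have := smooth_is_derive i (0 *: basis R i + (x0 + c *: x)) sh.
    rewrite scale0r add0r => /is_derive_slice h1.
    have h2 : is_derive (0 : R) 1 (fun t : R => c * t) (c *: 1).
      by apply: is_deriveZ; exact: is_derive_id.
    rewrite -[X in is_derive X](mulr0 c) in h1.
    have := is_derive1_comp h1 h2; rewrite /GRing.scale /= mulr1 mulrC.
    suff -> : (fun h0 : R => h (h0 *: basis R i + (x0 + c *: x))) \o (fun t => c * t) =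
      (fun h0 : R => h (x0 + c *: (h0 *: basis R i + x))) by [].
    apply/funext => t /=; congr h; rewrite scalerDr scalerA addrCA; congr (_ + _).
  by apply: is_derive_eq (is_deriveZ a h0) _; rewrite /GRing.scale /=; ring.
split; first by move=> x; have [] := H x.
by rewrite (is_derive_partial H); exists (partial i h), (a * c); split => //; exact: smooth_partial.
Qed.

End smooth.

(** * Test functions *)

Section test.
Variable R : realType.
Implicit Types (f g phi psi : R4 R -> R) (Om : set (R4 R)).
Notation supp f := (closure [set x | f x != 0]).

Lemma test_smooth Om phi : test_function Om phi -> smooth phi.
Proof. by case. Qed.

Lemma closure_neq0 f x : f x != 0 -> supp f x.
Proof. by move=> h; apply: (@subset_closure _ [set x | f x != 0]). Qed.

Lemma test_out Om phi x : test_function Om phi -> ~ Om x -> phi x = 0.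
Proof.
move=> [_ _ h] nx; apply/eqP/negPn/negP => fx; apply/nx/h; exact: closure_neq0.
Qed.

Lemma test_subset Om Om' phi : Om `<=` Om' -> test_function Om phi -> test_function Om' phi.
Proof. by move=> h [h1 h2 h3]; split => // x /h3/h. Qed.

(** All operations below keep or shrink the support, which is all that has to be
    checked besides smoothness. *)
Lemma test_supported Om phi f : test_function Om phi -> smooth f ->
  [set x | f x != 0] `<=` supp phi -> test_function Om f.
Proof.
move=> [_ c k] sf h.
have h' : supp f `<=` supp phi.
  by rewrite [X in _ `<=` X](closure_id _).1; [exact: closure_subset|exact: closed_closure].
split => //; last by move=> x /h'/k.
by apply: subclosed_compact c h'; exact: closed_closure.
Qed.

Lemma test0 Om : test_function Om (fun=> 0).
Proof.
have E : [set x : R4 R | (fun=> 0 : R) x != 0] = set0.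
  by apply/seteqP; split => x //=; rewrite eqxx.
by split; rewrite ?E ?closure0//; [exact: smooth_cst|exact: compact0].
Qed.

Lemma testD Om phi psi : test_function Om phi -> test_function Om psi ->
  test_function Om (fun x => phi x + psi x).
Proof.
move=> [s1 c1 k1] [s2 c2 k2].
have h : supp (fun x => phi x + psi x) `<=` supp phi `|` supp psi.
  rewrite -closureU; apply: closure_subset => x /= h.
  have [h1|h1] := eqVneq (phi x) 0; last by left.
  by right; move: h; rewrite h1 add0r.
split; first exact: smoothD.
  apply: subclosed_compact h; [exact: closed_closure|exact: compactU].
by move=> x /h[/k1|/k2].
Qed.

Lemma testZ Om a phi : test_function Om phi -> test_function Om (fun x => a * phi x).
Proof.
move=> tp; apply: (test_supported tp); first exact/smoothZ/test_smooth/tp.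
move=> x /= h; apply: closure_neq0; apply: contra_neq h => ->; exact: mulr0.
Qed.

Lemma testDZ Om a phi psi : test_function Om phi -> test_function Om psi ->
  test_function Om (fun x => phi x + a * psi x).
Proof. by move=> h1 h2; apply: testD => //; exact: testZ. Qed.

Lemma testB Om phi psi : test_function Om phi -> test_function Om psi ->
  test_function Om (fun x => phi x - psi x).
Proof.
move=> h1 h2; have := testDZ (-1) h1 h2.
suff -> : (fun x => phi x - psi x) = (fun x => phi x + -1 * psi x) by [].
by apply/funext => x; rewrite mulN1r.
Qed.

Lemma test_partial Om i phi : test_function Om phi -> test_function Om (partial i phi).
Proof.
move=> tp; apply: (test_supported tp); first exact/smooth_partial/test_smooth/tp.
move=> x /= h; apply: contrapT => nx; move/eqP: h; apply.
rewrite /partial (@near_eq_derive _ _ _ _ (fun=> 0)) ?derive_cst//.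
have : nbhs x (~` supp phi).
  by apply: open_nbhs_nbhs; split => //; apply: closed_openC; exact: closed_closure.
by apply: filterS => y ny; apply/eqP/negPn/negP => h'; apply/ny/closure_neq0.
Qed.

Lemma test_sabs Om e phi : 0 < e -> test_function Om phi -> test_function Om (sabs e phi).
Proof.
move=> e0 tp; apply: (test_supported tp).
  by apply: smooth_sabs => //; exact: test_smooth tp.
move=> x /= h; apply: closure_neq0; apply: contra_neq h; exact: sabs_eq0.
Qed.

Lemma test_bounded Om phi : test_function Om phi ->
  exists M, 0 < M /\ forall x, `|phi x| <= M.
Proof.
move=> [sp c _].
have : compact [set phi x | x in supp phi].
  apply: continuous_compact => //; apply: continuous_subspaceT.
  exact: smooth_continuous.
move=> /compact_bounded[M [_ hM]].
exists (`|M| + 1); split; first by rewrite ltr_pwDr.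
move=> x; have [->|px] := eqVneq (phi x) 0; first by rewrite normr0 addr_ge0.
apply: (hM (`|M| + 1)); first by rewrite (le_lt_trans (ler_norm _))// ltrDl.
by exists x => //; exact: closure_neq0.
Qed.

(** Half-open, so that boxes and cubes can be cut into disjoint cubes. *)
Definition box (b : R) : set (R4 R) :=
  [set x | forall i, -b <= coord i x < b].

Lemma boxE b : box b = (`[-b, b[ `*` `[-b, b[ `*` `[-b, b[ `*` `[-b, b[)%classic.
Proof.
apply/seteqP; split => [x h|x [[[h0 h1] h2] h3] [[|[|[|[|//]]]] i]] /=; last first.
- by rewrite /coord (tnth_nth 0) /=; move: h3; rewrite /= in_itv.
- by rewrite /coord (tnth_nth 0) /=; move: h2; rewrite /= in_itv.
- by rewrite /coord (tnth_nth 0) /=; move: h1; rewrite /= in_itv.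
- by rewrite /coord (tnth_nth 0) /=; move: h0; rewrite /= in_itv.
rewrite !in_itv /=; repeat split.
- by have := h (@Ordinal 4 0 isT); rewrite /coord (tnth_nth 0).
- by have := h (@Ordinal 4 1 isT); rewrite /coord (tnth_nth 0).
- by have := h (@Ordinal 4 2 isT); rewrite /coord (tnth_nth 0).
- by have := h (@Ordinal 4 3 isT); rewrite /coord (tnth_nth 0).
Qed.

Lemma coord_norm i (x : R4 R) : `|coord i x| <= `|x|.
Proof.
have E (V W : normedModType R) (y : V * W) : `|y| = Num.max `|y.1| `|y.2| by [].
rewrite !E /= !le_max.
by case: i => [[|[|[|[|//]]]] i]; rewrite /coord (tnth_nth 0) /= lexx ?orbT.
Qed.

Lemma bounded_box Om : bounded_set Om -> exists b, 0 < b /\ Om `<=` box b.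
Proof.
move=> [M [_ hM]]; exists (`|M| + 2); split; first by rewrite ltr_pwDr.
move=> x Ox i.
have h : `|x| <= `|M| + 1.
  by apply: (hM (`|M| + 1)) => //; rewrite (le_lt_trans (ler_norm _))// ltrDl.
have := le_trans (coord_norm i x) h; rewrite ler_norml => /andP[h1 h2].
by apply/andP; split; lra.
Qed.

Lemma measurable_box b : measurable (box b : set (measurableTypeR R * measurableTypeR R *
    measurableTypeR R * measurableTypeR R)).
Proof. by rewrite boxE; do 3 (apply: measurableX => //). Qed.

Lemma leb4X (A B C E : set R) : measurable A -> measurable B -> measurable C -> measurable E ->
  @leb4 R (A `*` B `*` C `*` E) = (@lebesgue_measure R A * @lebesgue_measure R B *
    @lebesgue_measure R C * @lebesgue_measure R E)%E.
Proof.
move=> mA mB mC mE; have E1 := @product_measure1E _ _ _ _ R (@lebesgue_measure R \x @lebesgue_measure R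
    \x @lebesgue_measure R)%E (@lebesgue_measure R) (A `*` B `*` C) E
    (measurableX (measurableX mA mB) mC) mE.
apply: etrans E1 _.
have E2 := @product_measure1E _ _ _ _ R (@lebesgue_measure R \x @lebesgue_measure R)%E
    (@lebesgue_measure R) (A `*` B) C (measurableX mA mB) mC.
rewrite [X in (X * _)%E = _]E2; congr (_ * _ * _)%E.
exact: product_measure1E.
Qed.

Lemma leb4_box b : (@leb4 R (box b) < +oo)%E.
Proof.
rewrite boxE leb4X//= lebesgue_measure_itv /=.
by case: ifPn => _; rewrite ?mul0e ?ltry// -?EFinB -!EFinM ltry.
Qed.

Notation mR4 := (measurableTypeR R * measurableTypeR R *
    measurableTypeR R * measurableTypeR R)%type.

Lemma bounded_set_fin Om : @measurable _ mR4 Om -> bounded_set Om -> (@leb4 R Om < +oo)%E.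
Proof.
move=> mO bOm; have [b [_ h]] := bounded_box bOm.
apply: le_lt_trans (leb4_box b); apply: le_measure => //; rewrite inE//.
exact: measurable_box.
Qed.

Section measure.
Variable Om : set (R4 R).
Hypotheses (mOm : @measurable _ mR4 Om) (Om_fin : (@leb4 R Om < +oo)%E).

Lemma intg_bounded f M : measurable_fun Om f -> (forall x, `|f x| <= M) ->
  intg (@leb4 R) Om f.
Proof.
move=> mf h; apply: (@intg_le _ _ _ _ _ mOm f (fun=> M)) => //.
apply/integrableP; split; first exact/measurable_EFinP.
under eq_integral do rewrite /=.
by rewrite (integral_cst _ mOm (`|M|%:E)) lte_mul_pinfty ?Om_fin.
Qed.

Lemma mf_smooth f : smooth f -> measurable_fun Om f.
Proof.
move=> sf; apply: measurable_funTS; apply: continuous_measurable_R4.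
exact: smooth_continuous.
Qed.

Lemma intg_cst c : intg (@leb4 R) Om (fun=> c).
Proof. by apply: (@intg_bounded _ `|c|). Qed.

Lemma L2_bounded f M : measurable_fun Om f -> (forall x, `|f x| <= M) ->
  L2 (@leb4 R) Om f.
Proof.
move=> mf h; split => //; apply: (@intg_bounded _ (M ^+ 2)).
  exact: measurable_funX.
by move=> x; rewrite normrX lerXn2r// nnegrE// (le_trans _ (h x)).
Qed.

Lemma L2_test Om' phi : test_function Om' phi -> L2 (@leb4 R) Om phi.
Proof.
move=> tp; have [M [_ h]] := test_bounded tp.
by apply: L2_bounded h; exact: (mf_smooth (test_smooth tp)).
Qed.

Lemma intg_testX Om' n phi : test_function Om' phi ->
  intg (@leb4 R) Om (fun x => phi x ^+ n).
Proof.
move=> tp; have [M [_ h]] := test_bounded tp.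
apply: (@intg_bounded _ (M ^+ n)).
  by apply: measurable_funX; exact: (mf_smooth (test_smooth tp)).
by move=> x; rewrite normrX lerXn2r// nnegrE// (le_trans _ (h x)).
Qed.

End measure.

End test.

(** * Integrals along coordinate lines *)

(** A copy of the product measure carrying the sigma-finiteness that iterating
    Tonelli's theorem over three products needs. *)
Section sigma_finite_product.
Context d1 d2 (X : measurableType d1) (Y : measurableType d2) (R : realType).
Variables (m1 : {sigma_finite_measure set X -> \bar R})
          (m2 : {sigma_finite_measure set Y -> \bar R}).

Definition prodm : set (X * Y)%type -> \bar R := (m1 \x m2)%E.

HB.instance Definition _ := Measure.on prodm.

Let prodm_sigma_finite : sigma_finite setT prodm.
Proof.
have [F FT Foo] := sigma_finiteT m1.
have [G GT Goo] := sigma_finiteT m2.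
pose H n := if unpickle n is Some p then F p.1 `*` G p.2 else set0.
exists H; last first.
  move=> n; rewrite /H; case: (unpickle n) => [p|]; last by split => //; rewrite measure0.
  have [mF fF] := Foo p.1; have [mG fG] := Goo p.2.
  split; first exact: measurableX.
  by rewrite [ltLHS]product_measure1E// lte_mul_pinfty// ge0_fin_numE.
apply/seteqP; split => // -[x y] _.
have [i _ Fi] : (\bigcup_i F i) x by rewrite -FT.
have [j _ Gj] : (\bigcup_i G i) y by rewrite -GT.
by exists (pickle (i, j)) => //; rewrite /H pickleK.
Qed.

HB.instance Definition _ := Measure_isSigmaFinite.Build _ _ _ prodm prodm_sigma_finite.

End sigma_finite_product.

(** Comparing integrals along all lines in one coordinate direction, where
    [upd x] parametrizes the line through [x]. *)
Definition slice_le (R : realType) d (X : measurableType d)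
    (m : set X -> \bar R) (upd : X -> R -> X) :=
  forall f g : X -> \bar R,
    measurable_fun setT f -> measurable_fun setT g ->
    (forall x, 0 <= f x)%E -> (forall x, 0 <= g x)%E ->
    (forall x, \int[@lebesgue_measure R]_t f (upd x t) <=
               \int[@lebesgue_measure R]_t g (upd x t))%E ->
    (\int[m]_x f x <= \int[m]_x g x)%E.

Lemma sube0_eq (R : realType) (a b : \bar R) :
  a \is a fin_num -> b \is a fin_num -> (a - b = 0)%E -> a = b.
Proof. by case: a b => [r||] [s||] // _ _ [] /eqP; rewrite subr_eq0 => /eqP ->. Qed.

Section slices.
Variable R : realType.
Notation leb := (@lebesgue_measure R).

Lemma slice_le_base : @slice_le R _ (measurableTypeR R) leb (fun _ t => t).
Proof. by move=> f g _ _ _ _ /(_ 0). Qed.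

Section prod.
Context d (X : measurableType d) (m : {sigma_finite_measure set X -> \bar R}).
Notation XR := (X * measurableTypeR R)%type.

Lemma slice_le_right :
  @slice_le R _ XR (m \x leb)%E (fun x t => (x.1, t)).
Proof.
move=> f g mf mg f0 g0 h.
rewrite !fubini_tonelli1//; apply: ge0_le_integral => //.
- by move=> x _; apply: integral_ge0.
- exact: measurable_fun_fubini_tonelli_F.
- exact: measurable_fun_fubini_tonelli_F.
by move=> x _; exact: (h (x, 0)).
Qed.

Lemma slice_le_left upd : slice_le m upd ->
  @slice_le R _ XR (m \x leb)%E (fun x t => (upd x.1 t, x.2)).
Proof.
move=> hm f g mf mg f0 g0 h.
rewrite !fubini_tonelli1// !fubini_tonelli//; apply: ge0_le_integral => //.
- by move=> x _; apply: integral_ge0.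
- exact: measurable_fun_fubini_tonelli_G.
- exact: measurable_fun_fubini_tonelli_G.
move=> y _; apply: hm => //.
- exact: measurableT_comp mf (measurable_pair2 _).
- exact: measurableT_comp mg (measurable_pair2 _).
by move=> x; exact: (h (x, y)).
Qed.

End prod.

Definition upd (i : 'I_4) (x : R4 R) (t : R) : R4 R :=
  match val i with
  | 0%N => (t, x.1.1.2, x.1.2, x.2)
  | 1%N => (x.1.1.1, t, x.1.2, x.2)
  | 2%N => (x.1.1.1, x.1.1.2, t, x.2)
  | _ => (x.1.1.1, x.1.1.2, x.1.2, t)
  end.

Lemma R4_eq (x y : R4 R) : (forall i, coord i x = coord i y) -> x = y.
Proof.
move=> h.
have := h (@Ordinal 4 0 isT); have := h (@Ordinal 4 1 isT).
have := h (@Ordinal 4 2 isT); have := h (@Ordinal 4 3 isT).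
rewrite /coord !(tnth_nth 0) /=.
by case: x y {h} => [[[a b] c] e] [[[a' b'] c'] e'] /= -> -> -> ->.
Qed.

Lemma coordD i (x y : R4 R) : coord i (x + y) = coord i x + coord i y.
Proof. by case: i => [[|[|[|[|//]]]] i]; rewrite /coord !(tnth_nth 0). Qed.

Lemma coordZ i a (x : R4 R) : coord i (a *: x) = a * coord i x.
Proof. by case: i => [[|[|[|[|//]]]] i]; rewrite /coord !(tnth_nth 0). Qed.

Lemma coord_basis i j : coord i (basis R j) = (i == j)%:R.
Proof.
by case: i => [[|[|[|[|//]]]] i]; case: j => [[|[|[|[|//]]]] j];
   rewrite /coord (tnth_nth 0).
Qed.

Lemma coord_upd_neq i j x t : i != j -> coord i (upd j x t) = coord i x.
Proof.
by case: i => [[|[|[|[|//]]]] i]; case: j => [[|[|[|[|//]]]] j]//= _;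
   rewrite /coord !(tnth_nth 0).
Qed.

Lemma coord_upd i x t : coord i (upd i x t) = t.
Proof. by case: i => [[|[|[|[|//]]]] i]; rewrite /coord (tnth_nth 0). Qed.

Lemma updE i x t : upd i x t = t *: basis R i + upd i x 0.
Proof.
apply: R4_eq => j; rewrite coordD coordZ coord_basis.
have [->|ji] := eqVneq j i; first by rewrite !coord_upd mulr1 addr0.
by rewrite !coord_upd_neq// mulr0 add0r.
Qed.

Lemma eq_slice_le d (X : measurableType d) (m : set X -> \bar R)
    (u v : X -> R -> X) : (forall x t, u x t = v x t) -> slice_le m u -> slice_le m v.
Proof.
move=> uv hu f g mf mg f0 g0 h; apply: hu => // x.
by under eq_integral do rewrite uv; under [leRHS]eq_integral do rewrite uv.
Qed.

(** The last coordinate is the inner variable of Tonelli's theorem; the others are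
    reached by exchanging it with the product of the first factors, inductively. *)
Lemma slice_le_leb4 i : slice_le (@leb4 R) (upd i).
Proof.
have h2a : slice_le (prodm leb leb) _ := slice_le_left slice_le_base.
have h2b : slice_le (prodm leb leb) _ := @slice_le_right _ _ leb.
have h3a : slice_le (prodm (prodm leb leb) leb) _ := slice_le_left h2a.
have h3b : slice_le (prodm (prodm leb leb) leb) _ := slice_le_left h2b.
have h3c : slice_le (prodm (prodm leb leb) leb) _ := @slice_le_right _ _ (prodm leb leb).
have h4a := slice_le_left h3a.
have h4b := slice_le_left h3b.
have h4c := slice_le_left h3c.
have h4d := @slice_le_right _ _ (prodm (prodm leb leb) leb).
case: i => [[|[|[|[|k]]]] hk]; last by [].
- apply: eq_slice_le h4a; by case=> [[[a b] c] e].
- apply: eq_slice_le h4b; by case=> [[[a b] c] e].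
- apply: eq_slice_le h4c; by case=> [[[a b] c] e].
- apply: eq_slice_le h4d; by case=> [[[a b] c] e].
Qed.

Lemma smooth_slice (f : R4 R -> R) i x (t : R) : smooth f ->
  is_derive t 1 (fun t => f (upd i x t)) (partial i f (upd i x t)).
Proof.
move=> sf; under eq_fun do rewrite updE.
rewrite [in X in is_derive _ _ _ X]updE.
apply: is_derive_slice_at; exact: smooth_is_derive.
Qed.

Lemma continuous_slice (f : R4 R -> R) i x : continuous f ->
  continuous (fun t => f (upd i x t)).
Proof.
move=> cf t; under [X in continuous_at _ X]eq_fun do rewrite updE.
apply: (@continuous_comp _ _ _ (fun t : R => t *: basis R i + upd i x 0) f); last exact: cf.
apply: (@continuousD _ _ _ (fun t : R => t *: basis R i) (cst (upd i x 0))).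
  exact: scalel_continuous.
exact: cst_continuous.
Qed.

Lemma smooth_FTC (f : R4 R -> R) i x (a b : R) : a <= b -> smooth f ->
  \int[leb]_(t in `[a, b]) (partial i f (upd i x t)) = f (upd i x b) - f (upd i x a).
Proof.
move=> ab sf; move: ab; rewrite le_eqVlt => /predU1P[<-|ab].
  by rewrite set_itv1 Rintegral_set1 subrr.
rewrite /Rintegral (@continuous_FTC2 _ _ (fun t => f (upd i x t)))//.
- apply: continuous_subspaceT; apply: continuous_slice.
  exact/smooth_continuous/smooth_partial.
- split.
  + by move=> t _; have [] := smooth_slice i x t sf.
  + apply: cvg_at_right_filter; apply: continuous_slice; exact: smooth_continuous.
  + apply: cvg_at_left_filter; apply: continuous_slice; exact: smooth_continuous.
by move=> t _; rewrite derive1E; have [_ ->] := smooth_slice i x t sf.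
Qed.

(** On each line in direction [i] the derivative integrates to 0 by the fundamental
    theorem of calculus, so its positive and negative parts have equal line integrals
    and hence equal integrals. *)
Lemma integral_partial0 Om i phi : test_function Om phi ->
  \int[@leb4 R]_x (partial i phi x) = 0.
Proof.
move=> tp; have [sp cK _] := tp.
have [b [b0 hb]] := bounded_box (compact_bounded cK).
have cd : continuous (partial i phi) by exact/smooth_continuous/smooth_partial.
have out x : ~ box b x -> phi x = 0.
  by move=> nx; apply/eqP/negPn/negP => h; apply/nx/hb/closure_neq0.
have outd x : ~ box b x -> partial i phi x = 0.
  move=> nx; apply/eqP/negPn/negP => h; apply/nx/hb.
  have [_ _ k] := test_partial i (And3 sp cK (@subset_refl _ _)).
  by apply: k; exact: closure_neq0.
pose F x := (partial i phi x)%:E.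
have mF : measurable_fun setT F.
  by apply/measurable_EFinP; exact: continuous_measurable_R4.
have line x : (\int[leb]_t F^\+ (upd i x t) = \int[leb]_t F^\- (upd i x t))%E.
  pose h t := partial i phi (upd i x t).
  have ch : continuous h by exact: continuous_slice.
  pose c := b + 1.
  have ih : leb.-integrable `[-c, c] (EFin \o h).
    by apply: continuous_compact_integrable; [exact: segment_compact|exact: continuous_subspaceT].
  have hE : h = h \_ `[-c, c].
    apply/funext => t; rewrite /patch; case: ifPn => // /negP nt.
    apply: outd => /(_ i); rewrite coord_upd => /andP[t1 t2]; apply: nt.
    by rewrite inE /= in_itv /= /c; apply/andP; split; lra.
  have ihT : leb.-integrable setT (EFin \o h).
    have mc : measurable `[-c, c]%classic by exact: measurable_itv.
    have := (@integrable_mkcond _ _ _ leb _ (EFin \o h) mc).1 ih.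
    by rewrite restrict_EFin -hE.
  have I0 : (\int[leb]_t (h t)%:E = 0)%E.
    rewrite -(fineK (integrable_fin_num measurableT ihT)) -/(Rintegral _ _ _).
    rewrite hE -Rintegral_mkcond smooth_FTC//; last by rewrite /c; lra.
    rewrite !out ?subrr// => /(_ i); rewrite coord_upd /c => /andP[t1 t2]; lra.
  move: I0; rewrite integralE.
  have f1 := integrable_pos_fin_num measurableT ihT.
  have f2 := integrable_neg_fin_num measurableT ihT.
  move=> h0. have k := sube0_eq f1 f2 h0.
  apply: etrans (etrans k _); apply: eq_integral => t _; by rewrite !unlock.
have E : (\int[@leb4 R]_x F^\+ x = \int[@leb4 R]_x F^\- x)%E.
  apply/eqP; rewrite eq_le; apply/andP; split; apply: (@slice_le_leb4 i) => //.
  - exact: measurable_funepos.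
  - exact: measurable_funeneg.
  - by move=> x; rewrite line.
  - exact: measurable_funeneg.
  - exact: measurable_funepos.
  - by move=> x; rewrite line.
rewrite /Rintegral integralE E; case: (\int[_]_x _)%E => //= r; exact: subrr.
Qed.

End slices.

(** * Poincare inequalities on products *)

Section rectangles.
Context d1 d2 (X : measurableType d1) (Y : measurableType d2) (R : realType).
Variables (m1 : {sigma_finite_measure set X -> \bar R})
          (m2 : {sigma_finite_measure set Y -> \bar R}).
Variables (A : set X) (B : set Y).
Hypotheses (mA : measurable A) (mB : measurable B).
Variable f : X * Y -> \bar R.
Hypotheses (mf : measurable_fun setT f) (f0 : forall z, (0 <= f z)%E).

Let fAB := f \_ (A `*` B).

Let mfAB : measurable_fun setT fAB.
Proof.
apply/(measurable_restrictT _ _).1; first exact: measurableX.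
exact: measurable_funTS.
Qed.

Let fAB0 z : (0 <= fAB z)%E.
Proof. by rewrite /fAB /patch; case: ifP. Qed.

Lemma measurable_integral_section :
  measurable_fun setT (fun x => \int[m2]_(y in B) f (x, y))%E.
Proof.
pose g := f \_ (setT `*` B).
have mg : measurable_fun setT g.
  apply/(measurable_restrictT _ _).1; first exact: measurableX.
  exact: measurable_funTS.
have g0 z : (0 <= g z)%E by rewrite /g /patch; case: ifP.
have := measurable_fun_fubini_tonelli_F (m2 := m2) _ mg g0.
congr (measurable_fun _ _); apply/funext => x; rewrite /fubini_F [RHS]integral_mkcond.
by apply: eq_integral => y _; rewrite /g /patch in_setX in_setT.
Qed.

Lemma tonelli_rectangle :
  (\int[m1 \x m2]_(z in A `*` B) f z =
   \int[m1]_(x in A) \int[m2]_(y in B) f (x, y))%E.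
Proof.
rewrite integral_mkcond fubini_tonelli1// [RHS]integral_mkcond.
apply: eq_integral => x _; rewrite /fubini_F /patch; case: ifPn => xA.
  rewrite [RHS]integral_mkcond; apply: eq_integral => y _.
  by rewrite /fAB /patch in_setX xA.
by apply: integral0_eq => y _; rewrite /patch in_setX (negbTE xA).
Qed.

Lemma tonelli_rectangle_sym :
  (\int[m1]_(x in A) \int[m2]_(y in B) f (x, y) =
   \int[m2]_(y in B) \int[m1]_(x in A) f (x, y))%E.
Proof.
rewrite -tonelli_rectangle integral_mkcond fubini_tonelli1// fubini_tonelli//.
rewrite [RHS]integral_mkcond.
apply: eq_integral => y _; rewrite /fubini_G /patch; case: ifPn => yB.
  rewrite [RHS]integral_mkcond; apply: eq_integral => x _.
  by rewrite /fAB /patch in_setX yB andbT.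
by apply: integral0_eq => x _; rewrite /patch in_setX (negbTE yB) andbF.
Qed.

End rectangles.

(** A Poincare inequality in its double integral form, which iterates well over
    products. *)
Definition poincare (R : realType) d (X : measurableType d)
    (m : set X -> \bar R) (c : R) (A : set X) (f : X -> R)
    (G : X -> \bar R) :=
  (\int[m]_(x in A) \int[m]_(y in A) ((f x - f y) ^+ 2)%:E <=
   c%:E * \int[m]_(x in A) G x)%E.

Section poincare_prod.
Context d1 d2 (X : measurableType d1) (Y : measurableType d2) (R : realType).
Variables (m1 : {sigma_finite_measure set X -> \bar R})
          (m2 : {sigma_finite_measure set Y -> \bar R}).
Variables (A : set X) (B : set Y).
Hypotheses (mA : measurable A) (mB : measurable B).
Variables (a b : R).
Hypotheses (a0 : 0 <= a) (b0 : 0 <= b) (mAa : m1 A = a%:E) (mBb : m2 B = b%:E).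

(** Going from [(x, y)] to [(x', y')] through [(x', y)] and using
    [(p + q) ^+ 2 <= 2 * p ^+ 2 + 2 * q ^+ 2], each half of the path varies one factor
    only; the variable that does not occur contributes the measure of its factor. *)
Lemma poincare_prod (f : X * Y -> R) (G1 G2 : X * Y -> \bar R) (c1 c2 c : R) :
  measurable_fun setT f -> measurable_fun setT G1 -> measurable_fun setT G2 ->
  (forall z, 0 <= G1 z)%E -> (forall z, 0 <= G2 z)%E ->
  0 <= c1 -> 0 <= c2 -> 2 * b * c1 <= c -> 2 * a * c2 <= c ->
  (forall y, B y -> poincare m1 c1 A (fun x => f (x, y)) (fun x => G1 (x, y))) ->
  (forall x, A x -> poincare m2 c2 B (fun y => f (x, y)) (fun y => G2 (x, y))) ->
  poincare (m1 \x m2)%E c (A `*` B) f (fun z => G1 z + G2 z)%E.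
Proof.
move=> mf mG1 mG2 G10 G20 c10 c20 hc1 hc2 h1 h2; rewrite /poincare.
pose q z w := ((f z - f w) ^+ 2)%:E.
have q0 z w : (0 <= q z w)%E by rewrite lee_fin sqr_ge0.
have mq d (T : measurableType d) (u v : T -> X * Y) : measurable_fun setT u ->
    measurable_fun setT v -> measurable_fun setT (fun t => q (u t) (v t)).
  move=> mu mv; apply/measurable_EFinP; apply: measurable_funX.
  by apply: measurable_funB; exact: measurableT_comp.
have mAB : measurable (A `*` B) by exact: measurableX.
have cA r : (\int[m1]_(x in A) r = r * a%:E)%E.
  by rewrite integral_cst//; congr (_ * _)%E.
have cB r : (\int[m2]_(y in B) r = r * b%:E)%E.
  by rewrite integral_cst//; congr (_ * _)%E.
pose P (z : X * Y) := (\int[m1]_(x' in A) q z (x', z.2))%E.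
pose Q (y : Y) (x' : X) := (\int[m2]_(y' in B) q (x', y) (x', y'))%E.
pose S (y : Y) := (\int[m1]_(x' in A) Q y x')%E.
have P0 z : (0 <= P z)%E by apply: integral_ge0.
have Q0 y x : (0 <= Q y x)%E by apply: integral_ge0.
have S0 y : (0 <= S y)%E by apply: integral_ge0.
have mP : measurable_fun setT P.
  apply: (@measurable_integral_section _ _ (X * Y)%type X R m1 A mA
    (fun p => q p.1 (p.2, p.1.2))) => //.
  apply: mq => //; apply: measurable_fun_pair => //.
  exact: measurableT_comp.
have mQ : measurable_fun setT (fun p : Y * X => Q p.1 p.2).
  apply: (@measurable_integral_section _ _ (Y * X)%type Y R m2 B mB
    (fun p => q (p.1.2, p.1.1) (p.1.2, p.2))) => //.
  apply: mq; apply: measurable_fun_pair => //; exact: measurableT_comp.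
have mQ1 y : measurable_fun setT (Q y).
  exact: (measurableT_comp mQ (measurable_pair1 y)).
have mS : measurable_fun setT S.
  exact: (@measurable_integral_section _ _ Y X R m1 A mA (fun p => Q p.1 p.2)).
have mS2 : measurable_fun setT (fun z : X * Y => S z.2) by exact: measurableT_comp.
(* P z collects the first half of the path and S the second, which does not depend
   on x. *)
have inner z : (A `*` B) z -> (\int[m1 \x m2]_(w in A `*` B) q z w <=
    (2 * b)%:E * P z + 2%:E * S z.2)%E.
  case: z => x y _.
  rewrite (tonelli_rectangle m1 m2 mA mB (f := q (x, y)))//; last exact: mq.
  apply: (@le_trans _ _ (\int[m1]_(x' in A)
     ((2 * b)%:E * q (x, y) (x', y) + 2%:E * Q y x'))%E).
    apply: ge0_le_integral => //.
    - by move=> x' _; apply: integral_ge0.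
    - apply: measurable_funTS; apply: measurable_integral_section => //.
      by apply: mq.
    - apply: measurable_funTS; apply: emeasurable_funD; apply: measurable_funeM => //.
      apply: mq => //; exact: measurable_pair2.
    move=> x' _.
    apply: (@le_trans _ _ (\int[m2]_(y' in B)
       (2%:E * q (x, y) (x', y) + 2%:E * q (x', y) (x', y')))%E).
      apply: ge0_le_integral => //.
      - by apply: measurable_funTS; apply: mq => //; exact: measurable_pair1.
      - apply: measurable_funTS; apply: emeasurable_funD => //.
        by apply: measurable_funeM; apply: mq => //; exact: measurable_pair1.
      move=> y' _; rewrite -!EFinM -EFinD lee_fin.
      have := sqr_ge0 (f (x, y) - f (x', y) - (f (x', y) - f (x', y'))).
      nra.
    rewrite ge0_integralD//; last 3 first.
    - by move=> y' _; rewrite mule_ge0// lee_fin.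
    - by move=> y' _; rewrite mule_ge0// lee_fin.
    - by apply: measurable_funTS; apply: measurable_funeM; apply: mq.
    rewrite cB ge0_integralZl//; last 1 first.
    - by apply: measurable_funTS; apply: mq.
    rewrite leeD2r// le_eqVlt; apply/orP; left; apply/eqP.
    by rewrite -!EFinM; congr EFin; ring.
  rewrite ge0_integralD//; last 4 first.
  - by move=> x' _; rewrite mule_ge0// lee_fin mulr_ge0.
  - apply: measurable_funTS; apply: measurable_funeM; apply: mq => //; exact: measurable_pair2.
  - by move=> x' _; rewrite mule_ge0// lee_fin.
  - by apply: measurable_funTS; exact: measurable_funeM.
  rewrite ge0_integralZl//; last 2 first.
  - apply: measurable_funTS; apply: mq => //; exact: measurable_pair2.
  - by rewrite lee_fin mulr_ge0.
  rewrite ge0_integralZl//; last 1 first.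
  - exact: measurable_funTS.
apply: (@le_trans _ _ (\int[m1 \x m2]_(z in A `*` B)
   ((2 * b)%:E * P z + 2%:E * S z.2))%E).
  apply: ge0_le_integral => //.
  - by move=> z _; apply: integral_ge0 => w _; exact: q0.
  - apply: measurable_funTS.
    apply: (@measurable_integral_section _ _ (X * Y)%type (X * Y)%type R (prodm m1 m2)
      _ mAB (fun p => q p.1 p.2)) => //; exact: mq.
  - by apply: measurable_funTS; apply: emeasurable_funD; exact: measurable_funeM.
rewrite ge0_integralD//; last 4 first.
- by move=> z _; rewrite mule_ge0// lee_fin mulr_ge0.
- by apply: measurable_funTS; exact: measurable_funeM.
- by move=> z _; rewrite mule_ge0// lee_fin.
- by apply: measurable_funTS; exact: measurable_funeM.
rewrite ge0_integralZl//; last 2 first.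
- exact: measurable_funTS.
- by rewrite lee_fin mulr_ge0.
rewrite ge0_integralZl//; last exact: measurable_funTS.
have c0 : 0 <= c by apply: le_trans hc1; rewrite !mulr_ge0.
have iG1 : (0 <= \int[m1 \x m2]_(z in A `*` B) G1 z)%E by apply: integral_ge0.
have iG2 : (0 <= \int[m1 \x m2]_(z in A `*` B) G2 z)%E by apply: integral_ge0.
rewrite [X in (_ <= _ * X)%E]ge0_integralD//; [|exact: measurable_funTS..].
rewrite [X in (_ <= X)%E]ge0_muleDr//; apply: leeD.
  apply: (@le_trans _ _ ((2 * b)%:E * (c1%:E * \int[m1 \x m2]_(z in A `*` B) G1 z))%E).
    apply: lee_wpmul2l; first by rewrite lee_fin mulr_ge0.
    rewrite !tonelli_rectangle// tonelli_rectangle_sym//.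
    rewrite [in leRHS]tonelli_rectangle_sym//.
    rewrite -ge0_integralZl//; last 2 first.
    - apply: measurable_funTS.
      apply: (@measurable_integral_section _ _ Y X R m1 A mA (fun p => G1 (p.2, p.1))) => //.
      apply: measurableT_comp => //; exact: measurable_fun_pair.
    - by move=> y _; apply: integral_ge0.
    apply: ge0_le_integral => //.
    - by move=> y _; apply: integral_ge0.
    - apply: measurable_funTS.
      apply: (@measurable_integral_section _ _ Y X R m1 A mA (fun p => P (p.2, p.1))) => //.
      apply: measurableT_comp => //; exact: measurable_fun_pair.
    - apply: measurable_funTS; apply: measurable_funeM.
      apply: (@measurable_integral_section _ _ Y X R m1 A mA (fun p => G1 (p.2, p.1))) => //.
      apply: measurableT_comp => //; exact: measurable_fun_pair.
  rewrite muleA; apply: lee_wpmul2r; first exact: iG1.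
  by rewrite -EFinM lee_fin.
have -> : (\int[m1 \x m2]_(z in A `*` B) S z.2 =
    a%:E * \int[m1]_(x in A) \int[m2]_(y in B) Q y x)%E.
  rewrite tonelli_rectangle//.
  under eq_integral do rewrite /=.
  rewrite cA muleC; congr (_ * _)%E.
  by rewrite (tonelli_rectangle_sym m2 m1 mB mA (f := fun p => Q p.1 p.2)).
apply: (@le_trans _ _ (2%:E * (a%:E * (c2%:E * \int[m1 \x m2]_(z in A `*` B) G2 z)))%E).
  apply: lee_wpmul2l; first by rewrite lee_fin.
  apply: lee_wpmul2l; first by rewrite lee_fin.
  rewrite tonelli_rectangle// -ge0_integralZl//; last 2 first.
  - by apply: measurable_funTS; exact: measurable_integral_section.
  - by move=> y _; apply: integral_ge0.
  apply: ge0_le_integral => //.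
  - by move=> y _; apply: integral_ge0.
  - apply: measurable_funTS.
    apply: (@measurable_integral_section _ _ X Y R m2 B mB (fun p => Q p.2 p.1)) => //.
    have msw : measurable_fun setT (fun p : X * Y => (p.2, p.1)).
      exact: measurable_fun_pair.
    exact: (measurableT_comp mQ msw).
  - by apply: measurable_funTS; apply: measurable_funeM; exact: measurable_integral_section.
rewrite !muleA; apply: lee_wpmul2r; first exact: iG2.
by rewrite -!EFinM lee_fin.
Qed.

End poincare_prod.

(** * The Poincare inequality on a cube *)

Section poincare_line.
Variable R : realType.
Notation leb := (@lebesgue_measure R).

Lemma lebesgue_measure_co (a h : R) : 0 < h -> leb `[a, a + h[%classic = h%:E.
Proof.
by move=> h0; rewrite lebesgue_measure_itv /= lte_fin ltrDl h0 -EFinB addrAC subrr add0r.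
Qed.

(** By the fundamental theorem of calculus and the Cauchy-Schwarz inequality
    [(f x - f y) ^+ 2] is at most [h] times the integral of [f' ^+ 2]; integrating in
    both variables gives two more factors [h]. *)
Lemma poincare_line (f f' : R -> R) (a h : R) : 0 < h ->
  (forall t : R, is_derive t 1 f (f' t)) -> continuous f' ->
  poincare leb (h ^+ 3) `[a, a + h[%classic f (fun t => (f' t ^+ 2)%:E).
Proof.
move=> h0 df cf'.
have mI : measurable `[a, a + h[%classic by exact: measurable_itv.
have int2 (b c : R) (n : nat) : intg leb `[b, c] (fun t => f' t ^+ n).
  apply: continuous_compact_integrable; first exact: segment_compact.
  apply: continuous_subspaceT => t.
  apply: (@continuous_comp _ _ _ f' (fun y => y ^+ n)); last exact: exprn_continuous.
  exact: cf'.
pose K := \int[leb]_(t in `[a, a + h[) (f' t ^+ 2).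
have IK : intg leb `[a, a + h[%classic (fun t => f' t ^+ 2).
  apply: integrableS (int2 a (a + h) 2%N) => //.
  by move=> t /=; rewrite !in_itv /= => /andP[-> /ltW].
have K0 : 0 <= K by apply: Rintegral_ge0 => t _; exact: sqr_ge0.
have key x y : y < x -> x \in `[a, a + h[ -> y \in `[a, a + h[ ->
    (f x - f y) ^+ 2 <= h * K.
  move=> yx; rewrite !in_itv /= => /andP[x1 x2] /andP[y1 y2].
  have mxy : measurable `[y, x]%classic by exact: measurable_itv.
  have FTC : \int[leb]_(t in `[y, x]) f' t = f x - f y.
    rewrite /Rintegral (@continuous_FTC2 _ _ f)//.
    - exact: continuous_subspaceT.
    - split.
      + by move=> t _; have [] := df t.
      + apply: cvg_at_right_filter; apply: differentiable_continuous.
        by apply/derivable1_diffP; have [] := df y.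
      + apply: cvg_at_left_filter; apply: differentiable_continuous.
        by apply/derivable1_diffP; have [] := df x.
    by move=> t _; rewrite derive1E; have [_ ->] := df t.
  have L1 : L2 leb `[y, x]%classic (fun=> 1).
    split => //; have hh := @intg_eq _ _ _ leb _ mxy (fun t => f' t ^+ 0) (fun=> 1 ^+ 2). apply: hh; last exact: int2.
    by move=> t _; rewrite expr0 expr1n.
  have Lf : L2 leb `[y, x]%classic f'.
    split; last exact: int2.
    exact: (intg_mf (int2 y x 1%N)).
  have := I_CS (mu := leb) mxy L1 Lf.
  under [X in X ^+ 2 <= _]eq_Rintegral do rewrite mul1r.
  rewrite FTC; move=> /le_trans; apply.
  have -> : \int[leb]_(t in `[y, x]) (1 ^+ 2) = x - y.
    rewrite (@Rintegral_cst _ _ _ leb _ mxy) expr1n mul1r.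
    have E : leb `[y, x]%classic = (x - y)%:E by rewrite lebesgue_measure_itv /= lte_fin yx.
    exact: (congr1 fine E).
  apply: ler_pM.
  - by rewrite subr_ge0 ltW.
  - by apply: Rintegral_ge0 => t _; exact: sqr_ge0.
  - lra.
  rewrite -lee_fin (I_EFin (mu := leb) mxy (int2 _ _ _)) (I_EFin (mu := leb) mI IK).
  apply: ge0_subset_integral => //.
  - by apply/measurable_EFinP; exact: (intg_mf IK).
  - by move=> t _; rewrite lee_fin sqr_ge0.
  move=> t /=; rewrite !in_itv /= => /andP[t1 t2].
  by rewrite (le_trans y1 t1) (le_lt_trans t2 x2).
have key2 x y : x \in `[a, a + h[ -> y \in `[a, a + h[ ->
    (f x - f y) ^+ 2 <= h * K.
  move=> hx hy; have [xy|yx|->] := ltgtP x y; last 1 first.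
  - by rewrite subrr expr0n mulr_ge0// ltW.
  - by rewrite -sqrrN opprB; exact: key.
  - exact: key.
have cf : continuous f.
  by move=> t; apply: differentiable_continuous; apply/derivable1_diffP; have [] := df t.
have mf : measurable_fun setT f by exact: continuous_measurable_fun.
have cst_bound (g : R -> \bar R) (c : R) : measurable_fun setT g ->
   (forall t : R, t \in `[a, a + h[ -> (0 <= g t <= c%:E)%E) ->
   (\int[leb]_(t in `[a, (a + h)%R[) g t <= (h * c)%:E)%E.
  move=> mg hg.
  apply: (@le_trans _ _ (\int[leb]_(t in `[a, (a + h)%R[) (cst c%:E t))%E).
    apply: ge0_le_integral => //.
    - by move=> t ht; have /andP[] := hg t ht.
    - exact: measurable_funTS.
    - by move=> t ht; have /andP[] := hg t ht.
  rewrite integral_cst// muleC EFinM le_eqVlt; apply/orP; left; apply/eqP.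
  congr (_ * _)%E; exact: lebesgue_measure_co.
rewrite /poincare -(I_EFin (mu := leb) mI IK) -EFinM.
have -> : h ^+ 3 * K = h * (h * (h * K)) by ring.
apply: (cst_bound _ _).
  apply: (@measurable_integral_section _ _ (measurableTypeR R) (measurableTypeR R) R leb
    _ mI (fun p => ((f p.1 - f p.2) ^+ 2)%:E)).
    apply/measurable_EFinP; apply: measurable_funX.
    by apply: measurable_funB; exact: measurableT_comp.
  by move=> z; rewrite lee_fin sqr_ge0.
move=> x hx; apply/andP; split; first by apply: integral_ge0 => y _; rewrite lee_fin sqr_ge0.
apply: (cst_bound _ _).
  by apply/measurable_EFinP; apply: measurable_funX; exact: measurable_funB.
by move=> y hy; rewrite !lee_fin sqr_ge0 key2.
Qed.

Definition cube (a : 'I_4 -> R) (h : R) : set (R4 R) :=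
  [set x | forall i, a i <= coord i x < a i + h].

Lemma cubeE a h : let I i := `[a i, a i + h[%classic in
  cube a h = I (@Ordinal 4 0 isT) `*` I (@Ordinal 4 1 isT) `*` I (@Ordinal 4 2 isT)
    `*` I (@Ordinal 4 3 isT).
Proof.
apply/seteqP; split => [x hx|x [[[h0 h1] h2] h3] [[|[|[|[|k]]]] hk]]; last by [].
- rewrite /= !in_itv /=; repeat split.
  + by have := hx (@Ordinal 4 0 isT); rewrite /coord (tnth_nth 0).
  + by have := hx (@Ordinal 4 1 isT); rewrite /coord (tnth_nth 0).
  + by have := hx (@Ordinal 4 2 isT); rewrite /coord (tnth_nth 0).
  + by have := hx (@Ordinal 4 3 isT); rewrite /coord (tnth_nth 0).
- by rewrite (_ : Ordinal hk = @Ordinal 4 0 isT); [move: h0; rewrite /= in_itv /coord (tnth_nth 0) | exact: val_inj].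
- by rewrite (_ : Ordinal hk = @Ordinal 4 1 isT); [move: h1; rewrite /= in_itv /coord (tnth_nth 0) | exact: val_inj].
- by rewrite (_ : Ordinal hk = @Ordinal 4 2 isT); [move: h2; rewrite /= in_itv /coord (tnth_nth 0) | exact: val_inj].
- by rewrite (_ : Ordinal hk = @Ordinal 4 3 isT); [move: h3; rewrite /= in_itv /coord (tnth_nth 0) | exact: val_inj].
Qed.

Lemma measurable_cube a h : @measurable _ (measurableTypeR R * measurableTypeR R *
    measurableTypeR R * measurableTypeR R)%type (cube a h).
Proof. by rewrite cubeE; do 3 (apply: measurableX => //). Qed.

Lemma leb4_cube a h : 0 < h -> @leb4 R (cube a h) = (h ^+ 4)%:E.
Proof.
move=> h0; rewrite cubeE leb4X// !lebesgue_measure_co// -!EFinM; congr EFin; ring.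
Qed.

End poincare_line.

Section poincare_cube.
Variable R : realType.
Notation leb := (@lebesgue_measure R).

(** The product inequality is applied three times, starting from lines: the constants
    are [h ^+ 3], [2 * h ^+ 4], [4 * h ^+ 5] and [8 * h ^+ 6]. *)
Lemma poincare_cube (phi : R4 R -> R) (a : 'I_4 -> R) (h : R) : 0 < h -> smooth phi ->
  poincare (@leb4 R) (8 * h ^+ 6) (cube a h) phi
    (fun x => (\sum_(i < 4) partial i phi x ^+ 2)%:E).
Proof.
move=> h0 sp.
have -> : (fun x => (\sum_(i < 4) partial i phi x ^+ 2)%:E) =
    (fun x => (partial (@Ordinal 4 0 isT) phi x ^+ 2)%:E +
              (partial (@Ordinal 4 1 isT) phi x ^+ 2)%:E +
              (partial (@Ordinal 4 2 isT) phi x ^+ 2)%:E +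
              (partial (@Ordinal 4 3 isT) phi x ^+ 2)%:E)%E.
  apply/funext => x; rewrite -!EFinD; congr EFin.
  rewrite !big_ord_recr big_ord0 /= add0r.
  by congr (_ ^+ 2 + _ ^+ 2 + _ ^+ 2 + _ ^+ 2); congr (partial _ phi x); exact: val_inj.
rewrite cubeE.
set i0 := Ordinal _; set i1 := @Ordinal 4 1 _; set i2 := @Ordinal 4 2 _; set i3 := @Ordinal 4 3 _.
have cp i : continuous (partial i phi) by exact/smooth_continuous/smooth_partial.
have mp i : measurable_fun setT (partial i phi) by exact: continuous_measurable_R4.
have mphi : measurable_fun setT phi by apply: continuous_measurable_R4; exact: smooth_continuous.
have mG i : measurable_fun setT (fun x => (partial i phi x ^+ 2)%:E).
  by apply/measurable_EFinP; exact: measurable_funX.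
have G0 i x : (0 <= (partial i phi x ^+ 2)%:E)%E by rewrite lee_fin sqr_ge0.
have line i x : poincare leb (h ^+ 3) `[a i, a i + h[%classic
    (fun t => phi (upd i x t)) (fun t => (partial i phi (upd i x t) ^+ 2)%:E).
  apply: (@poincare_line R _ (fun t => partial i phi (upd i x t))) => //.
    by move=> t; exact: smooth_slice.
  exact: continuous_slice.
have mI i : measurable `[a i, a i + h[%classic by exact: measurable_itv.
have h00 := ltW h0.
have P2 (z w : R) : poincare (prodm leb leb) (2 * h ^+ 4)
    (`[a i0, a i0 + h[ `*` `[a i1, a i1 + h[)%classic (fun p => phi (p, z, w))
    (fun p => (partial i0 phi (p, z, w) ^+ 2)%:E + (partial i1 phi (p, z, w) ^+ 2)%:E)%E.
  have pr : measurable_fun setT (fun p : measurableTypeR R * measurableTypeR R => (p, z, w)).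
    by do 2 (apply: measurable_fun_pair => //).
  apply: (@poincare_prod _ _ _ _ _ leb leb _ _ (mI i0) (mI i1) h h h00 h00
     (lebesgue_measure_co _ h0) (lebesgue_measure_co _ h0)
     (fun p => phi (p, z, w)) (fun p => (partial i0 phi (p, z, w) ^+ 2)%:E)
     (fun p => (partial i1 phi (p, z, w) ^+ 2)%:E) (h ^+ 3) (h ^+ 3)) => //.
  - exact: measurableT_comp.
  - exact: (measurableT_comp (mG i0)).
  - exact: (measurableT_comp (mG i1)).
  - by rewrite exprn_ge0.
  - by rewrite exprn_ge0.
  - by rewrite -mulrA -exprS.
  - by rewrite -mulrA -exprS.
  - by move=> y _; exact: (line i0 (0, y, z, w)).
  - by move=> x _; exact: (line i1 (x, 0, z, w)).
have P3 (w : R) : poincare (prodm (prodm leb leb) leb) (4 * h ^+ 5)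
    (`[a i0, a i0 + h[ `*` `[a i1, a i1 + h[ `*` `[a i2, a i2 + h[)%classic
    (fun p => phi (p, w))
    (fun p => (partial i0 phi (p, w) ^+ 2)%:E + (partial i1 phi (p, w) ^+ 2)%:E
      + (partial i2 phi (p, w) ^+ 2)%:E)%E.
  have pr : measurable_fun setT (fun p : measurableTypeR R * measurableTypeR R *
     measurableTypeR R => (p, w)) by apply: measurable_fun_pair.
  have m2 : prodm leb leb (`[a i0, a i0 + h[ `*` `[a i1, a i1 + h[)%classic = (h ^+ 2)%:E.
    rewrite [LHS]product_measure1E// [X in (X * _)%E](lebesgue_measure_co _ h0).
    by rewrite [X in (_ * X)%E](lebesgue_measure_co _ h0) -EFinM expr2.
  apply: (@poincare_prod _ _ _ _ _ (prodm leb leb) leb _ _ (measurableX (mI i0) (mI i1)) (mI i2)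
     (h ^+ 2) h (sqr_ge0 h) h00 m2 (lebesgue_measure_co _ h0)
     (fun p => phi (p, w))
     (fun p => (partial i0 phi (p, w) ^+ 2)%:E + (partial i1 phi (p, w) ^+ 2)%:E)%E
     (fun p => (partial i2 phi (p, w) ^+ 2)%:E) (2 * h ^+ 4) (h ^+ 3)) => //.
  - exact: measurableT_comp.
  - apply: emeasurable_funD; [exact: (measurableT_comp (mG i0))|exact: (measurableT_comp (mG i1))].
  - exact: (measurableT_comp (mG i2)).
  - by move=> x; apply: adde_ge0.
  - by rewrite mulr_ge0// exprn_ge0.
  - by rewrite exprn_ge0.
  - by rewrite le_eqVlt; apply/orP; left; apply/eqP; ring.
  - by have := exprn_ge0 5 h00; rewrite -mulrA -exprD; lra.
  - by move=> [x1 x2] _; exact: (line i2 (x1, x2, 0, w)).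
have m3 : prodm (prodm leb leb) leb
   (`[a i0, a i0 + h[ `*` `[a i1, a i1 + h[ `*` `[a i2, a i2 + h[)%classic = (h ^+ 3)%:E.
  rewrite [LHS]product_measure1E//; last exact: measurableX.
  rewrite [X in (_ * X)%E](lebesgue_measure_co _ h0).
  rewrite [X in (X * _)%E]product_measure1E// [X in (X * _ * _)%E](lebesgue_measure_co _ h0).
  rewrite [X in (_ * X * _)%E](lebesgue_measure_co _ h0) -!EFinM; congr EFin; ring.
apply: (@poincare_prod _ _ _ _ _ (prodm (prodm leb leb) leb) leb _ _
     (measurableX (measurableX (mI i0) (mI i1)) (mI i2)) (mI i3)
     (h ^+ 3) h (exprn_ge0 3 h00) h00 m3 (lebesgue_measure_co _ h0) phi
     (fun p => (partial i0 phi p ^+ 2)%:E + (partial i1 phi p ^+ 2)%:E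
       + (partial i2 phi p ^+ 2)%:E)%E
     (fun p => (partial i3 phi p ^+ 2)%:E) (4 * h ^+ 5) (h ^+ 3)) => //.
- by apply: emeasurable_funD; [apply: emeasurable_funD; exact: mG|exact: mG].
- exact: mG.
- by move=> x; rewrite !adde_ge0//; exact: G0.
- by rewrite mulr_ge0// exprn_ge0.
- by rewrite exprn_ge0.
- by rewrite le_eqVlt; apply/orP; left; apply/eqP; ring.
- by have := exprn_ge0 6 h00; rewrite -mulrA -exprD; lra.
- by move=> [[x1 x2] x3] _; exact: (line i3 (x1, x2, x3, 0)).
Qed.

End poincare_cube.

(** * The Dirichlet energy and the grid estimate *)

Section energy.
Variable R : realType.
Notation mR4 := (measurableTypeR R * measurableTypeR R *
    measurableTypeR R * measurableTypeR R)%type.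
Variable Om : set (R4 R).
Hypotheses (mOm : @measurable _ mR4 Om) (Om_fin : (@leb4 R Om < +oo)%E).
Implicit Types phi psi : R4 R -> R.
Notation I f := (\int[@leb4 R]_(x in Om) f x).

Definition endot phi psi :=
  \sum_(i < 4) I (fun x => partial i phi x * partial i psi x).
Definition energy phi := \sum_(i < 4) I (fun x => partial i phi x ^+ 2).

Lemma energy_ge0 phi : 0 <= energy phi.
Proof. by apply: sumr_ge0 => i _; apply: Ige0 => x _; exact: sqr_ge0. Qed.

Lemma L2_partial Om' i phi : test_function Om' phi -> L2 (@leb4 R) Om (partial i phi).
Proof. by move=> tp; exact: (L2_test mOm Om_fin (test_partial i tp)). Qed.

Lemma energyDZ a phi psi : test_function Om phi -> test_function Om psi ->
  energy (fun x => phi x + a * psi x) =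
  energy phi + 2 * a * endot phi psi + a ^+ 2 * energy psi.
Proof.
move=> tp ts; rewrite /energy /endot !mulr_sumr -!big_split /=.
apply: eq_bigr => i _.
have := I_sqrD mOm a (L2_partial i tp) (L2_partial i ts) => <-.
apply: Ieq => x _; rewrite partialD ?partialZ//.
- exact: test_smooth ts.
- exact: test_smooth tp.
- exact/smoothZ/(test_smooth ts).
Qed.

Lemma energyZ a phi : test_function Om phi -> energy (fun x => a * phi x) = a ^+ 2 * energy phi.
Proof.
move=> tp; rewrite /energy mulr_sumr; apply: eq_bigr => i _.
rewrite -IZ//; last by have [] := L2_partial i tp.
by apply: Ieq => x _; rewrite partialZ ?exprMn//; exact: test_smooth tp.
Qed.

Lemma energyB phi psi : test_function Om phi -> test_function Om psi ->
  energy (fun x => phi x - psi x) = energy phi - 2 * endot phi psi + energy psi.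
Proof.
move=> tp ts; have := energyDZ (-1) tp ts.
suff -> : (fun x => phi x + -1 * psi x) = (fun x => phi x - psi x).
  by move=> ->; move: (energy phi) (endot phi psi) (energy psi) => e1 e2 e3; ring.
by apply/funext => x; rewrite mulN1r.
Qed.

Lemma energyD phi psi : test_function Om phi -> test_function Om psi ->
  energy (fun x => phi x + psi x) = energy phi + 2 * endot phi psi + energy psi.
Proof.
move=> tp ts; have := energyDZ 1 tp ts.
suff -> : (fun x => phi x + 1 * psi x) = (fun x => phi x + psi x).
  by move=> ->; move: (energy phi) (endot phi psi) (energy psi) => e1 e2 e3; ring.
by apply/funext => x; rewrite mul1r.
Qed.

Lemma energyB_le phi psi : test_function Om phi -> test_function Om psi ->
  energy (fun x => phi x - psi x) <= 2 * (energy phi + energy psi).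
Proof.
move=> tp ts; rewrite energyB//.
have := energy_ge0 (fun x => phi x + psi x); rewrite energyD//.
by move: (energy phi) (endot phi psi) (energy psi) => e1 e2 e3; lra.
Qed.

End energy.

Section test_extension.
Variable R : realType.
Variables (Om D : set (R4 R)).

Lemma Rintegral_extend (f : R4 R -> R) : (Om `<=` D) -> (forall x, ~ Om x -> f x = 0) ->
  \int[@leb4 R]_(x in Om) f x = \int[@leb4 R]_(x in D) f x.
Proof.
move=> OD f0; rewrite Rintegral_mkcond [RHS]Rintegral_mkcond; congr (Rintegral _ _ _).
apply/funext => x; rewrite /patch; case: ifPn => xO.
  by rewrite ifT// inE; apply: OD; rewrite inE in xO.
by case: ifPn => // _; rewrite f0// => Ox; move: xO; rewrite notin_setE.
Qed.

End test_extension.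

Section rellich.
Variable R : realType.
Notation mR4 := (measurableTypeR R * measurableTypeR R *
    measurableTypeR R * measurableTypeR R)%type.

(** Expanding the square, the double integral of the Poincare inequality is
    [2 * h ^+ 4] times the integral of [phi ^+ 2] minus twice the squared integral of
    [phi]. *)
Lemma cube_L2 Om' phi (a : 'I_4 -> R) (h : R) : 0 < h -> test_function Om' phi ->
  \int[@leb4 R]_(x in cube a h) (phi x ^+ 2) <=
  h ^- 4 * (\int[@leb4 R]_(x in cube a h) phi x) ^+ 2 +
  4 * h ^+ 2 * \int[@leb4 R]_(x in cube a h) (\sum_(i < 4) partial i phi x ^+ 2).
Proof.
move=> h0 tp.
have mQ := measurable_cube a h.
have fQ : (@leb4 R (cube a h) < +oo)%E by rewrite leb4_cube// ltry.
have vQ : fine (@leb4 R (cube a h)) = h ^+ 4 by rewrite leb4_cube.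
have i1 : intg (@leb4 R) (cube a h) phi.
  exact: (intg_testX mQ fQ 1 tp).
have i2 : intg (@leb4 R) (cube a h) (fun x => phi x ^+ 2).
  exact: (intg_testX mQ fQ 2 tp).
have iG : intg (@leb4 R) (cube a h) (fun x => \sum_(i < 4) partial i phi x ^+ 2).
  apply: (intg_sum mQ) => i; exact: (intg_testX mQ fQ 2 (test_partial i tp)).
have ic (c : R) : intg (@leb4 R) (cube a h) (fun=> c) by exact: intg_cst.
have Ic (c : R) : \int[@leb4 R]_(x in cube a h) c = c * h ^+ 4.
  by rewrite Rintegral_cst// vQ.
have := poincare_cube a h0 (test_smooth tp); rewrite /poincare.
rewrite -(I_EFin mQ iG).
pose S := \int[@leb4 R]_(x in cube a h) (phi x ^+ 2).
pose P := \int[@leb4 R]_(x in cube a h) (phi x).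
pose G := \int[@leb4 R]_(x in cube a h) (\sum_(i < 4) partial i phi x ^+ 2).
rewrite -/S -/P -/G.
have inner x : (\int[@leb4 R]_(y in cube a h) ((phi x - phi y) ^+ 2)%:E =
   (h ^+ 4 * phi x ^+ 2 - 2 * P * phi x + S)%:E)%E.
  have e : forall y, cube a h y ->
      phi x ^+ 2 - (2 * phi x * phi y - phi y ^+ 2) = (phi x - phi y) ^+ 2.
    by move=> y _; ring.
  have ii : intg (@leb4 R) (cube a h) (fun y => 2 * phi x * phi y - phi y ^+ 2).
    by apply: (intgB mQ) => //; exact: (intgZ mQ).
  rewrite -I_EFin//; last by apply: (intg_eq mQ e); exact: (intgB mQ).
  congr EFin.
  transitivity (\int[@leb4 R]_(y in cube a h) (phi x ^+ 2 - (2 * phi x * phi y - phi y ^+ 2))).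
    by apply: Ieq => y hy; rewrite e.
  rewrite IB// IB//; last exact: (intgZ mQ).
  rewrite IZ// Ic -/S -/P; move: (S) (P) (phi x) => s p q; ring.
under eq_integral do rewrite inner.
have ii : intg (@leb4 R) (cube a h) (fun x => h ^+ 4 * phi x ^+ 2 - 2 * P * phi x).
  by apply: (intgB mQ); exact: (intgZ mQ).
rewrite -I_EFin//; last exact: (intgD mQ).
rewrite -EFinM lee_fin ID// IB//; [|exact: (intgZ mQ)..].
rewrite !IZ// Ic -/S -/P => H.
have h4 : 0 < h ^+ 4 by rewrite exprn_gt0.
move: {inner ii} (S) (P) (G) H => s p g H.
have E1 : h ^- 4 * p ^+ 2 + 4 * h ^+ 2 * g = (p ^+ 2 + 4 * h ^+ 6 * g) / h ^+ 4.
  by field; rewrite lt0r_neq0.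
rewrite E1 ler_pdivlMr//.
by move: H; nra.
Qed.

Definition cell (b : R) (N : nat) (J : {ffun 'I_4 -> 'I_N}) : set (R4 R) :=
  cube (fun i => - b + (J i)%:R * (2 * b / N%:R)) (2 * b / N%:R).
Arguments cell : clear implicits.

Lemma grid_1D (b h t : R) (N : nat) : -b <= t -> t < - b + N%:R * h -> 0 < h ->
  exists k : 'I_N, - b + k%:R * h <= t < - b + k%:R * h + h.
Proof.
move=> bt + h0; elim: N => [|N IH]; first by rewrite mul0r addr0 ltNge bt.
have [tN _|Nt tN1] := ltP t (- b + N%:R * h).
  by have [k hk] := IH tN; exists (widen_ord (leqnSn N) k).
by exists ord_max; rewrite Nt /=; move: tN1; rewrite -natr1 mulrDl mul1r addrA.
Qed.

Lemma grid_1D_uniq (b h t : R) (k l : nat) : 0 < h ->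
  - b + k%:R * h <= t < - b + k%:R * h + h ->
  - b + l%:R * h <= t < - b + l%:R * h + h -> (k <= l)%N.
Proof.
move=> h0 /andP[k1 _] /andP[_ l2].
have : k%:R * h < (l%:R + 1) * h by move: k1 l2; lra.
by rewrite ltr_pM2r// natr1 ltr_nat ltnS.
Qed.

Lemma box_cells b N : 0 < b -> (0 < N)%N ->
  box b = \big[setU/set0]_(J <- index_enum {ffun 'I_4 -> 'I_N}) cell b N J.
Proof.
move=> b0 N0; have h0 : 0 < 2 * b / N%:R by rewrite divr_gt0 ?mulr_gt0 ?ltr0n.
have Nh : N%:R * (2 * b / N%:R) = 2 * b by rewrite mulrC divfK// pnatr_eq0 -lt0n.
apply/seteqP; split => x.
  move=> hx.
  have c i : exists k : 'I_N, - b + k%:R * (2 * b / N%:R) <= coord i x <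
     - b + k%:R * (2 * b / N%:R) + (2 * b / N%:R).
    have /andP[x1 x2] := hx i; apply: grid_1D => //.
    by rewrite Nh; move: x2; lra.
  pose J := [ffun i => xchoose (c i)].
  rewrite -bigcup_seq; exists J; first by rewrite /= mem_index_enum.
  by move=> i; rewrite ffunE; exact: (xchooseP (c i)).
rewrite -bigcup_seq => -[J _ hJ] i; have /andP[x1 x2] := hJ i.
have k0 : 0 <= (J i)%:R :> R by rewrite ler0n.
have k1 : (J i)%:R + 1 <= N%:R :> R by rewrite natr1 ler_nat.
have k2 : ((J i)%:R + 1) * (2 * b / N%:R) <= 2 * b by rewrite -[leRHS]Nh ler_wpM2r// ltW.
have k3 : 0 <= (J i)%:R * (2 * b / N%:R) by rewrite mulr_ge0// ltW.
by apply/andP; split; lra.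
Qed.

Lemma integral_cells b N (g : R4 R -> \bar R) : 0 < b -> (0 < N)%N ->
  @measurable_fun _ _ mR4 _ setT g -> (forall x, 0 <= g x)%E ->
  (\int[@leb4 R]_(x in box b) g x =
   \sum_(J : {ffun 'I_4 -> 'I_N}) \int[@leb4 R]_(x in cell b N J) g x)%E.
Proof.
move=> b0 N0 mg g0; rewrite (box_cells b0 N0).
have h0 : 0 < 2 * b / N%:R by rewrite divr_gt0 ?mulr_gt0 ?ltr0n.
rewrite ge0_integral_bigsetU//.
- by move=> J; exact: measurable_cube.
- exact: index_enum_uniq.
- apply/trivIsetP => J K _ _ JK; apply/seteqP; split => // x [hJ hK].
  move/eqP: JK; apply; apply/ffunP => i; apply/val_inj/eqP.
  rewrite eqn_leq (grid_1D_uniq h0 (hJ i) (hK i)).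
  by rewrite (grid_1D_uniq h0 (hK i) (hJ i)).
- exact: measurable_funTS.
Qed.

Variable Om : set (R4 R).
Hypotheses (mOm : @measurable _ mR4 Om) (Om_fin : (@leb4 R Om < +oo)%E).
Variable b : R.
Hypotheses (b0 : 0 < b) (Omb : Om `<=` box b).
Implicit Types phi : R4 R -> R.

Lemma energyE phi : test_function Om phi ->
  energy Om phi = \int[@leb4 R]_(x in Om) (\sum_(i < 4) partial i phi x ^+ 2).
Proof.
move=> tp; rewrite Isum// => i; exact: (intg_testX mOm Om_fin 2 (test_partial i tp)).
Qed.

Lemma Rintegral_cells phi N : (0 < N)%N -> continuous phi -> (forall x, 0 <= phi x) ->
  (forall x, ~ Om x -> phi x = 0) -> (exists M, forall x, `|phi x| <= M) ->
  \int[@leb4 R]_(x in Om) phi x =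
  \sum_(J : {ffun 'I_4 -> 'I_N}) \int[@leb4 R]_(x in cell b N J) phi x.
Proof.
move=> N0 cphi p0 pO [M hM].
have h0 : 0 < 2 * b / N%:R by rewrite divr_gt0 ?mulr_gt0 ?ltr0n.
have mp : @measurable_fun _ _ mR4 _ setT phi by exact: continuous_measurable_R4.
have ip D : @measurable _ mR4 D -> (@leb4 R D < +oo)%E -> intg (@leb4 R) D phi.
  by move=> mD fD; apply: (intg_bounded mD fD _ hM); exact: measurable_funTS.
rewrite (Rintegral_extend Omb)//.
apply: EFin_inj; rewrite I_EFin; [|exact: measurable_box|]; last first.
  by apply: ip; [exact: measurable_box|exact: leb4_box].
have mp' : @measurable_fun _ _ mR4 _ setT (fun x => (phi x)%:E).
  exact/measurable_EFinP.
have p0' x : (0 <= (phi x)%:E)%E by rewrite lee_fin.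
rewrite (integral_cells b0 N0 mp' p0').
rewrite -sumEFin; apply: eq_bigr => J _; rewrite I_EFin//; first exact: measurable_cube.
by apply: ip; [exact: measurable_cube|rewrite leb4_cube// ltry].
Qed.

Lemma continuous_sum n (F : 'I_n -> R4 R -> R) : (forall i, continuous (F i)) ->
  continuous (fun x => \sum_(i < n) F i x).
Proof.
elim: n F => [|n IH] F cF x.
  by under [X in continuous_at _ X]eq_fun do rewrite big_ord0; exact: cst_continuous.
under [X in continuous_at _ X]eq_fun do rewrite big_ord_recr.
apply: (@continuousD _ _ _ (fun x => \sum_(i < n) F (widen_ord (leqnSn n) i) x)).
  exact: IH.
exact: cF.
Qed.

(** On a fine grid the L2 norm is controlled by finitely many averages up to a
    small multiple of the energy: this is the compactness of the embedding. *)
Lemma grid_L2 phi N h : (0 < N)%N -> test_function Om phi -> h = 2 * b / N%:R ->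
  \int[@leb4 R]_(x in Om) (phi x ^+ 2) <=
  h ^- 4 * \sum_(J : {ffun 'I_4 -> 'I_N})
     (\int[@leb4 R]_(x in cell b N J) phi x) ^+ 2 +
  4 * h ^+ 2 * energy Om phi.
Proof.
move=> N0 tp hE.
have h0 : 0 < h by rewrite hE divr_gt0 ?mulr_gt0 ?ltr0n.
have [M [M0 hM]] := test_bounded tp.
have cp : continuous phi by exact/smooth_continuous/(test_smooth tp).
have cd i : continuous (partial i phi).
  exact/smooth_continuous/smooth_partial/(test_smooth tp).
have cs (f : R4 R -> R) : continuous f -> continuous (fun x : R4 R => f x ^+ 2 : R).
  move=> cf x; apply: (@continuous_comp _ _ _ f (fun y => y ^+ 2)); first exact: cf.
  exact: exprn_continuous.
rewrite (@Rintegral_cells _ N)//; last 4 first.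
- exact: cs.
- by move=> x; exact: sqr_ge0.
- by move=> x nx; rewrite (test_out tp nx) expr0n.
- exists (M ^+ 2) => x; rewrite normrX lerXn2r// nnegrE// (le_trans _ (hM x))//.
rewrite energyE// (@Rintegral_cells _ N)//; last 4 first.
- by apply: continuous_sum => i; exact: cs.
- by move=> x; apply: sumr_ge0 => i _; exact: sqr_ge0.
- move=> x nx; rewrite big1// => i _.
  by rewrite (test_out (test_partial i tp) nx) expr0n.
- have hb i : exists M, forall x, `|partial i phi x| <= M.
    by have [K [_ hK]] := test_bounded (test_partial i tp); exists K.
  have /choice[K hK] := hb.
  exists (\sum_(i < 4) K i ^+ 2) => x.
  rewrite ger0_norm; last by apply: sumr_ge0 => i _; exact: sqr_ge0.
  apply: ler_sum => i _; rewrite -real_normK ?num_real// lerXn2r// nnegrE//.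
  exact: le_trans (hK i x).
rewrite !mulr_sumr -big_split /=; apply: ler_sum => J _.
rewrite /cell -hE; exact: cube_L2 tp.
Qed.

End rellich.
Arguments cell {R} b N J.

(** * Rellich compactness *)

Section rellich.
Variable R : realType.
Notation mR4 := (measurableTypeR R * measurableTypeR R *
    measurableTypeR R * measurableTypeR R)%type.
Variable Om : set (R4 R).
Hypotheses (mOm : @measurable _ mR4 Om) (Om_fin : (@leb4 R Om < +oo)%E).
Variable b : R.
Hypotheses (b0 : 0 < b) (Omb : Om `<=` box b).
Implicit Types phi : R4 R -> R.
Notation I f := (\int[@leb4 R]_(x in Om) f x).

(** A bounded real sequence converges along an ultrafilter, so that no diagonal
    extraction is needed to make finitely many averages Cauchy at once. *)
Lemma ultrafilter_bounded_cvg (U : set_system nat) (a : nat -> R) (C : R) :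
  UltraFilter U -> (forall n, `|a n| <= C) ->
  exists l, forall d, 0 < d -> U [set n | `|a n - l| < d].
Proof.
move=> UU aC.
have cK : compact `[-C, C]%classic by exact: segment_compact.
rewrite compact_ultra in cK.
have Ua : UltraFilter (a @ U).
  split=> [|G GF sG]; first exact: fmap_proper_filter.
  rewrite predeqE => A; split; last exact: sG.
  move=> GA; have [//|nA] := in_ultra_setVsetC (a @^-1` A) UU.
  have /filter_ex[y []//] : G (A `&` ~` A) by apply: filterI => //; exact: sG.
have [|l [_ hl]] := cK (a @ U) Ua.
  apply: (@filterS _ U _ setT); last exact: filterT.
  by move=> n _ /=; rewrite in_itv /= -ler_norml.
exists l => d d0.
have : (a @ U) [set y | `|y - l| < d].
  apply: hl; apply/nbhs_ballP; exists d => // y; by rewrite /ball /= distrC.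
exact.
Qed.

Variables (phi : nat -> R4 R -> R) (M : R).
Hypotheses (tphi : forall n, test_function Om (phi n))
  (EM : forall n, energy Om (phi n) <= M)
  (LM : forall n, I (fun x => phi n x ^+ 2) <= M).

(** A grid is chosen so fine that the energy term of [grid_L2] is at most [e / 2]; the
    finitely many averages are then close to their limits along the ultrafilter. *)
Lemma rellich_step (U : set_system nat) (e : R) : UltraFilter U -> 0 < e ->
  exists2 E, U E & forall n m, E n -> E m -> I (fun x => (phi n x - phi m x) ^+ 2) <= e.
Proof.
move=> UU e0.
have M0 : 0 <= M by apply: le_trans (EM 0%N); exact: energy_ge0.
have [N [N0 hN]] : exists N : nat, (0 < N)%N /\ 16 * (2 * b / N%:R) ^+ 2 * M <= e / 2.
  pose K := 128 * b ^+ 2 * M / e.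
  have K0 : 0 <= K by rewrite divr_ge0// ?mulr_ge0 ?sqr_ge0// ltW.
  have [N hN] : exists N : nat, K < N%:R.
    by exists (Num.Def.truncn K).+1; rewrite truncnS_gt.
  have N0 : (0 < N)%N by rewrite -(ltr0n R) (le_lt_trans K0 hN).
  exists N; split => //.
  have NR : 1 <= N%:R :> R by rewrite ler1n.
  have -> : 16 * (2 * b / N%:R) ^+ 2 * M = (K / N%:R ^+ 2) * (e / 2).
    have Nn0 : N%:R != 0 :> R by rewrite pnatr_eq0 -lt0n.
    by rewrite /K; field; rewrite ?Nn0 ?lt0r_neq0.
  rewrite ler_piMl//; first by rewrite divr_ge0// ltW.
  rewrite ler_pdivrMr ?exprn_gt0 ?ltr0n// mul1r expr2.
  by apply: le_trans (ltW hN) _; rewrite ler_peMl// ler0n.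
set h := 2 * b / N%:R in hN.
have h0 : 0 < h by rewrite divr_gt0 ?mulr_gt0 ?ltr0n.
have h40 : 0 <= h ^+ 4 by exact: exprn_ge0 (ltW h0).
pose av n (J : {ffun 'I_4 -> 'I_N}) := \int[@leb4 R]_(x in cell b N J) phi n x.
(* Bounds the number of cells; adding 1 makes it positive. *)
pose W : R := \sum_(J : {ffun 'I_4 -> 'I_N}) 1 + 1.
have W0 : 0 < W by rewrite ltr_pwDr// sumr_ge0.
pose d2 := e / 2 * h ^+ 4 / (4 * W).
have d20 : 0 < d2.
  apply: divr_gt0; last by rewrite mulr_gt0.
  by apply: mulr_gt0; [exact: divr_gt0|exact: exprn_gt0].
pose d := Num.sqrt d2.
have d0 : 0 < d by rewrite sqrtr_gt0.
have mc J := measurable_cube (fun i => - b + (J i : 'I_N)%:R * h) h.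
have fc (J : {ffun 'I_4 -> 'I_N}) : (@leb4 R (cell b N J) < +oo)%E.
  by rewrite leb4_cube// ltry.
have avC J n : `|av n J| <= Num.sqrt (h ^+ 4 * M).
  rewrite -(@ler_pXn2r _ 2)// ?nnegrE ?sqrtr_ge0// real_normK ?num_real//.
  rewrite sqr_sqrtr; last by rewrite mulr_ge0.
  have L1 : L2 (@leb4 R) (cell b N J) (fun=> 1).
    by apply: (@L2_bounded _ _ _ _ _ 1) => //; [exact: mc|move=> x; rewrite normr1].
  have L2p : L2 (@leb4 R) (cell b N J) (phi n) by exact: (L2_test (mc J) (fc J) (tphi n)).
  have := I_CS (mc J) L1 L2p.
  have -> : \int[@leb4 R]_(x in cell b N J) (1 * phi n x) = av n J.
    by apply: Ieq => x _; rewrite mul1r.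
  move=> /le_trans; apply.
  have -> : \int[@leb4 R]_(x in cell b N J) (1 ^+ 2) = h ^+ 4.
    by rewrite (Rintegral_cst _ (mc J)) expr1n mul1r leb4_cube.
  rewrite ler_wpM2l//.
  apply: le_trans (LM n).
  have [K [_ hK]] := test_bounded (tphi n).
  have cp : continuous (phi n) by exact/smooth_continuous/(test_smooth (tphi n)).
  have cs : continuous (fun x : R4 R => phi n x ^+ 2 : R).
    move=> x; apply: (@continuous_comp _ _ _ (phi n) (fun y => y ^+ 2)); first exact: cp.
    exact: exprn_continuous.
  have bK : exists K, forall x, `|phi n x ^+ 2| <= K.
    exists (K ^+ 2) => x; rewrite normrX lerXn2r// nnegrE//.
    exact: le_trans (hK x).
  have out x : ~ Om x -> phi n x ^+ 2 = 0.
    by move=> nx; rewrite (test_out (tphi n) nx) expr0n.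
  rewrite (Rintegral_cells b0 Omb N0 cs (fun x => sqr_ge0 _) out bK).
  rewrite (bigD1 J)//= lerDl; apply: sumr_ge0 => L _.
  by apply: Ige0 => x _; exact: sqr_ge0.
have hl J : exists l, forall d, 0 < d -> U [set n | `|av n J - l| < d].
  by apply: ultrafilter_bounded_cvg (avC J).
have /choice[l {}hl] := hl.
exists [set n | forall J, `|av n J - l J| < d].
  by apply: filter_forall => J; exact: hl.
move=> n m hn hm.
have tB := testB (tphi n) (tphi m).
apply: le_trans (grid_L2 mOm Om_fin b0 Omb N0 tB (erefl h)) _.
have -> : e = e / 2 + e / 2 by field.
apply: lerD; last first.
  apply: le_trans hN; rewrite mulrAC -[leRHS]mulrA [leRHS]mulrC.
  have := energyB_le mOm Om_fin (tphi n) (tphi m).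
  have := EM n; have := EM m; have := sqr_ge0 h.
  move: (energy _ (fun x => _ - _)) (energy Om (phi n)) (energy Om (phi m)) (h ^+ 2).
  by move=> e1 e2 e3 hh; nra.
have hJ J : (\int[@leb4 R]_(x in cell b N J) (phi n x - phi m x)) ^+ 2 <= 4 * d2.
  rewrite (IB (mc J)); last 2 first.
  - exact: (intg_testX (mc J) (fc J) 1 (tphi n)).
  - exact: (intg_testX (mc J) (fc J) 1 (tphi m)).
  rewrite -/(av n J) -/(av m J).
  have -> : 4 * d2 = (2 * d) ^+ 2 by rewrite exprMn sqr_sqrtr ?(ltW d20)//; ring.
  rewrite -real_normK ?num_real// lerXn2r// ?nnegrE ?mulr_ge0 ?(ltW d0)//.
  have -> : av n J - av m J = (av n J - l J) - (av m J - l J) by ring.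
  by apply: le_trans (ler_normB _ _) _; have := hn J; have := hm J; lra.
apply: (@le_trans _ _ (h ^- 4 * \sum_(J : {ffun 'I_4 -> 'I_N}) (4 * d2))).
  rewrite ler_wpM2l ?invr_ge0//.
  by apply: ler_sum => J _; exact: hJ.
apply: (@le_trans _ _ (h ^- 4 * (W * (4 * d2)))).
  apply: ler_wpM2l; first by rewrite invr_ge0.
  have -> : \sum_(J : {ffun 'I_4 -> 'I_N}) (4 * d2) =
      (\sum_(J : {ffun 'I_4 -> 'I_N}) 1) * (4 * d2).
    by rewrite mulr_suml; apply: eq_bigr => J _; rewrite mul1r.
  apply: ler_wpM2r; first by rewrite mulr_ge0// ltW.
  by rewrite lerDl.
rewrite le_eqVlt; apply/orP; left; apply/eqP; rewrite /d2.
by field; rewrite !lt0r_neq0.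
Qed.

(** Rellich's theorem. The index [n k] lies in the sets attached to both [k] and [k - 1],
    so that consecutive terms are close enough for the completeness of L2. *)
Lemma rellich : exists u (n : nat -> nat), [/\ L2 (@leb4 R) Om u,
  forall k, (k <= n k)%N &
  forall k, I (fun x => (phi (n k) x - u x) ^+ 2) <= 8 * 4^-1 ^+ k].
Proof.
have [U [UU Uoo]] := ultraFilterLemma eventually_filter.
have e0 k : 0 < 16^-1 ^+ k :> R by rewrite exprn_gt0// invr_gt0.
have /choice[E hE] : forall k, exists E, U E /\ forall n m, E n -> E m ->
    I (fun x => (phi n x - phi m x) ^+ 2) <= 16^-1 ^+ k.
  by move=> k; have [E UE hE] := rellich_step UU (e0 k); exists E.
have Un k : U [set n | (k <= n)%N] by apply: Uoo; exists k.
have hn k : exists n, [/\ (k <= n)%N, E k n & E k.-1 n].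
  have : U ([set n | (k <= n)%N] `&` E k `&` E k.-1).
    by apply: filterI; [apply: filterI => //; exact: (hE k).1|exact: (hE k.-1).1].
  by move=> /filter_ex[n [[h1 h2] h3]]; exists n.
have /choice[n {}hn] := hn.
have Lp k : L2 (@leb4 R) Om (phi (n k)) by exact: (L2_test mOm Om_fin (tphi _)).
have [k|u [Lu hu]] := L2_complete mOm Lp.
  by apply: (hE k).2; [have [] := hn k.+1|have [] := hn k].
by exists u, n; split => // k; have [] := hn k.
Qed.

End rellich.

(** * The Sobolev and Poincare inequalities for test functions *)

Section sobolev.
Variable R : realType.
Notation mR4 := (measurableTypeR R * measurableTypeR R *
    measurableTypeR R * measurableTypeR R)%type.
Implicit Types phi psi : R4 R -> R.

Lemma ae_leb4 (P Q : R4 R -> Prop) : (forall x, P x -> Q x) ->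
  {ae @leb4 R, forall x, P x} -> {ae @leb4 R, forall x, Q x}.
Proof. by move=> PQ; apply: filterS; first exact: (ae_filter_ringOfSetsType (@leb4 R)). Qed.

Lemma ae_zero_intP (D : set (R4 R)) f : @measurable _ mR4 D -> L2 (@leb4 R) D f ->
  ae_zero D f <-> \int[@leb4 R]_(x in D) (f x ^+ 2) = 0.
Proof.
move=> mD [mf if2].
have mf2 : @measurable_fun _ _ mR4 _ D (fun x => (f x ^+ 2)%:E).
  exact: measurable_int if2.
have [h1 h2] := ae_eq_integral_abs (@leb4 R) mD mf2.
have E : (\int[@leb4 R]_(x in D) `|(f x ^+ 2)%:E| = \int[@leb4 R]_(x in D) (f x ^+ 2)%:E)%E.
  by apply: eq_integral => x _; rewrite gee0_abs// lee_fin sqr_ge0.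
split=> [h|h].
  have /h2 : ae_eq (@leb4 R) D (fun x => (f x ^+ 2)%:E) (cst 0%E).
    by apply: (ae_leb4 _ h) => x hx Dx; rewrite hx// expr0n.
  by rewrite E /Rintegral => ->.
have : (\int[@leb4 R]_(x in D) `|(f x ^+ 2)%:E|)%E = 0%E.
  by rewrite E -I_EFin// h.
move=> /h1; apply: ae_leb4 => x hx Dx.
by have [/eqP] := hx Dx; rewrite sqrf_eq0 => /eqP.
Qed.

Section test_whole.
Variable Om : set (R4 R).

Lemma intg_test_extend D D' n phi : test_function Om phi ->
  @measurable _ mR4 D -> @measurable _ mR4 D' -> D `<=` D' ->
  (forall x, D' x -> ~ D x -> phi x = 0) -> (@leb4 R D < +oo)%E ->
  intg (@leb4 R) D' (fun x => phi x ^+ n.+1).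
Proof.
move=> tp mD mD' DD' out fD.
have /(integrable_mkcond _ mD) := intg_testX mD fD n.+1 tp.
move=> /(integrableS measurableT mD' (@subsetT _ _)); apply: eq_integrable => // x.
rewrite inE => D'x; rewrite /patch; case: ifPn => //.
by rewrite notin_setE => nD; rewrite out// expr0n.
Qed.

Lemma intgT_test n phi : test_function Om phi ->
  intg (@leb4 R) setT (fun x => phi x ^+ n.+1).
Proof.
move=> tp; have [_ cK _] := tp; have [b [b0 hb]] := bounded_box (compact_bounded cK).
apply: (@intg_test_extend (box b) setT n phi tp) => //.
- exact: measurable_box.
- by move=> x _ nx; apply/eqP/negPn/negP => h; apply/nx/hb/closure_neq0.
- exact: leb4_box.
Qed.

Lemma mfT_smooth phi : smooth phi -> @measurable_fun _ _ mR4 _ setT phi.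
Proof. by move=> sp; apply: continuous_measurable_R4; exact: smooth_continuous. Qed.

Lemma inL_testT p phi : (0 < p)%N -> test_function Om phi -> inL setT p phi.
Proof.
case: p => // p _ tp; split; first exact: mfT_smooth (test_smooth tp).
apply: intg_eq (intg_norm (intgT_test p tp)) => // x _; exact: normrX.
Qed.

Lemma testM psi phi : smooth psi -> test_function Om phi ->
  test_function Om (fun x => psi x * phi x).
Proof.
move=> sp tp; apply: (test_supported tp); first exact: smoothM (test_smooth tp).
move=> x /= h; apply: closure_neq0; apply: contra_neq h => ->; exact: mulr0.
Qed.

Lemma integration_by_parts_test (D : set (R4 R)) i psi phi : smooth psi -> test_function Om phi ->
  (forall x, ~ D x -> phi x = 0 /\ partial i phi x = 0) ->
  \int[@leb4 R]_(x in D) (psi x * partial i phi x) =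
  - \int[@leb4 R]_(x in D) (partial i psi x * phi x).
Proof.
move=> sp tp out.
rewrite (Rintegral_extend (D := setT))//; last by move=> x /out[_ ->]; rewrite mulr0.
rewrite [in RHS](Rintegral_extend (D := setT))//; last by move=> x /out[-> _]; rewrite mulr0.
have := integral_partial0 i (testM sp tp).
have -> : partial i (fun x => psi x * phi x) =
   (fun x => psi x * partial i phi x + partial i psi x * phi x).
  apply: is_derive_partial => x.
  have h1 := smooth_is_derive i x sp; have h2 := smooth_is_derive i x (test_smooth tp).
  by apply: is_derive_eq (is_deriveM h1 h2) _; rewrite /GRing.scale /= [_ * partial i psi x]mulrC.
rewrite ID//; last 2 first.
- exact: (intgT_test 0 (testM sp (test_partial i tp))).
- exact: (intgT_test 0 (testM (smooth_partial i sp) tp)).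
by move/eqP; rewrite addr_eq0 => /eqP.
Qed.

End test_whole.

(** The product of a smooth function with a test function is a test function, whose
    derivative integrates to 0. *)
Lemma weak_gradient_test Om phi : smooth phi ->
  weak_gradient Om phi (fun i => partial i phi).
Proof.
move=> sp i psi tpsi; apply: (integration_by_parts_test sp tpsi) => x nx.
by rewrite (test_out tpsi nx) (test_out (test_partial i tpsi) nx).
Qed.

Notation S := (sobolev_constant R).

Lemma sobolev_lb : has_lbound [set q | exists u gu, [/\ @D12 R u gu, ~ ae_zero setT u &
    q = (\int[@leb4 R]_x (\sum_(i < 4) gu i x ^+ 2)) /
        Num.sqrt (\int[@leb4 R]_x `|u x| ^+ 4)]].
Proof.
exists 0 => _ [u [gu [_ _ ->]]]; rewrite divr_ge0//; apply: Rintegral_ge0 => x _.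
by apply: sumr_ge0 => i _; exact: sqr_ge0.
Qed.

Lemma sobolev_ge0 : 0 <= S.
Proof.
rewrite /sobolev_constant; set E := [set q | _].
have [E0|/set0P/negP/negPn/eqP->] := pselect (E !=set0); last by rewrite inf0.
apply: lb_le_inf => // _ [u [gu [_ _ ->]]]; rewrite divr_ge0//; apply: Rintegral_ge0 => x _.
by apply: sumr_ge0 => i _; exact: sqr_ge0.
Qed.

Section test.
Variable Om : set (R4 R).
Hypotheses (mOm : @measurable _ mR4 Om) (Om_fin : (@leb4 R Om < +oo)%E).
Notation I f := (\int[@leb4 R]_(x in Om) f x).

(** A test function with its classical partial derivatives competes in the infimum
    that defines the Sobolev constant. *)
Lemma sobolev_ineq phi : test_function Om phi ->
  S * Num.sqrt (I (fun x => phi x ^+ 4)) <= energy Om phi.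
Proof.
move=> tp.
have F0 : 0 <= I (fun x => phi x ^+ 4) by apply: Ige0 => x _; rewrite (exprM _ 2 2) sqr_ge0.
have [->|Fn0] := eqVneq (I (fun x => phi x ^+ 4)) 0.
  by rewrite sqrtr0 mulr0 energy_ge0.
have Fp : 0 < I (fun x => phi x ^+ 4) by rewrite lt_def Fn0.
rewrite -ler_pdivlMr ?sqrtr_gt0//.
apply: ge_inf; first exact: sobolev_lb.
have tT : test_function setT phi by apply: test_subset tp.
exists phi, (fun i => partial i phi); split.
- split; [exact: inL_testT tp| |].
    by move=> i; apply: inL_testT (test_partial i tp).
  by apply: weak_gradient_test; exact: test_smooth tp.
- move=> h; move/eqP: Fn0; apply.
  rewrite (Rintegral_extend (D := setT))//; last first.
    by move=> x nx; rewrite (test_out tp nx) expr0n.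
  have t2 : L2 (@leb4 R) setT (fun x => phi x ^+ 2).
    split; first exact: intg_mf (intgT_test 1 tp).
    have := intgT_test 3 tp; apply: intg_eq => // x _; by rewrite -exprM.
  have /(ae_zero_intP measurableT t2).1 : ae_zero setT (fun x => phi x ^+ 2).
    by apply: (ae_leb4 _ h) => x hx _; rewrite hx// expr0n.
  by move=> <-; apply: Ieq => x _; rewrite -exprM.
have -> : \int[@leb4 R]_x (\sum_(i < 4) partial i phi x ^+ 2) = energy Om phi.
  rewrite energyE//; symmetry; apply: Rintegral_extend => // x nx.
  by apply: big1 => i _; rewrite (test_out (test_partial i tp) nx) expr0n.
congr (_ / Num.sqrt _).
rewrite (Rintegral_extend (D := setT))//; last first.
  by move=> x nx; rewrite (test_out tp nx) expr0n.
by apply: Ieq => x _; rewrite -normrX ger0_norm// (exprM _ 2 2) sqr_ge0.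
Qed.

Lemma sobolev_L4 phi : 0 < S -> test_function Om phi ->
  I (fun x => phi x ^+ 4) <= energy Om phi ^+ 2 / S ^+ 2.
Proof.
move=> S0 tp; have := sobolev_ineq tp.
have F0 : 0 <= I (fun x => phi x ^+ 4) by apply: Ige0 => x _; rewrite (exprM _ 2 2) sqr_ge0.
rewrite ler_pdivlMr ?exprn_gt0// => h.
have : (S * Num.sqrt (I (fun x => phi x ^+ 4))) ^+ 2 <= energy Om phi ^+ 2.
  by apply: lerXn2r; rewrite ?nnegrE ?energy_ge0 ?mulr_ge0 ?sqrtr_ge0// ltW.
by rewrite exprMn sqr_sqrtr// mulrC.
Qed.

(** Poincare's inequality follows from Sobolev's since Om has finite measure. *)
Lemma poincare_test phi : 0 < S -> test_function Om phi ->
  I (fun x => phi x ^+ 2) <= Num.sqrt (vol Om) / S * energy Om phi.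
Proof.
move=> S0 tp; have F2 := sobolev_L4 S0 tp.
have v0 : 0 <= vol Om by exact: fine_ge0.
have L1 : L2 (@leb4 R) Om (fun=> 1).
  by apply: (@L2_bounded _ _ mOm Om_fin _ 1) => // x; rewrite normr1.
have L2s : L2 (@leb4 R) Om (fun x => phi x ^+ 2).
  split; first exact: intg_mf (intg_testX mOm Om_fin 2 tp).
  have := intg_testX mOm Om_fin 4 tp; apply: intg_eq => // x _; by rewrite -exprM.
have := I_CS mOm L1 L2s.
have -> : I (fun x => 1 * phi x ^+ 2) = I (fun x => phi x ^+ 2).
  by apply: Ieq => x _; rewrite mul1r.
have -> : I (fun=> 1 ^+ 2) = vol Om by rewrite (Rintegral_cst _ mOm) expr1n mul1r.
have -> : I (fun x => (phi x ^+ 2) ^+ 2) = I (fun x => phi x ^+ 4).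
  by apply: Ieq => x _; rewrite -exprM.
move=> h; have e0 := energy_ge0 Om phi.
rewrite -(@ler_pXn2r _ 2)// ?nnegrE; last 2 first.
- by apply: Ige0 => x _; exact: sqr_ge0.
- by rewrite !mulr_ge0 ?sqrtr_ge0 ?invr_ge0// ltW.
apply: le_trans h _; rewrite !exprMn sqr_sqrtr// exprVn -mulrA ler_wpM2l//.
by rewrite mulrC.
Qed.

End test.

End sobolev.

(** * Existence of test functions *)

Section bump.
Variable R : realType.
Notation mR4 := (measurableTypeR R * measurableTypeR R *
    measurableTypeR R * measurableTypeR R)%type.
Implicit Types phi psi : R4 R -> R.
Notation S := (sobolev_constant R).

(** If every test function vanished, every function would have weak gradient 0,
    and the indicator of a box would give a zero Sobolev quotient. *)
Lemma exists_nonzero_test_whole : 0 < S ->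
  exists phi x, test_function setT phi /\ phi x != 0.
Proof.
move=> S0; apply: contrapT => hno.
have no phi : test_function setT phi -> forall x, phi x = 0.
  by move=> tp x; apply/eqP/negPn/negP => h; apply: hno; exists phi, x.
suff : S <= 0 by rewrite leNgt S0.
have mB := @measurable_box R 1.
have mu_ : @measurable_fun _ _ mR4 _ setT (\1_(box 1) : R4 R -> R).
  exact: measurable_indic.
have e4 n : (fun x => `|\1_(box 1) x| ^+ n.+1) = (\1_(box 1) : R4 R -> R).
  apply/funext => x; rewrite indicE; case: (_ \in _) => /=.
    by rewrite normr1 expr1n.
  by rewrite normr0 expr0n.
have iu n : intg (@leb4 R) setT (fun x => `|\1_(box 1) x| ^+ n.+1).
  rewrite e4; have h1 : intg (@leb4 R) (box 1) (fun=> 1).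
    exact: intg_cst (@leb4_box R 1) _.
  move/(integrable_mkcond _ mB): h1; apply: eq_integrable => // x _.
  by rewrite /patch indicE; case: (_ \in _).
apply: ge_inf; first exact: sobolev_lb.
exists (\1_(box 1)), (fun _ _ => 0); split.
- split.
  + by split => //; exact: iu.
  + move=> i; split => //; apply: (@intg_eq _ _ _ _ _ measurableT (fun=> 0)).
      by move=> x _; rewrite normr0 expr0n.
    exact: intg0.
  move=> i psi tpsi; have z := no _ (test_partial i tpsi).
  rewrite (Ieq _ (g := fun=> 0)); last by move=> x _; rewrite z mulr0.
  rewrite [in RHS](Ieq _ (g := fun=> 0)); last by move=> x _; rewrite mul0r.
  by rewrite I0// oppr0.
- have L : L2 (@leb4 R) setT (\1_(box 1)).
    split => //; apply: (intg_eq measurableT _ (iu 1%N)) => x _.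
    by rewrite real_normK ?num_real.
  move=> /(ae_zero_intP measurableT L).1.
  have -> : \int[@leb4 R]_x (\1_(box 1) x ^+ 2) = fine (@leb4 R (box 1)).
    rewrite -[RHS]mul1r -(Rintegral_cst _ mB) [RHS]Rintegral_mkcond.
    apply: Ieq => x _; rewrite /patch indicE; case: (_ \in _); by rewrite ?expr1n ?expr0n.
  rewrite boxE leb4X//.
  have E : @lebesgue_measure R `[(-1)%R, 1%R[%classic = 2%:E.
    by rewrite lebesgue_measure_itv /= lte_fin ifT; [rewrite -EFinB; congr EFin; ring|lra].
  rewrite !E -!EFinM /= => /eqP.
  by rewrite !mulf_eq0 pnatr_eq0.
rewrite (Ieq _ (g := fun=> 0)); first by rewrite I0// mul0r.
by move=> x _; rewrite big1// => i _; rewrite expr0n.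
Qed.

Lemma norm_coord_lt (x : R4 R) (r : R) : (forall i, `|coord i x| < r) -> `|x| < r.
Proof.
move=> h; rewrite !prod_normE !gt_max.
have := h (@Ordinal 4 0 isT); have := h (@Ordinal 4 1 isT).
have := h (@Ordinal 4 2 isT); have := h (@Ordinal 4 3 isT).
by rewrite /coord !(tnth_nth 0) /= => -> -> -> ->.
Qed.

Variable Om : set (R4 R).
Hypotheses (oOm : open Om) (Om0 : Om !=set0) (Om_fin : (@leb4 R Om < +oo)%E).
Notation I f := (\int[@leb4 R]_(x in Om) f x).
Let mOm : @measurable _ mR4 Om := open_measurable_R4 oOm.

(** A continuous function that is not 0 at a point is bounded away from 0 on a small
    cube. *)
Lemma integral_sqr_test_gt0 phi x : test_function Om phi -> phi x != 0 ->
  0 < I (fun x => phi x ^+ 2).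
Proof.
move=> tp px.
have Ox : Om x by apply: contrapT => nx; move/eqP: px; apply; exact: test_out tp nx.
have cp : continuous phi by exact/smooth_continuous/(test_smooth tp).
pose d := `|phi x| / 2.
have d0 : 0 < d by rewrite divr_gt0// normr_gt0.
have : nbhs x (Om `&` [set y | d < `|phi y|]).
  apply: filterI; first exact: open_nbhs_nbhs.
  have : nbhs (phi x) [set z | d < `|z|].
    apply: open_nbhs_nbhs; split; last by rewrite /d /= ltr_pdivrMr// ltr_pMr ?normr_gt0// ltr1n.
    exact: (open_comp (fun z _ => @norm_continuous _ _ z) (@open_gt R d)).
  by move/(cp x).
move=> /nbhs_ballP[r /= r0 hr].
pose Q := cube (fun i => coord i x) r.
have QO y : Q y -> Om y /\ d < `|phi y|.
  move=> Qy; apply: hr; rewrite -ball_normE /ball_ /=.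
  apply: norm_coord_lt => i; have /andP[h1 h2] := Qy i.
  have -> : coord i (x - y) = coord i x - coord i y.
    by rewrite -scaleN1r coordD coordZ mulN1r.
  by rewrite distrC ger0_norm ?subr_ge0// ltrBlDl.
have mQ := measurable_cube (fun i => coord i x) r.
have fQ : (@leb4 R Q < +oo)%E by rewrite leb4_cube// ltry.
have iQ := intg_testX mQ fQ 2 tp.
have iO := intg_testX mOm Om_fin 2 tp.
apply: (@lt_le_trans _ _ (d ^+ 2 * r ^+ 4)); first by rewrite mulr_gt0 ?exprn_gt0.
have -> : d ^+ 2 * r ^+ 4 = \int[@leb4 R]_(y in Q) (d ^+ 2).
  by rewrite (Rintegral_cst _ mQ) leb4_cube.
apply: (@le_trans _ _ (\int[@leb4 R]_(y in Q) (phi y ^+ 2))).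
  apply: (Ile mQ) => //; first exact: intg_cst.
  move=> y /QO[_ /ltW h]; rewrite -[phi y ^+ 2]real_normK ?num_real//.
  by apply: lerXn2r; rewrite ?nnegrE// ltW.
rewrite -lee_fin !I_EFin//; apply: ge0_subset_integral => //.
- by apply/measurable_EFinP; exact: (intg_mf iO).
- by move=> y _; rewrite lee_fin sqr_ge0.
- by move=> y /QO[].
Qed.

(** A nonzero test function on the whole space is shrunk into a ball inside [Om] by
    a homothety. *)
Lemma exists_nonzero_test : 0 < S -> exists phi, test_function Om phi /\
  0 < I (fun x => phi x ^+ 2).
Proof.
move=> /exists_nonzero_test_whole[f [z [[sf cK _] fz]]].
set K := closure _ in cK.
have [y0 Oy0] := Om0.
have [r /= r0 hr] : nbhs_ball y0 Om by apply/nbhs_ballP; exact: open_nbhs_nbhs.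
have [M [_ hM]] := compact_bounded cK.
pose B := `|M| + 1 + `|z|.
have B0 : 0 < B by rewrite /B; have := normr_ge0 M; have := normr_ge0 z; lra.
pose c := 2 * B / r.
have c0 : 0 < c by rewrite divr_gt0// mulr_gt0.
have cn0 : c != 0 by rewrite gt_eqF.
pose phi y := f ((z - c *: y0) + c *: y).
pose g (w : R4 R) := c^-1 *: w + (y0 - c^-1 *: z).
have gK y : g ((z - c *: y0) + c *: y) = y.
  rewrite /g !scalerDr scalerN !scalerA mulVf// !scale1r.
  by rewrite -(opprB (c^-1 *: z) y0) addrAC subrr add0r.
have cg : continuous g.
  move=> w; apply: (@continuousD _ _ _ (fun w => c^-1 *: w) (cst _)).
    exact: scaler_continuous.
  exact: cst_continuous.
have cgK : compact [set g w | w in K].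
  by apply: continuous_compact => //; exact: continuous_subspaceT.
have sub : closure [set y | phi y != 0] `<=` [set g w | w in K].
  rewrite [X in _ `<=` X](closure_id _).1; last by apply: compact_closed cgK; exact: norm_hausdorff.
  apply: closure_subset => y /= hy; exists ((z - c *: y0) + c *: y) => //.
  exact: closure_neq0.
have tphi : test_function Om phi.
  split.
  - exact: smooth_affine.
  - by apply: subclosed_compact sub => //; exact: closed_closure.
  move=> y /sub[w Kw <-]; apply: hr; rewrite -ball_normE /ball_ /=.
  have -> : y0 - g w = c^-1 *: (z - w).
    by rewrite /g scalerBr addrCA opprD addrA subrr add0r opprB.
  rewrite normrZ ger0_norm ?invr_ge0 ?(ltW c0)// mulrC ltr_pdivrMr//.
  have hw : `|w| <= `|M| + 1.
    by apply: (hM (`|M| + 1)) => //; rewrite (le_lt_trans (ler_norm _))// ltrDl.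
  have -> : r * c = 2 * B by rewrite /c mulrC divfK// gt_eqF.
  apply: le_lt_trans (ler_normB _ _) _; rewrite /B; have := normr_ge0 M; have := normr_ge0 z; lra.
exists phi; split => //.
apply: (@integral_sqr_test_gt0 _ y0) => //.
by rewrite /phi subrK.
Qed.

End bump.

(** * The space H10 *)

Lemma eq0_small (R : realType) (x C : R) : 0 <= C ->
  (forall e, 0 < e -> `|x| <= C * e) -> x = 0.
Proof.
move=> C0 h; apply/eqP/negPn/negP => x0.
have nx : 0 < `|x| by rewrite normr_gt0.
have c1 : 0 < C + 1 by rewrite ltr_pwDr.
have := h (`|x| / (C + 1)) (divr_gt0 nx c1).
rewrite mulrCA -ler_pdivrMl// mulVf ?gt_eqF// ler_pdivlMr// mul1r; lra.
Qed.

Section H10.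
Variable R : realType.
Notation mR4 := (measurableTypeR R * measurableTypeR R *
    measurableTypeR R * measurableTypeR R)%type.
Variable Om : set (R4 R).
Hypotheses (mOm : @measurable _ mR4 Om) (Om_fin : (@leb4 R Om < +oo)%E).
Implicit Types (phi psi u v w f : R4 R -> R) (gu gw : 'I_4 -> R4 R -> R).
Notation I f := (\int[@leb4 R]_(x in Om) f x).
Notation N f := (N2 (@leb4 R) Om f).
Notation L2 := (L2 (@leb4 R) Om).
Notation test := (test_function Om).

Lemma inL2P u : inL Om 2 u <-> L2 u.
Proof.
by split=> -[h1 h2]; split => //; apply: (intg_eq mOm _ h2) => x _;
   rewrite real_normK ?num_real.
Qed.

Lemma test_L2 phi : test phi -> L2 phi.
Proof. exact: L2_test. Qed.

(** The density condition of H10 with norms instead of a sum of squared norms, so that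
    the triangle inequality applies to each component. *)
Definition approximable u gu := forall e, 0 < e -> exists phi,
  [/\ test phi, N (fun x => u x - phi x) <= e &
      forall i, N (fun x => gu i x - partial i phi x) <= e].

(** Integration by parts holds for the approximating test functions and both sides are
    continuous in L2. *)
Lemma weak_gradient_approximable u gu : L2 u -> (forall i, L2 (gu i)) ->
  approximable u gu -> weak_gradient Om u gu.
Proof.
move=> Lu Lg ap i psi ts.
apply/eqP; rewrite -subr_eq0 opprK; apply/eqP.
have Lp := test_L2 ts; have Ld := test_L2 (test_partial i ts).
apply: (@eq0_small _ _ (N (partial i psi) + N psi)).
  by rewrite addr_ge0 ?N2_ge0.
move=> e /ap[phi [tp h1 /(_ i) h2]].
have Lf := test_L2 tp; have Lfd := test_L2 (test_partial i tp).
have Z : I (fun x => phi x * partial i psi x) + I (fun x => partial i phi x * psi x) = 0.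
  by rewrite (@weak_gradient_test _ Om _ (test_smooth tp) i psi ts) addNr.
have -> : I (fun x => u x * partial i psi x) + I (fun x => gu i x * psi x) =
   I (fun x => (u x - phi x) * partial i psi x) +
   I (fun x => (gu i x - partial i phi x) * psi x).
  have -> : I (fun x => (u x - phi x) * partial i psi x) =
     I (fun x => u x * partial i psi x) - I (fun x => phi x * partial i psi x).
    rewrite -(IB mOm (L2_mul mOm Lu Ld) (L2_mul mOm Lf Ld)).
    by apply: Ieq => x _; rewrite mulrBl.
  have -> : I (fun x => (gu i x - partial i phi x) * psi x) =
     I (fun x => gu i x * psi x) - I (fun x => partial i phi x * psi x).
    rewrite -(IB mOm (L2_mul mOm (Lg i) Lp) (L2_mul mOm Lfd Lp)).
    by apply: Ieq => x _; rewrite mulrBl.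
  by rewrite addrACA -opprD Z subr0.
apply: le_trans (ler_normD _ _) _.
have k1 := I_CS_N2 mOm (L2B mOm Lu Lf) Ld.
have k2 := I_CS_N2 mOm (L2B mOm (Lg i) Lfd) Lp.
rewrite mulrDl; apply: lerD.
  by apply: le_trans k1 _; rewrite mulrC ler_wpM2l// N2_ge0.
by apply: le_trans k2 _; rewrite mulrC ler_wpM2l// N2_ge0.
Qed.

Lemma H10P u gu : H10 Om u gu <->
  [/\ L2 u, forall i, L2 (gu i) & approximable u gu].
Proof.
have N2le (f : R4 R -> R) e : 0 <= e -> (N f <= e) = (I (fun x => f x ^+ 2) <= e ^+ 2).
  move=> e0; rewrite -N2_sqr; apply/esym; apply: (@ler_pXn2r R 2 isT) => //.
  by rewrite nnegrE N2_ge0.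
split.
  move=> [[/inL2P Lu Lg wg] ap]; split=> // [i|e e0]; first exact/inL2P.
  have [phi tp h] := ap (e ^+ 2) (exprn_gt0 2 e0).
  have g0 (f : R4 R -> R) : 0 <= I (fun x => f x ^+ 2) by apply: Ige0 => x _; exact: sqr_ge0.
  have s0 : 0 <= \sum_(i < 4) I (fun x => (gu i x - partial i phi x) ^+ 2).
    by apply: sumr_ge0 => i _.
  exists phi; split => //.
    by rewrite N2le ?(ltW e0)//; apply: le_trans _ (ltW h); rewrite lerDl.
  move=> i; rewrite N2le ?(ltW e0)//; apply: le_trans _ (ltW h).
  apply: le_trans (_ : _ <= \sum_(i < 4) I (fun x => (gu i x - partial i phi x) ^+ 2)) _.
    by rewrite (bigD1 i)//= lerDl sumr_ge0.
  by rewrite lerDr.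
move=> [Lu Lg ap]; split.
  split; [exact/inL2P|by move=> i; exact/inL2P|exact: weak_gradient_approximable].
move=> eps eps0.
pose e := Num.sqrt (eps / 6).
have e0 : 0 < e by rewrite sqrtr_gt0 divr_gt0.
have [phi [tp h1 h2]] := ap e e0; exists phi => //.
move: h1; rewrite N2le ?(ltW e0)// sqr_sqrtr ?divr_ge0 ?(ltW eps0)// => h1.
apply: (@le_lt_trans _ _ (eps / 6 + \sum_(i < 4) eps / 6)).
  apply: lerD => //; apply: ler_sum => i _.
  by have := h2 i; rewrite N2le ?(ltW e0)// sqr_sqrtr ?divr_ge0 ?(ltW eps0).
by rewrite sumr_const card_ord -mulr_natl; lra.
Qed.

(** A limit in L2 of test functions of bounded energy lies in H10: among the test
    functions close to [u] in L2 those of almost least energy are Cauchy for the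
    energy, by the parallelogram identity. *)
Lemma H10_closure u (M : R) : L2 u ->
  (forall e, 0 < e -> exists phi, [/\ test phi, energy Om phi <= M &
     N (fun x => u x - phi x) <= e]) ->
  exists gu, H10 Om u gu.
Proof.
move=> Lu hu.
pose C e := [set energy Om phi | phi in [set phi | test phi /\ N (fun x => u x - phi x) <= e]].
have C0 e : lbound (C e) 0 by move=> _ [phi _ <-]; exact: energy_ge0.
have Cn e : 0 < e -> C e !=set0.
  by move=> /hu[phi [tp _ h]]; exists (energy Om phi); exists phi.
have Cinf e : 0 < e -> has_inf (C e) by move=> e0; split; [exact: Cn|exists 0; exact: C0].
pose DD := [set inf (C e) | e in [set e | 0 < e]].
have Dub : has_sup DD.
  split; first by exists (inf (C 1)); exists 1 => //; exact: ltr01.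
  exists M => _ [e /= e0 <-].
  have [phi [tp hM h]] := hu e e0; apply: le_trans hM.
  by apply: ge_inf; [exists 0; exact: C0|exists phi].
pose dd := sup DD.
pose eta k : R := 16^-1 ^+ k / 16.
have eta0 k : 0 < eta k by rewrite divr_gt0// exprn_gt0// invr_gt0.
have /choice[del hdel] : forall k, exists e, 0 < e /\ dd - eta k < inf (C e).
  by move=> k; have [_ [e /= e0 <-] h] := sup_adherent (eta0 k) Dub; exists e.
have /choice[r hr] : forall k, exists r, 0 < r /\ forall j, (j <= k)%N -> r <= del j.
  elim=> [|k [r [r0 hr]]].
    exists (del 0%N); split; first exact: (hdel 0%N).1.
    by move=> j; rewrite leqn0 => /eqP->.
  exists (Num.min r (del k.+1)); split; first by rewrite lt_min r0 (hdel k.+1).1.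
  move=> j; rewrite leq_eqVlt => /predU1P[->|]; first by rewrite ge_min lexx orbT.
  by rewrite ltnS => /hr h; rewrite ge_min h.
have /choice[phi hphi] : forall k, exists phi, [/\ test phi,
    N (fun x => u x - phi x) <= Num.min (r k) (2^-1 ^+ k) &
    energy Om phi < dd + eta k].
  move=> k; set e := Num.min _ _.
  have e0 : 0 < e by rewrite lt_min (hr k).1 exprn_gt0// invr_gt0.
  have [_ [phi [tp h] <-] hlt] := inf_adherent (eta0 k) (Cinf e e0).
  exists phi; split => //; apply: lt_le_trans hlt _; rewrite lerD2r.
  by apply: ub_le_sup; [exact: Dub.2|exists e].
have tp k : test (phi k) by have [] := hphi k.
have Lp k := test_L2 (tp k).
have hk k j : (j <= k)%N -> N (fun x => u x - phi k x) <= del j.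
  move=> jk; have [_ h _] := hphi k; apply: le_trans h _.
  by rewrite ge_min (hr k).2.
have Ecauchy k : energy Om (fun x => phi k.+1 x - phi k x) <= 16^-1 ^+ k.
  pose m x := 2^-1 * (phi k.+1 x + phi k x).
  have tD := testD (tp k.+1) (tp k).
  have tm : test m by exact: testZ.
  have hm : dd - eta k < energy Om m.
    apply: lt_le_trans (hdel k).2 _; apply: ge_inf; first by exists 0; exact: C0.
    exists m => //; split => //.
    have E : (fun x => u x - m x) = (fun x => 2^-1 * (u x - phi k.+1 x) + 2^-1 * (u x - phi k x)).
      by apply/funext => x; rewrite /m; field.
    rewrite E; have L1 := L2B mOm Lu (Lp k.+1); have L2' := L2B mOm Lu (Lp k).
    apply: le_trans (N2D mOm (L2Z mOm _ L1) (L2Z mOm _ L2')) _.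
    rewrite !N2Z// ger0_norm ?invr_ge0//.
    have := hk k.+1 k (leqnSn k); have := hk k k (leqnn k).
    by move: (N _) (N _) => n1 n2; lra.
  have := energyZ mOm Om_fin 2^-1 tD; rewrite -/m => Em.
  have [_ _ h1] := hphi k.+1; have [_ _ h2] := hphi k.
  have e1 : eta k.+1 <= eta k.
    rewrite /eta ler_pM2r ?invr_gt0// exprS ler_piMl ?exprn_ge0 ?invr_ge0//.
    by rewrite invf_le1// ler1n.
  have e2 : 16^-1 ^+ k = 16 * eta k by rewrite /eta; field.
  rewrite e2; have := energyB mOm Om_fin (tp k.+1) (tp k).
  move: Em hm; rewrite energyD//.
  move: (energy _ (fun x => _ - _)) (energy Om m) (energy _ _) (energy _ _) (endot _ _ _) h1 h2.
  move=> a1 a2 a3 a4 a5 h1 h2 Em hm E1.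
  by have := eta0 k; lra.
have Hi i : exists g, L2 g /\ forall k, I (fun x => (partial i (phi k) x - g x) ^+ 2) <= 8 * 4^-1 ^+ k.
  apply: L2_complete => // k; first exact: (test_L2 (test_partial i (tp k))).
  apply: le_trans (Ecauchy k).
  rewrite /energy (bigD1 i)//=.
  have -> : partial i (fun x => phi k.+1 x - phi k x) =
      (fun x => partial i (phi k.+1) x - partial i (phi k) x).
    apply: is_derive_partial => x; apply: is_deriveB; apply: smooth_is_derive.
      exact: test_smooth (tp k.+1).
    exact: test_smooth (tp k).
  by rewrite lerDl sumr_ge0// => j _; apply: Ige0 => x _; exact: sqr_ge0.
have /choice[gu hgu] := Hi.
exists gu; apply/H10P; split => //; first by move=> i; exact: (hgu i).1.
move=> e e0.
have [k hk2] : exists k, 3 * 2^-1 ^+ k <= e.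
  have q0 : (fun k => 3 * 2^-1 ^+ k : R) @ \oo --> (0 : R).
    rewrite -[X in _ --> X](mulr0 3); apply: cvgMr.
    by apply: cvg_expr; rewrite ger0_norm ?invr_ge0// invf_lt1// ltr1n.
  have [k _ hk2] : \forall k \near \oo, 3 * 2^-1 ^+ k < e by have := cvgr_lt _ q0; exact.
  by exists k; apply/ltW/hk2 => /=.
have p0 : 0 <= 2^-1 ^+ k :> R by rewrite exprn_ge0// invr_ge0.
exists (phi k); split => //.
  have [_ h _] := hphi k; apply: le_trans h _; rewrite ge_min; apply/orP; right.
  by apply: le_trans hk2; rewrite ler_peMl//; lra.
move=> i; rewrite N2C; apply: le_trans hk2.
rewrite -(@ler_pXn2r _ 2)// ?nnegrE ?N2_ge0 ?mulr_ge0// N2_sqr.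
apply: le_trans ((hgu i).2 k) _.
rewrite exprMn -exprM mulnC exprM.
have -> : 2^-1 ^+ 2 = 4^-1 :> R by field.
by rewrite ler_wpM2r ?exprn_ge0 ?invr_ge0//; lra.
Qed.

End H10.

(** * Weak solutions tested against H10 *)

Section real_lemmas.
Variable R : realType.

(** A truncation of [s ^+ 4] that is Lipschitz in [s ^+ 2], so that its integral is
    continuous in L2. *)
Definition trunc4 (k s : R) : R := Num.min (s ^+ 2) k ^+ 2.

Lemma trunc4_ge0 k s : 0 <= trunc4 k s. Proof. exact: sqr_ge0. Qed.

Lemma trunc4_le k s : 0 <= k -> trunc4 k s <= s ^+ 4.
Proof.
move=> k0; rewrite /trunc4 (exprM s 2 2); apply: lerXn2r; rewrite ?nnegrE ?sqr_ge0//.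
  by rewrite le_min sqr_ge0.
by rewrite ge_min lexx.
Qed.

Lemma trunc4_bounded k s : 0 <= k -> `|trunc4 k s| <= k ^+ 2.
Proof.
move=> k0; rewrite ger0_norm ?trunc4_ge0//; apply: lerXn2r; rewrite ?nnegrE//.
  by rewrite le_min sqr_ge0.
by rewrite ge_min lexx orbT.
Qed.

Lemma trunc4_lip k s t : 0 <= k ->
  `|trunc4 k s - trunc4 k t| <= 2 * k * `|(s - t) * (s + t)|.
Proof.
move=> k0; rewrite -subr_sqr /trunc4.
move: (s ^+ 2) (t ^+ 2) (sqr_ge0 s) (sqr_ge0 t) => a b a0 b0.
rewrite subr_sqr normrM.
have h1 : `|Num.min a k - Num.min b k| <= `|a - b|.
  rewrite ler_norml -!lerBlDr; case: (leP a k) => ak; case: (leP b k) => bk;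
   have := ler_norm (a - b); have := ler_norm (b - a); rewrite distrC => *; apply/andP; split; lra.
have h2 : `|Num.min a k + Num.min b k| <= 2 * k.
  rewrite ger0_norm ?addr_ge0 ?le_min ?a0 ?b0 ?k0//.
  by case: (leP a k) => ak; case: (leP b k) => bk; lra.
rewrite mulrC; apply: ler_pM => //.
Qed.

(** Either [q <= d * p] or [p <= q / d]. *)
Lemma young43 (p q d : R) : 0 <= p -> 0 <= q -> 0 < d ->
  p ^+ 3 * q <= d * p ^+ 4 + d ^- 3 * q ^+ 4.
Proof.
move=> p0 q0 d0.
have d3 : 0 <= d ^- 3 by rewrite invr_ge0 exprn_ge0// ltW.
have p3 := exprn_ge0 3 p0.
have [qd|dq] := leP q (d * p).
  apply: (@le_trans _ _ (d * p ^+ 4)).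
    have -> : d * p ^+ 4 = p ^+ 3 * (d * p) by ring.
    exact: ler_wpM2l.
  by rewrite lerDl mulr_ge0// exprn_ge0.
apply: (@le_trans _ _ (d ^- 3 * q ^+ 4)); last first.
  by rewrite lerDr mulr_ge0 ?exprn_ge0// ltW.
have -> : d ^- 3 * q ^+ 4 = d ^- 3 * q ^+ 3 * q by rewrite -mulrA -exprSr.
apply: ler_wpM2r => //.
rewrite -exprVn -exprMn; apply: lerXn2r; rewrite ?nnegrE//.
  by rewrite mulr_ge0// invr_ge0 ltW.
by rewrite ler_pdivlMl// ltW.
Qed.

Lemma young_cubic (p q d : R) : 0 <= p -> 0 <= q -> 0 < d ->
  (1 + p ^+ 3) * q <= d * (1 + p ^+ 4) + 2 * d ^- 3 * q ^+ 4.
Proof.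
move=> p0 q0 d0; have := young43 p0 q0 d0; have := young43 ler01 q0 d0.
rewrite !expr1n mul1r mulr1 => h1 h2; rewrite mulrDl mul1r mulrDr mulr1.
by rewrite -[2 * _ * _]mulrA mulr_natl mulr2n addrACA; apply: lerD.
Qed.

End real_lemmas.

Section weak_solution.
Variable R : realType.
Notation mR4 := (measurableTypeR R * measurableTypeR R *
    measurableTypeR R * measurableTypeR R)%type.
Variable Om : set (R4 R).
Hypotheses (mOm : @measurable _ mR4 Om) (Om_fin : (@leb4 R Om < +oo)%E).
Implicit Types (phi psi u v w f : R4 R -> R) (gu gw : 'I_4 -> R4 R -> R).
Notation I f := (\int[@leb4 R]_(x in Om) f x).
Notation N f := (N2 (@leb4 R) Om f).
Notation L2 := (L2 (@leb4 R) Om).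
Notation test := (test_function Om).
Notation intg := (intg (@leb4 R) Om).
Notation S := (sobolev_constant R).
Hypothesis S0 : 0 < S.

(** The Sobolev bound passes to L2 limits: the truncations of the fourth power are
    continuous in L2 and increase to it. *)
Lemma L4_bound v m : L2 v -> 0 <= m ->
  (forall e, 0 < e -> exists phi, [/\ test phi, energy Om phi <= m &
     N (fun x => v x - phi x) <= e]) ->
  intg (fun x => v x ^+ 4) /\ I (fun x => v x ^+ 4) <= m ^+ 2 / S ^+ 2.
Proof.
move=> Lv m0 hv.
have mT k : measurable_fun Om (fun x => trunc4 k (v x)).
  apply: measurable_funX; apply: measurable_minr => //.
  by apply: measurable_funX; exact: Lv.1.
have iT k : 0 <= k -> intg (fun x => trunc4 k (v x)).
  by move=> k0; apply: (intg_bounded mOm Om_fin (mT k)) => x; exact: trunc4_bounded.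
have key k : 0 <= k -> I (fun x => trunc4 k (v x)) <= m ^+ 2 / S ^+ 2.
  move=> k0.
  pose W := 2 * k * (2 * N v + 1).
  have W0 : 0 <= W by rewrite mulr_ge0 ?mulr_ge0// addr_ge0// mulr_ge0// N2_ge0.
  apply/ler_addgt0Pr => e e0.
  pose d := Num.min 1 (e / (W + 1)).
  have d0 : 0 < d by rewrite lt_min ltr01 divr_gt0// ltr_pwDr.
  have [phi [tp hE hN]] := hv d d0.
  have Lp := L2_test mOm Om_fin tp.
  have iTp : intg (fun x => trunc4 k (phi x)).
    apply: (@intg_bounded _ _ mOm Om_fin _ (k ^+ 2)) => [|x]; last exact: trunc4_bounded.
    apply: measurable_funX; apply: measurable_minr => //.
    by apply: measurable_funX; exact: Lp.1.
  have h1 : I (fun x => trunc4 k (phi x)) <= m ^+ 2 / S ^+ 2.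
    apply: (@le_trans _ _ (I (fun x => phi x ^+ 4))).
      apply: (Ile mOm) => //; first exact: (intg_testX mOm Om_fin 4 tp).
      by move=> x _; exact: trunc4_le.
    apply: le_trans (sobolev_L4 mOm Om_fin S0 tp) _.
    rewrite ler_pM2r ?invr_gt0 ?exprn_gt0//.
    by apply: lerXn2r; rewrite ?nnegrE// energy_ge0.
  have LB := L2B mOm Lv Lp; have LD := L2D mOm Lv Lp.
  have h2 : I (fun x => trunc4 k (v x)) - I (fun x => trunc4 k (phi x)) <= W * d.
    rewrite -IB ?iT//.
    apply: (@le_trans _ _ (I (fun x => 2 * k * `|(v x - phi x) * (v x + phi x)|))).
      apply: (Ile mOm).
      - by apply: (intgB mOm) => //; exact: iT.
      - by apply: (intgZ mOm); exact: (intg_norm (L2_mul mOm LB LD)).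
      - by move=> x _; apply: le_trans (ler_norm _) _; exact: trunc4_lip.
    rewrite (IZ mOm); last exact: (intg_norm (L2_mul mOm LB LD)).
    rewrite /W -!mulrA ler_wpM2l// ler_wpM2l//.
    apply: le_trans (I_CS_norm mOm LB LD) _.
    rewrite mulrC; apply: ler_pM; rewrite ?N2_ge0//.
    have E : (fun x => v x + phi x) = (fun x => 2 * v x + (-1) * (v x - phi x)).
      by apply/funext => x; ring.
    rewrite E; apply: le_trans (N2D mOm (L2Z mOm _ Lv) (L2Z mOm _ LB)) _.
    rewrite !N2Z// normrN1 mul1r ger0_norm// lerD2l.
    by apply: le_trans hN _; rewrite /d ge_min lexx.
  have h3 : W * d <= e.
    apply: (@le_trans _ _ ((W + 1) * d)); first by rewrite ler_wpM2r ?(ltW d0)// lerDl.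
    rewrite mulrC -ler_pdivlMr; last by rewrite ltr_pwDr.
    by rewrite /d ge_min lexx orbT.
  by move: h1 h2 h3; move: (Rintegral _ _ _) (Rintegral _ _ _) (W * d) (m ^+ 2 / S ^+ 2) => x1 x2 x3 x4; lra.
apply: (intg_ge0_bound mOm).
- by apply: measurable_funX; exact: Lv.1.
- by move=> x _; rewrite (exprM _ 2 2) sqr_ge0.
have mono x : {homo (fun n => (trunc4 n%:R (v x))%:E) : n p / (n <= p)%N >-> (n <= p)%E}.
  move=> n p np; rewrite lee_fin /trunc4; apply: lerXn2r; rewrite ?nnegrE ?le_min ?sqr_ge0 ?ler0n//.
  by rewrite !ge_min lexx /= ler_nat np orbT.
have E : (\int[@leb4 R]_(x in Om) (v x ^+ 4)%:E =
   \int[@leb4 R]_(x in Om) limn (fun n => (trunc4 n%:R (v x))%:E))%E.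
  apply: eq_integral => x _; apply/esym/cvg_lim => //.
  apply: cvg_near_cst.
  near=> n; congr EFin; rewrite /trunc4 min_l -?exprM//.
  near: n; exists (Num.Def.truncn (v x ^+ 2)).+1 => // n /= hn.
  apply: le_trans (ltW (truncnS_gt _)) _; by rewrite ler_nat.
have mT' n : measurable_fun Om (fun x => (trunc4 n%:R (v x))%:E).
  exact/measurable_EFinP.
have T0' n x : Om x -> (0 <= (trunc4 n%:R (v x))%:E)%E.
  by rewrite lee_fin trunc4_ge0.
rewrite E (monotone_convergence _ mOm mT' T0' (fun x _ => mono x)).
apply: lime_le.
  apply: ereal_nondecreasing_is_cvgn => n p np; apply: ge0_le_integral => //;
    first [exact: T0' | exact: mT' | by move=> x Ox; exact: mono].
apply: nearW => n; rewrite -(I_EFin mOm); last by apply: iT; rewrite ler0n.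
by rewrite lee_fin key// ler0n.
Unshelve. all: end_near. Qed.

Lemma energyB_small phi psi gw e : test phi -> test psi -> (forall i, L2 (gw i)) -> 0 < e ->
  (forall i, N (fun x => gw i x - partial i phi x) <= e) ->
  (forall i, N (fun x => gw i x - partial i psi x) <= e) ->
  energy Om (fun x => phi x - psi x) <= 16 * e ^+ 2.
Proof.
move=> tp ts Lg e0 h1 h2.
have -> : 16 * e ^+ 2 = \sum_(i < 4) (2 * e) ^+ 2.
  by rewrite sumr_const card_ord -mulr_natl; ring.
apply: ler_sum => i _.
have -> : partial i (fun x => phi x - psi x) = (fun x => partial i phi x - partial i psi x).
  apply: is_derive_partial => x; apply: is_deriveB; apply: smooth_is_derive.
    exact: test_smooth tp.
  exact: test_smooth ts.
rewrite -N2_sqr; apply: lerXn2r; rewrite ?nnegrE ?N2_ge0 ?mulr_ge0 ?(ltW e0)//.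
have L1 := L2_test mOm Om_fin (test_partial i tp).
have L2' := L2_test mOm Om_fin (test_partial i ts).
apply: le_trans (N2B mOm L1 (Lg i) L2') _.
by rewrite N2C; have := h1 i; have := h2 i; move: (N _) (N _) => a b; lra.
Qed.

(** Approximating test functions are close to each other in energy, so all of them have
    energy comparable to that of a single one. *)
Lemma H10_bounded_energy w gw : H10 Om w gw -> exists m, 0 <= m /\
  forall e, 0 < e -> exists phi, [/\ test phi, energy Om phi <= m &
     N (fun x => w x - phi x) <= e].
Proof.
move=> /(H10P mOm Om_fin)[Lw Lg ap].
have [phi1 [tp1 _ h1]] := ap 1 ltr01.
exists (2 * (16 + energy Om phi1)); split.
  by have := energy_ge0 Om phi1; lra.
move=> e e0; have d0 : 0 < Num.min e 1 by rewrite lt_min e0 ltr01.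
have [phi [tp h2 h3]] := ap _ d0; exists phi; split => //; last first.
  by apply: le_trans h2 _; rewrite ge_min lexx.
have h3' i : N (fun x => gw i x - partial i phi x) <= 1.
  by apply: le_trans (h3 i) _; rewrite ge_min lexx orbT.
have := energyB_small tp tp1 Lg ltr01 h3' h1; rewrite expr1n mulr1 => hB.
have tB := testB tp tp1.
have := energyB_le mOm Om_fin tB (testZ (-1) tp1).
rewrite energyZ// sqrrN expr1n mul1r.
have -> : (fun x => phi x - phi1 x - -1 * phi1 x) = phi by apply/funext => x; ring.
by move: hB; move: (energy _ _) (energy _ _) (energy _ _) => a b c; lra.
Qed.

(** An equation holding against test functions extends to H10: the right-hand side
    has at most cubic growth in [u], and [u] and the test objects lie in L4. *)
Lemma distributional_weak_solution u (h : R4 R -> R) (M C : R) : L2 u -> measurable_fun Om h ->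
  0 <= C -> (forall x, Om x -> `|h x| <= C * (1 + `|u x| ^+ 3)) ->
  (forall e, 0 < e -> exists phi, [/\ test phi, energy Om phi <= M &
     N (fun x => u x - phi x) <= e]) ->
  (forall psi, test psi ->
     - I (fun x => u x * \sum_(i < 4) partial i (partial i psi) x) =
     I (fun x => h x * psi x)) ->
  dirichlet_weak_solution Om u h.
Proof.
move=> Lu mh C0 hC hu heq.
have [gu Hu] := H10_closure mOm Om_fin Lu hu.
have [_ Lg _] := (H10P mOm Om_fin u gu).1 Hu.
have [[_ _ wu] _] := Hu.
have M0 : 0 <= M.
  have [phi [_ h1 _]] := hu 1 ltr01; exact: le_trans (energy_ge0 _ _) h1.
have [iu4 _] := L4_bound Lu M0 hu.
pose U4 := I (fun x => u x ^+ 4).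
have U40 : 0 <= U4 by apply: Ige0 => x _; rewrite (exprM _ 2 2) sqr_ge0.
have V0 : 0 <= vol Om by exact: fine_ge0.
have abs4 (a : R) : `|a| ^+ 4 = a ^+ 4.
  by rewrite -normrX ger0_norm// (exprM _ 2 2) sqr_ge0.
(* Young's inequality splits the cubic growth in u from w; its parameter d is kept free
   for the final limit. *)
have pair w d : L2 w -> intg (fun x => w x ^+ 4) -> 0 < d ->
    intg (fun x => h x * w x) /\
    `|I (fun x => h x * w x)| <= C * (d * (vol Om + U4) + 2 * d ^- 3 * I (fun x => w x ^+ 4)).
  move=> Lw iw4 d0.
  have ig : intg (fun x => C * (d * (1 + u x ^+ 4) + 2 * d ^- 3 * w x ^+ 4)).
    apply: (intgZ mOm); apply: (intgD mOm); apply: (intgZ mOm) => //.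
    by apply: (intgD mOm) => //; exact: intg_cst.
  have hb x : Om x -> `|h x * w x| <= C * (d * (1 + u x ^+ 4) + 2 * d ^- 3 * w x ^+ 4).
    move=> Ox; rewrite normrM; apply: le_trans (ler_wpM2r (normr_ge0 _) (hC x Ox)) _.
    rewrite -[leLHS]mulrA -(abs4 (u x)) -(abs4 (w x)); apply: ler_wpM2l => //.
    exact: young_cubic.
  have ihw : intg (fun x => h x * w x).
    apply: (intg_le mOm _ ig hb); apply: measurable_funM => //; exact: Lw.1.
  split => //; apply: le_trans (Inorm mOm ihw) _.
  apply: le_trans (Ile mOm (intg_norm ihw) ig hb) _.
  have i1 : intg (fun=> 1) by exact: intg_cst.
  have i2 := intgD mOm i1 iu4.
  rewrite (IZ mOm); last by apply: (intgD mOm); apply: (intgZ mOm).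
  rewrite (ID mOm); [|exact: (intgZ mOm)..].
  rewrite !(IZ mOm)// (ID mOm)//.
  by rewrite (Rintegral_cst _ mOm) mul1r.
have test_eq psi : test psi -> \sum_(i < 4) I (fun x => gu i x * partial i psi x) =
    I (fun x => h x * psi x).
  move=> ts; rewrite -heq//.
  have -> : (fun x => u x * \sum_(i < 4) partial i (partial i psi) x) =
      (fun x => \sum_(i < 4) u x * partial i (partial i psi) x).
    by apply/funext => x; rewrite mulr_sumr.
  rewrite (Isum mOm); last first.
    move=> i; apply: (L2_mul mOm) => //.
    exact: (L2_test mOm Om_fin (test_partial i (test_partial i ts))).
  rewrite -sumrN; apply: eq_bigr => i _.
  by rewrite (wu i (partial i psi) (test_partial i ts)) opprK.
exists gu => // w gw Hw.
have [Lw Lgw ap] := (H10P mOm Om_fin w gw).1 Hw.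
have [mw [mw0 hw]] := H10_bounded_energy Hw.
have [iw4 _] := L4_bound Lw mw0 hw.
have [ihw _] := pair w 1 Lw iw4 ltr01.
split=> //.
have -> : I (fun x => \sum_(i < 4) gu i x * gw i x) = \sum_(i < 4) I (fun x => gu i x * gw i x).
  by rewrite (Isum mOm)// => i; exact: (L2_mul mOm).
apply/eqP; rewrite -subr_eq0; apply/eqP.
pose K := \sum_(i < 4) N (gu i).
have K0 : 0 <= K by apply: sumr_ge0 => i _; exact: N2_ge0.
have S2 : 0 <= S ^- 2 by rewrite invr_ge0 sqr_ge0.
have W0 : 0 <= vol Om + U4 + 2 * (256 * S ^- 2).
  exact: (addr_ge0 (addr_ge0 V0 U40) (mulr_ge0 (ler0n _ 2) (mulr_ge0 (ler0n _ 256) S2))).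
apply: (@eq0_small _ _ (K + C * (vol Om + U4 + 2 * (256 * S ^- 2)))).
  exact: (addr_ge0 K0 (mulr_ge0 C0 W0)).
move=> e e0.
have [psi [ts h1 h2]] := ap e e0.
have Lp := L2_test mOm Om_fin ts.
have Lpd i := L2_test mOm Om_fin (test_partial i ts).
have LB := L2B mOm Lw Lp.
have [iB4 hB4] : intg (fun x => (w x - psi x) ^+ 4) /\
    I (fun x => (w x - psi x) ^+ 4) <= (16 * e ^+ 2) ^+ 2 / S ^+ 2.
  apply: L4_bound => //; first by rewrite mulr_ge0// exprn_ge0// ltW.
  move=> d d0; have md0 : 0 < Num.min d e by rewrite lt_min d0 e0.
  have [chi [tc k1 k2]] := ap _ md0.
  exists (fun x => chi x - psi x); split; first exact: (testB tc ts).
    apply: (energyB_small tc ts Lgw e0 _ h2) => i.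
    by apply: le_trans (k2 i) _; rewrite ge_min lexx orbT.
  have -> : (fun x => w x - psi x - (chi x - psi x)) = (fun x => w x - chi x).
    by apply/funext => x; ring.
  by apply: le_trans k1 _; rewrite ge_min lexx.
(* With d := e the fourth powers, of order e ^+ 4, absorb the factor e ^- 3. *)
have [ihB hB] := pair _ e LB iB4 e0.
have [ihp _] := pair psi 1 Lp (intg_testX mOm Om_fin 4 ts) ltr01.
have -> : \sum_(i < 4) I (fun x => gu i x * gw i x) - I (fun x => h x * w x) =
   \sum_(i < 4) I (fun x => gu i x * (gw i x - partial i psi x)) -
   I (fun x => h x * (w x - psi x)).
  have -> : I (fun x => h x * (w x - psi x)) = I (fun x => h x * w x) - I (fun x => h x * psi x).
    by rewrite -(IB mOm ihw ihp); apply: Ieq => x _; rewrite mulrBr.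
  have -> : \sum_(i < 4) I (fun x => gu i x * (gw i x - partial i psi x)) =
     \sum_(i < 4) I (fun x => gu i x * gw i x) - \sum_(i < 4) I (fun x => gu i x * partial i psi x).
    rewrite -sumrB; apply: eq_bigr => i _.
    rewrite -(IB mOm (L2_mul mOm (Lg i) (Lgw i)) (L2_mul mOm (Lg i) (Lpd i))).
    by apply: Ieq => x _; rewrite mulrBr.
  by rewrite (test_eq psi ts) opprB addrA subrK.
apply: le_trans (ler_normB _ _) _; rewrite mulrDl; apply: lerD.
  apply: le_trans (ler_norm_sum _ _ _) _; rewrite mulr_suml; apply: ler_sum => i _.
  apply: le_trans (I_CS_N2 mOm (Lg i) (L2B mOm (Lgw i) (Lpd i))) _.
  by rewrite ler_wpM2l// N2_ge0.
apply: le_trans hB _; rewrite -[leRHS]mulrA; apply: ler_wpM2l => //.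
have e3 : 0 <= 2 * e ^- 3 by rewrite mulr_ge0// invr_ge0 exprn_ge0// ltW.
apply: le_trans (lerD (lexx _) (ler_wpM2l e3 hB4)) _.
have en0 : e != 0 by rewrite gt_eqF.
rewrite le_eqVlt; apply/orP; left; apply/eqP.
by move: (vol Om) (U4) (S ^- 2) => a c s; field.
Qed.

End weak_solution.

(** * Critical nonlinearities *)

Section nonlinearity.
Variables (R : realType) (m K : R) (H h : R -> R).
Hypotheses (m0 : 0 <= m) (K0 : 0 <= K).
Hypothesis HL : forall x y, `|H x - H y| <= K * `|x - y| * (1 + x ^+ 2 + y ^+ 2).
Hypothesis Hd : forall x : R, is_derive x 1 H (h x).
Hypothesis hb : forall x, `|h x| <= K * (1 + x ^+ 2).

(** [H] is a perturbation of the critical power [m / 4 * s ^+ 4] with a derivative of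
    quadratic growth. *)
Definition prim (s : R) : R := m / 4 * s ^+ 4 + H s.
Definition nonl (s : R) : R := m * s ^+ 3 + h s.

Lemma pow_le4 (a : R) : [/\ `|a| <= 1 + a ^+ 4, a ^+ 2 <= 1 + a ^+ 4 & `|a| ^+ 3 <= 1 + a ^+ 4].
Proof.
have -> : a ^+ 4 = `|a| ^+ 4 by rewrite -normrX ger0_norm// (exprM _ 2 2) sqr_ge0.
have -> : a ^+ 2 = `|a| ^+ 2 by rewrite real_normK ?num_real.
move: (normr_ge0 a); move: `|a| => p p0.
have h1 := sqr_ge0 (p - 1); have h2 := sqr_ge0 (p ^+ 2 - 1).
have h3 := sqr_ge0 (p ^+ 2 - p).
have e4 : p ^+ 4 = (p ^+ 2) ^+ 2 by rewrite -exprM.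
have e3 : p ^+ 3 = p ^+ 2 * p by rewrite -exprSr.
by split; nra.
Qed.

Lemma prim_shift_bound (a k B : R) : 0 <= B -> `|k| <= B ->
  `|prim (a + k) - prim a| <=
  `|k| * ((m / 4 * (4 + 6 * B + 4 * B ^+ 2 + B ^+ 3) + K * (4 + 2 * B ^+ 2)) * (1 + a ^+ 4)).
Proof.
move=> B0 kB; rewrite /prim.
have -> : m / 4 * (a + k) ^+ 4 + H (a + k) - (m / 4 * a ^+ 4 + H a) =
  m / 4 * (k * (4 * a ^+ 3 + 6 * a ^+ 2 * k + 4 * a * k ^+ 2 + k ^+ 3)) + (H (a + k) - H a).
  by ring.
have [p1 p2 p3] := pow_le4 a.
have k2 : `|k| ^+ 2 <= B ^+ 2 by apply: lerXn2r; rewrite ?nnegrE.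
have k3 : `|k| ^+ 3 <= B ^+ 3 by apply: lerXn2r; rewrite ?nnegrE.
have B2 := exprn_ge0 2 B0; have B3 := exprn_ge0 3 B0.
have a40 : 0 <= a ^+ 4 by rewrite (exprM _ 2 2) sqr_ge0.
rewrite [X in _ <= _ * X]mulrDl [leRHS]mulrDr.
apply: le_trans (ler_normD _ _) _; apply: lerD.
  rewrite normrM (ger0_norm (_ : 0 <= m / 4)) ?divr_ge0// normrM mulrCA; apply: ler_wpM2l => //.
  rewrite -[leRHS]mulrA; apply: ler_wpM2l; first by rewrite divr_ge0.
  apply: le_trans (ler_normD _ _) _; apply: le_trans (lerD (ler_normD _ _) (lexx _)) _.
  apply: le_trans (lerD (lerD (ler_normD _ _) (lexx _)) (lexx _)) _.
  rewrite !(normrX, normrM) !(ger0_norm (ler0n _ _)).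
  have q1 : `|a| ^+ 2 * `|k| <= (1 + a ^+ 4) * B.
    by apply: ler_pM => //; rewrite ?exprn_ge0// real_normK ?num_real.
  have q2 : `|a| * `|k| ^+ 2 <= (1 + a ^+ 4) * B ^+ 2 by apply: ler_pM => //; exact: exprn_ge0.
  have q3 : 0 <= a ^+ 4 * B ^+ 3 by exact: mulr_ge0.
  by lra.
apply: le_trans (HL _ _) _; rewrite addrAC subrr add0r [K * _]mulrC -!mulrA.
apply: ler_wpM2l => //; apply: ler_wpM2l => //.
have kk : k ^+ 2 <= B ^+ 2 by rewrite -real_normK ?num_real.
have := sqr_ge0 (a - k); have := mulr_ge0 a40 B2; nra.
Qed.

(** The increment of [prim] by a bounded quantity loses one degree: as a function of the
    base point it is Lipschitz with a quadratic weight. It is therefore continuous for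
    L2 convergence of functions bounded in L4, although [prim] itself is not. *)
Lemma prim_shift_lip (a b k B : R) : 0 <= B -> `|k| <= B ->
  `|(prim (a + k) - prim a) - (prim (b + k) - prim b)| <=
  (m / 4 * (6 * B + 6 * B ^+ 2 + 4 * B ^+ 3) + K * (3 + 4 * B ^+ 2)) *
    (`|a - b| * (1 + a ^+ 2 + b ^+ 2)).
Proof.
move=> B0 kB; rewrite /prim.
have -> : m / 4 * (a + k) ^+ 4 + H (a + k) - (m / 4 * a ^+ 4 + H a) -
   (m / 4 * (b + k) ^+ 4 + H (b + k) - (m / 4 * b ^+ 4 + H b)) =
  m / 4 * ((a - b) * (4 * k * (a ^+ 2 + a * b + b ^+ 2) + 6 * k ^+ 2 * (a + b) + 4 * k ^+ 3)) +
  ((H (a + k) - H (b + k)) - (H a - H b)) by ring.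
have k2 : `|k| ^+ 2 <= B ^+ 2 by apply: lerXn2r; rewrite ?nnegrE.
have k3 : `|k| ^+ 3 <= B ^+ 3 by apply: lerXn2r; rewrite ?nnegrE.
have B2 := exprn_ge0 2 B0; have B3 := exprn_ge0 3 B0.
have a2 := sqr_ge0 a; have b2 := sqr_ge0 b.
have ab1 := sqr_ge0 (a - b); have ab2 := sqr_ge0 (a + b).
rewrite [leRHS]mulrDl; apply: le_trans (ler_normD _ _) _; apply: lerD.
  rewrite normrM (ger0_norm (_ : 0 <= m / 4)) ?divr_ge0// normrM -[leRHS]mulrA.
  apply: ler_wpM2l; first by rewrite divr_ge0.
  rewrite [leRHS]mulrCA; apply: ler_wpM2l => //.
  apply: le_trans (ler_normD _ _) _; apply: le_trans (lerD (ler_normD _ _) (lexx _)) _.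
  rewrite !(normrX, normrM) !(ger0_norm (ler0n _ _)).
  have n1 : `|a ^+ 2 + a * b + b ^+ 2| <= 3 / 2 * (1 + a ^+ 2 + b ^+ 2).
    by rewrite ler_norml; apply/andP; split; nra.
  have n2 : `|a + b| <= 1 + a ^+ 2 + b ^+ 2.
    have s1 := sqr_ge0 (a + 1); have s2 := sqr_ge0 (a - 1).
    have s3 := sqr_ge0 (b + 1); have s4 := sqr_ge0 (b - 1).
    by rewrite ler_norml; apply/andP; split; nra.
  have q1 := ler_pM (normr_ge0 k) (normr_ge0 _) kB n1.
  have q2 := ler_pM (exprn_ge0 2 (normr_ge0 k)) (normr_ge0 _) k2 n2.
  have q3 : 0 <= (a ^+ 2 + b ^+ 2) * B ^+ 3 by apply: mulr_ge0 => //; exact: addr_ge0.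
  by lra.
apply: le_trans (ler_normB _ _) _; apply: le_trans (lerD (HL _ _) (HL _ _)) _.
have -> : a + k - (b + k) = a - b by ring.
rewrite -!mulrA -mulrDr; apply: ler_wpM2l => //.
rewrite -mulrDr [leRHS]mulrCA; apply: ler_wpM2l => //.
have kk : k ^+ 2 <= B ^+ 2 by rewrite -real_normK ?num_real.
have s1 := sqr_ge0 (a - k); have s2 := sqr_ge0 (b - k).
have := mulr_ge0 a2 B2; have := mulr_ge0 b2 B2; nra.
Qed.

Lemma prim_derive (x : R) : is_derive x 1 prim (nonl x).
Proof.
have h4 := is_deriveX 4 (is_derive_id x (1 : R)).
have h5 := is_deriveZ (m / 4) h4.
apply: is_derive_eq (is_deriveD h5 (Hd x)) _.
by rewrite /nonl /GRing.scale /=; field.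
Qed.

Lemma nonl_bound x : `|nonl x| <= (m + 2 * K) * (1 + `|x| ^+ 3).
Proof.
rewrite /nonl; apply: le_trans (ler_normD _ _) _.
rewrite normrM normrX (ger0_norm m0).
have := hb x; have -> : x ^+ 2 = `|x| ^+ 2 by rewrite real_normK ?num_real.
move: (normr_ge0 x); move: `|x| => p p0 hh.
have e : p ^+ 2 <= 1 + p ^+ 3.
  have -> : p ^+ 3 = p ^+ 2 * p by rewrite -exprSr.
  have := sqr_ge0 (p - 1); have := sqr_ge0 p; nra.
have p3 := exprn_ge0 3 p0.
have h2 : K * (1 + p ^+ 2) <= K * (2 * (1 + p ^+ 3)) by apply: ler_wpM2l => //; lra.
have E : (m + 2 * K) * (1 + p ^+ 3) = m + m * p ^+ 3 + K * (2 * (1 + p ^+ 3)) by ring.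
by rewrite E; move: m0 hh h2; move: (K * _) (K * _) (m * _) => x1 x2 x3; lra.
Qed.

Lemma continuous_prim : continuous prim.
Proof.
move=> x; apply: differentiable_continuous; apply/derivable1_diffP.
by have [] := prim_derive x.
Qed.

End nonlinearity.

(** * The Euler-Lagrange equation of a limit *)

Lemma opposite_inequalities (R : realDomainType) (a b a' b' : R) :
  0 <= - a - b -> 0 <= - a' - b' -> a' = - a -> b' = - b -> - a = b.
Proof.
move=> h1 h2 e1 e2; rewrite e1 e2 in h2.
by apply/eqP; rewrite eq_le; apply/andP; split; lra.
Qed.

Section variational_limit.
Variable R : realType.
Notation mR4 := (measurableTypeR R * measurableTypeR R *
    measurableTypeR R * measurableTypeR R)%type.
Variable Om : set (R4 R).
Hypotheses (mOm : @measurable _ mR4 Om) (Om_fin : (@leb4 R Om < +oo)%E).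
Implicit Types (phi psi u v w f : R4 R -> R).
Notation I f := (\int[@leb4 R]_(x in Om) f x).
Notation N f := (N2 (@leb4 R) Om f).
Notation L2 := (L2 (@leb4 R) Om).
Notation test := (test_function Om).
Notation intg := (intg (@leb4 R) Om).
Notation S := (sobolev_constant R).
Hypothesis S0 : 0 < S.

Variables (m K : R) (H h : R -> R).
Hypotheses (m0 : 0 <= m) (K0 : 0 <= K).
Hypothesis HL : forall x y, `|H x - H y| <= K * `|x - y| * (1 + x ^+ 2 + y ^+ 2).
Hypothesis Hd : forall x : R, is_derive x 1 H (h x).
Hypothesis hb : forall x, `|h x| <= K * (1 + x ^+ 2).
Hypothesis mh : measurable_fun setT h.
Notation F := (prim m H).
Notation f := (nonl m h).

(** The functional whose critical points solve the equation with right-hand side [f]. It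
    is only evaluated at test functions. *)
Definition action phi := energy Om phi / 2 - I (fun x => F (phi x)).

Lemma measurable_prim u : measurable_fun Om u -> measurable_fun Om (fun x => F (u x)).
Proof.
move=> mu; apply: (@measurableT_comp _ _ _ _ _ _ F) => //.
apply: continuous_measurable_fun; exact: continuous_prim Hd.
Qed.

Lemma measurable_nonl u : measurable_fun Om u -> measurable_fun Om (fun x => f (u x)).
Proof.
move=> mu; apply: measurable_funD.
  by apply: measurable_funM => //; exact: measurable_funX.
exact: measurableT_comp.
Qed.

Lemma intg_prim_test phi : test phi -> intg (fun x => F (phi x)).
Proof.
move=> tp; have [B [B0 hB]] := test_bounded tp.
have tm := mf_smooth (Om := Om) (test_smooth tp).
have iF0 : intg (fun=> F 0) by exact: intg_cst.
have h0 : intg (fun x => F (0 + phi x) - F 0).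
  apply: (@intg_bounded _ _ mOm Om_fin _ (B * ((m / 4 * (4 + 6 * B + 4 * B ^+ 2 + B ^+ 3) + K * (4 + 2 * B ^+ 2)) * (1 + 0 ^+ 4)))).
    apply: measurable_funB => //; apply: measurable_prim.
    by under eq_fun do rewrite add0r.
  move=> x; apply: le_trans (prim_shift_bound m0 K0 HL 0 (ltW B0) (hB x)) _.
  apply: ler_wpM2r => //.
  have B2 := exprn_ge0 2 (ltW B0); have B3 := exprn_ge0 3 (ltW B0).
  rewrite expr0n addr0 mulr1 addr_ge0// mulr_ge0 ?divr_ge0 ?addr_ge0 ?mulr_ge0 ?(ltW B0)//.
apply: (intg_eq mOm _ (intgD mOm h0 iF0)) => x _.
by rewrite add0r subrK.
Qed.

Lemma intg_prim_shift u psi : L2 u -> intg (fun x => u x ^+ 4) -> test psi ->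
  intg (fun x => F (u x + psi x) - F (u x)).
Proof.
move=> Lu iu4 ts; have [B [B0 hB]] := test_bounded ts.
pose D := m / 4 * (4 + 6 * B + 4 * B ^+ 2 + B ^+ 3) + K * (4 + 2 * B ^+ 2).
have i1 : intg (fun=> 1) by exact: intg_cst.
apply: (intg_le mOm _ (intgZ mOm (B * D) (intgD mOm i1 iu4))).
  have tm := mf_smooth (Om := Om) (test_smooth ts).
  apply: measurable_funB; apply: measurable_prim; last exact: Lu.1.
  by apply: measurable_funD => //; exact: Lu.1.
move=> x _; apply: le_trans (prim_shift_bound m0 K0 HL (u x) (ltW B0) (hB x)) _.
rewrite -/D -[leRHS]mulrA; apply: ler_wpM2r => //.
have B2 := exprn_ge0 2 (ltW B0); have B3 := exprn_ge0 3 (ltW B0).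
have D0 : 0 <= D by rewrite /D addr_ge0// mulr_ge0 ?divr_ge0 ?addr_ge0 ?mulr_ge0 ?(ltW B0).
by apply: mulr_ge0 => //; rewrite addr_ge0// (exprM _ 2 2) sqr_ge0.
Qed.

(** Both derivatives are moved to [psi], so that the left-hand side passes to L2 limits
    in [phi]. *)
Lemma endot_laplacian phi psi : test phi -> test psi ->
  endot Om phi psi = - I (fun x => phi x * \sum_(i < 4) partial i (partial i psi) x).
Proof.
move=> tp ts; rewrite /endot.
have -> : (fun x => phi x * \sum_(i < 4) partial i (partial i psi) x) =
    (fun x => \sum_(i < 4) phi x * partial i (partial i psi) x).
  by apply/funext => x; rewrite mulr_sumr.
rewrite (Isum mOm); last first.
  move=> i; apply: (L2_mul mOm (L2_test mOm Om_fin tp)).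
  exact: (L2_test mOm Om_fin (test_partial i (test_partial i ts))).
rewrite -sumrN; apply: eq_bigr => i _.
have := @weak_gradient_test _ Om _ (test_smooth tp) i _ (test_partial i ts).
by move=> ->; rewrite opprK.
Qed.

Lemma L2_sqr v : L2 v -> intg (fun x => v x ^+ 4) -> L2 (fun x => v x ^+ 2).
Proof.
move=> Lv i4; split; first by apply: measurable_funX; exact: Lv.1.
by apply: (intg_eq mOm _ i4) => x _; rewrite -exprM.
Qed.

(** By [prim_shift_lip] the critical growth does no harm here: only increments in the
    direction of a bounded function have to converge. *)
Lemma prim_shift_close u M psi : L2 u -> intg (fun x => u x ^+ 4) -> test psi -> 0 <= M ->
  exists C, 0 <= C /\ forall phi e, test phi -> energy Om phi <= M ->
    N (fun x => u x - phi x) <= e ->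
    forall t, 0 <= t <= 1 ->
    `|I (fun x => F (phi x + t * psi x) - F (phi x)) -
      I (fun x => F (u x + t * psi x) - F (u x))| <= C * e.
Proof.
move=> Lu iu4 ts M0; have [B [B0 hB]] := test_bounded ts.
pose D := m / 4 * (6 * B + 6 * B ^+ 2 + 4 * B ^+ 3) + K * (3 + 4 * B ^+ 2).
have B00 := ltW B0.
have D0 : 0 <= D.
  have B2 := exprn_ge0 2 B00; have B3 := exprn_ge0 3 B00.
  by rewrite /D addr_ge0// mulr_ge0 ?divr_ge0 ?addr_ge0 ?mulr_ge0.
have L1 : L2 (fun=> 1) by apply: (@L2_bounded _ _ mOm Om_fin _ 1) => // x; rewrite normr1.
have Lu2 := L2_sqr Lu iu4.
pose W := N (fun=> 1) + M / S + N (fun x => u x ^+ 2).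
have S00 : 0 <= M / S by exact: divr_ge0 M0 (ltW S0).
have W0 : 0 <= W by exact: addr_ge0 (addr_ge0 (N2_ge0 _ _ _) S00) (N2_ge0 _ _ _).
exists (D * W); split; first exact: mulr_ge0.
move=> phi e tp hE hN t /andP[t0 t1].
have Lp := L2_test mOm Om_fin tp.
have tt := testZ t ts.
have ip4 := intg_testX mOm Om_fin 4 tp.
have Lp2 := L2_sqr Lp ip4.
have i1 := intg_prim_shift Lp ip4 tt; have i2 := intg_prim_shift Lu iu4 tt.
rewrite -(IB mOm i1 i2); apply: le_trans (Inorm mOm (intgB mOm i1 i2)) _.
pose g x := 1 + phi x ^+ 2 + u x ^+ 2.
have Lg : L2 g by exact: (L2D mOm (L2D mOm L1 Lp2) Lu2).
have LB := L2B mOm Lp Lu.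
have ig := intg_norm (L2_mul mOm LB Lg).
apply: (@le_trans _ _ (I (fun x => D * `|(phi x - u x) * g x|))).
  apply: (Ile mOm (intg_norm (intgB mOm i1 i2)) (intgZ mOm D ig)) => x _.
  have kB : `|t * psi x| <= B.
    rewrite normrM ger0_norm//; apply: le_trans (hB x).
    by rewrite ler_piMl.
  apply: le_trans (prim_shift_lip m0 K0 HL (phi x) (u x) B00 kB) _.
  rewrite -/D; apply: ler_wpM2l => //; rewrite normrM.
  by rewrite (ger0_norm (_ : 0 <= g x))// /g addr_ge0 ?sqr_ge0// addr_ge0 ?sqr_ge0.
rewrite (IZ mOm) // -mulrA; apply: ler_wpM2l => //.
apply: le_trans (I_CS_norm mOm LB Lg) _; rewrite mulrC.
apply: ler_pM; rewrite ?N2_ge0//; last by rewrite N2C.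
apply: le_trans (N2D mOm (L2D mOm L1 Lp2) Lu2) _; rewrite /W lerD2r.
apply: le_trans (N2D mOm L1 Lp2) _; rewrite lerD2l.
rewrite -(@ler_pXn2r _ 2)// ?nnegrE ?N2_ge0// N2_sqr.
have -> : I (fun x => (phi x ^+ 2) ^+ 2) = I (fun x => phi x ^+ 4).
  by apply: Ieq => x _; rewrite -exprM.
apply: le_trans (sobolev_L4 mOm Om_fin S0 tp) _.
rewrite exprMn exprVn; apply: ler_wpM2r; first by rewrite invr_ge0 sqr_ge0.
by apply: lerXn2r; rewrite ?nnegrE// energy_ge0.
Qed.

(** Dominated convergence: by [prim_shift_bound] the quotients are at most a multiple of
    [1 + u ^+ 4]. *)
Lemma prim_quotient_cvg u psi (d : R) : L2 u -> intg (fun x => u x ^+ 4) -> test psi ->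
  0 < d -> d <= 1 ->
  (fun n => I (fun x => (F (u x + (d / n.+1%:R) * psi x) - F (u x)) / (d / n.+1%:R))) @ \oo -->
  I (fun x => f (u x) * psi x).
Proof.
move=> Lu iu4 ts d0 d1; have [B [B0 hB]] := test_bounded ts.
pose D := m / 4 * (4 + 6 * B + 4 * B ^+ 2 + B ^+ 3) + K * (4 + 2 * B ^+ 2).
have B00 := ltW B0.
have D0 : 0 <= D.
  have B2 := exprn_ge0 2 B00; have B3 := exprn_ge0 3 B00.
  by rewrite /D addr_ge0// mulr_ge0 ?divr_ge0 ?addr_ge0 ?mulr_ge0.
pose t n := d / n.+1%:R.
have t0 n : 0 < t n by rewrite divr_gt0.
have t1 n : t n <= 1.
  by rewrite /t ler_pdivrMr// mul1r; apply: le_trans d1 _; rewrite ler1n.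
have i1 : intg (fun=> 1) by exact: intg_cst.
have iG := intgZ mOm (D * B) (intgD mOm i1 iu4).
have tm := mf_smooth (Om := Om) (test_smooth ts).
pose q n x := (F (u x + t n * psi x) - F (u x)) / t n.
have mq n : measurable_fun Om (fun x => (q n x)%:E).
  apply/measurable_EFinP; apply: measurable_funM => //.
  apply: measurable_funB; apply: measurable_prim; last exact: Lu.1.
  by apply: measurable_funD; [exact: Lu.1|exact: measurable_funM].
have mf : measurable_fun Om (fun x => (f (u x) * psi x)%:E).
  by apply/measurable_EFinP; apply: measurable_funM => //; apply: measurable_nonl; exact: Lu.1.
have t_cvg : t @ \oo --> (0 : R).
  rewrite -[X in _ --> X](mulr0 d); apply: cvgMr; exact: cvg_harmonic.
have q_cvg x : (q ^~ x) @ \oo --> f (u x) * psi x.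
  have hd := prim_derive m Hd (u x).
  have hc : is_derive (0 : R) 1 (fun s : R => F (u x + s * psi x)) (f (u x) * psi x).
    have h1 : is_derive (0 : R) 1 (fun s : R => u x + s * psi x) (psi x).
      have h2 := is_deriveM (is_derive_id (0 : R) 1) (is_derive_cst (psi x) (0 : R) 1).
      have h3 := is_deriveD (is_derive_cst (u x) (0 : R) 1) h2.
      apply: is_derive_eq h3 _; by rewrite /GRing.scale /= mul0r mulr1 !add0r.
    have hd' : is_derive (u x + 0 * psi x) (1 : R) F (f (u x)) by rewrite mul0r addr0.
    exact: (@is_derive1_comp _ F (fun s : R => u x + s * psi x) _ _ _ hd' h1).
  have [hc1 hc2] := hc.
  have lim0 : (fun s : R => s^-1 *: (((fun s : R => F (u x + s * psi x)) \o shift 0) (s *: 1)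
      - F (u x + 0 * psi x))) @ 0^' --> f (u x) * psi x.
    by rewrite -hc2; exact: hc1.
  have tn0 n : t n != 0 by rewrite gt_eqF.
  have := (cvgr_dnbhsP _ _ _).1 lim0 t (conj tn0 t_cvg).
  suff -> : (fun n => (t n)^-1 *: (((fun s : R => F (u x + s * psi x)) \o shift 0) (t n *: 1)
      - F (u x + 0 * psi x))) = q ^~ x by [].
  apply/funext => n; rewrite /q /= /GRing.scale /= mulr1 addr0 mul0r addr0.
  exact: mulrC.
have dom n x : `|q n x| <= D * B * (1 + u x ^+ 4).
  have kB : `|t n * psi x| <= t n * B.
    by rewrite normrM (ger0_norm (ltW (t0 n))) ler_wpM2l// ltW.
  have kB' : `|t n * psi x| <= B by apply: le_trans kB _; rewrite ler_piMl.
  rewrite /q normrM normfV (ger0_norm (ltW (t0 n))) ler_pdivrMr//.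
  apply: le_trans (prim_shift_bound m0 K0 HL (u x) B00 kB') _; rewrite -/D.
  have u40 : 0 <= 1 + u x ^+ 4 by rewrite addr_ge0// (exprM _ 2 2) sqr_ge0.
  apply: le_trans (ler_wpM2r (mulr_ge0 D0 u40) kB) _.
  rewrite le_eqVlt; apply/orP; left; apply/eqP; ring.
have iq n : intg (q n) by apply: (intg_le mOm _ iG) => [|x _]; [by apply/measurable_EFinP; exact: mq|exact: dom].
have ifp : intg (fun x => f (u x) * psi x).
  apply: (intg_le mOm _ iG) => [|x _]; first by apply/measurable_EFinP; exact: mf.
  have hn : (fun n => `|q n x|) @ \oo --> `|f (u x) * psi x|.
    by apply: cvg_norm; exact: q_cvg.
  rewrite -(cvg_lim _ hn)//; apply: limr_le; first by apply/cvg_ex; eexists; exact: hn.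
  by apply: nearW => n; exact: dom.
have cv : {ae @leb4 R, forall x, Om x ->
    (fun n => (q n x)%:E) @ \oo --> (f (u x) * psi x)%:E}.
  apply: aeW => x _; apply: cvg_EFin; first exact: nearW.
  exact: q_cvg.
have bd : {ae @leb4 R, forall x n, Om x ->
    (`|(q n x)%:E| <= (D * B * (1 + u x ^+ 4))%:E)%E}.
  by apply: aeW => x n _; rewrite lee_fin; exact: dom.
have [_ _ DCT] := dominated_convergence mOm mq mf cv iG bd.
move: DCT; rewrite -(I_EFin mOm ifp) => DCT.
exact: (fine_cvg DCT).
Qed.

Lemma L2_laplacian psi : test psi -> L2 (fun x => \sum_(i < 4) partial i (partial i psi) x).
Proof.
move=> ts; have Li i : L2 (partial i (partial i psi)).
  exact: (L2_test mOm Om_fin (test_partial i (test_partial i ts))).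
under eq_fun do rewrite !big_ord_recr big_ord0.
by do !apply: (L2D mOm) => //; exact: (L2_0 _ mOm).
Qed.

Lemma intg_nonl_test u psi : L2 u -> intg (fun x => u x ^+ 4) -> test psi ->
  intg (fun x => f (u x) * psi x).
Proof.
move=> Lu iu4 ts; have [B [B0 hB]] := test_bounded ts.
have i1 : intg (fun=> 1) by exact: intg_cst.
have c0 : 0 <= m + 2 * K by exact: addr_ge0 m0 (mulr_ge0 (ler0n _ 2) K0).
apply: (intg_le mOm _ (intgZ mOm ((m + 2 * K) * 2 * B) (intgD mOm i1 iu4))).
  apply: measurable_funM; first by apply: measurable_nonl; exact: Lu.1.
  exact: (mf_smooth (test_smooth ts)).
move=> x _; rewrite normrM.
have [_ _ p3] := pow_le4 (u x).
have u40 : 0 <= u x ^+ 4 by rewrite (exprM _ 2 2) sqr_ge0.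
apply: le_trans (ler_pM (normr_ge0 _) (normr_ge0 _) (nonl_bound m0 K0 hb (u x)) (hB x)) _.
have -> : (m + 2 * K) * 2 * B * (1 + u x ^+ 4) = (m + 2 * K) * (2 * (1 + u x ^+ 4)) * B by ring.
apply: ler_wpM2r; first exact: ltW.
by apply: ler_wpM2l => //; lra.
Qed.

(** The energy is expanded exactly in [t], and its linear term is written with the
    Laplacian of [psi], so that only L2 convergence is needed. After dividing by [t],
    [t] tends to 0. *)
Lemma variational_inequality u M psi : L2 u -> intg (fun x => u x ^+ 4) -> test psi -> 0 <= M ->
  (exists2 tau, 0 < tau & forall e, 0 < e -> exists phi, [/\ test phi, energy Om phi <= M,
     N (fun x => u x - phi x) <= e &
     forall t, 0 < t <= tau -> action phi - e <= action (fun x => phi x + t * psi x)]) ->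
  0 <= - I (fun x => u x * \sum_(i < 4) partial i (partial i psi) x) - I (fun x => f (u x) * psi x).
Proof.
move=> Lu iu4 ts M0 [tau tau0 hmin].
pose lap x := \sum_(i < 4) partial i (partial i psi) x.
have Llap : L2 lap by exact: L2_laplacian.
have [C [C0 hC]] := prim_shift_close Lu iu4 ts M0.
pose Z := - I (fun x => u x * lap x).
pose G t := I (fun x => F (u x + t * psi x) - F (u x)).
have key t : 0 < t -> t <= tau -> t <= 1 -> 0 <= t * Z + t ^+ 2 / 2 * energy Om psi - G t.
  move=> t0 ttau t1.
  (* W collects the coefficients of the error terms; an error e / W in all of them adds
     up to e. *)
  pose W := 1 + t * N lap + C.
  have W0 : 0 < W.
    by apply: ltr_wpDr => //; apply: ltr_wpDr => //; apply: mulr_ge0 (ltW t0) (N2_ge0 _ _ _).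
  apply/ler_addgt0Pr => e e0.
  have d0 : 0 < e / W by exact: divr_gt0.
  have [phi [tp hE hN ha]] := hmin _ d0.
  have tt := testZ t ts.
  have {}ha := ha t (introT andP (conj t0 ttau)).
  have Lp := L2_test mOm Om_fin tp.
  have E1 : action (fun x => phi x + t * psi x) - action phi =
     t * endot Om phi psi + t ^+ 2 / 2 * energy Om psi -
     I (fun x => F (phi x + t * psi x) - F (phi x)).
    rewrite (IB mOm (intg_prim_test (testDZ t tp ts)) (intg_prim_test tp)).
    rewrite /action energyDZ//.
    move: (energy _ _) (energy _ _) (endot _ _ _) (Rintegral _ _ _) (Rintegral _ _ _).
    by move=> a1 a2 a3 a4 a5; field.
  have E2 : `|endot Om phi psi - Z| <= e / W * N lap.
    have -> : endot Om phi psi - Z = I (fun x => (u x - phi x) * lap x).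
      rewrite (endot_laplacian tp ts) /Z opprK addrC.
      rewrite -(IB mOm (L2_mul mOm Lu Llap) (L2_mul mOm Lp Llap)).
      by apply: Ieq => x _; rewrite mulrBl.
    apply: le_trans (I_CS_N2 mOm (L2B mOm Lu Lp) Llap) _.
    by apply: ler_wpM2r => //; exact: N2_ge0.
  have t01 : 0 <= t <= 1 by rewrite ltW.
  have E3 := hC phi (e / W) tp hE hN t t01.
  have E4 : e = e / W + t * (e / W * N lap) + C * (e / W).
    by rewrite /W; field; rewrite -/W gt_eqF.
  rewrite E4; move: E2 E3; rewrite !ler_norml -/(G t) => /andP[a1 a2] /andP[b1 b2].
  have := ler_wpM2l (ltW t0) a2.
  move: ha E1 b1 b2; move: (action _) (action _) (endot _ _ _) (Rintegral _ _ (fun x => _ - _)).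
  move: (t ^+ 2 / 2 * energy _ _) (e / W) (Z) (N lap) (G t).
  by move=> x1 x2 x3 x4 x5 x6 x7 x8 x9; lra.
pose d := Num.min tau 1.
have d0 : 0 < d by rewrite lt_min tau0 ltr01.
have dtau : d <= tau by rewrite ge_min lexx.
have d1 : d <= 1 by rewrite ge_min lexx orbT.
have cv := prim_quotient_cvg Lu iu4 ts d0 d1.
pose t n := d / n.+1%:R.
have t0 n : 0 < t n by rewrite divr_gt0.
have td n : t n <= d.
  by rewrite /t ler_pdivrMr// ler_peMr ?ler1n// ltW.
have t_cvg : t @ \oo --> (0 : R).
  rewrite -[X in _ --> X](mulr0 d); apply: cvgMr; exact: cvg_harmonic.
have lim : (fun n => Z + t n / 2 * energy Om psi -
    I (fun x => (F (u x + t n * psi x) - F (u x)) / t n)) @ \oo -->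
    Z + 0 / 2 * energy Om psi - I (fun x => f (u x) * psi x).
  apply: cvgB; last exact: cv.
  apply: cvgD; first exact: cvg_cst.
  by apply: cvgMl; apply: cvgMl.
rewrite mul0r mul0r addr0 in lim.
rewrite -/Z -(cvg_lim _ lim)//; apply: limr_ge; first by apply/cvg_ex; eexists; exact: lim.
apply: nearW => n.
have tt := testZ (t n) ts.
have iq := intg_prim_shift Lu iu4 tt.
have -> : I (fun x => (F (u x + t n * psi x) - F (u x)) / t n) = (t n)^-1 * G (t n).
  by rewrite /G -(IZ mOm _ iq); apply: Ieq => x _; rewrite mulrC.
have := key (t n) (t0 n) (le_trans (td n) dtau) (le_trans (td n) d1).
move: (G (t n)) (Z) (energy Om psi) => g z en hk.
have -> : z + t n / 2 * en - (t n)^-1 * g = (t n)^-1 * (t n * z + t n ^+ 2 / 2 * en - g).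
  by field; rewrite gt_eqF.
by apply: mulr_ge0 => //; rewrite invr_ge0 ltW.
Qed.

(** The variational inequality in the directions [psi] and [- psi] is an equality. The
    approximants need not minimize over all test functions: it suffices that they almost
    minimize among their small perturbations in each direction, uniformly. *)
Lemma variational_limit u M : L2 u -> 0 <= M ->
  (forall psi, test psi -> exists2 tau, 0 < tau & forall e, 0 < e -> exists phi,
     [/\ test phi, energy Om phi <= M, N (fun x => u x - phi x) <= e &
     forall t, 0 < t <= tau -> action phi - e <= action (fun x => phi x + t * psi x)]) ->
  dirichlet_weak_solution Om u (fun x => f (u x)).
Proof.
move=> Lu M0 hmin.
have hu e : 0 < e -> exists phi, [/\ test phi, energy Om phi <= M & N (fun x => u x - phi x) <= e].
  move=> e0; have [tau _ h1] := hmin _ (@test0 R Om).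
  by have [phi [a1 a2 a3 _]] := h1 e e0; exists phi.
have [iu4 _] := L4_bound mOm Om_fin S0 Lu M0 hu.
apply: (@distributional_weak_solution R Om mOm Om_fin S0 u _ M (m + 2 * K)) => //.
- by apply: measurable_nonl; exact: Lu.1.
- exact: addr_ge0 m0 (mulr_ge0 (ler0n _ 2) K0).
- by move=> x _; exact: nonl_bound.
move=> psi ts.
have v1 := variational_inequality Lu iu4 ts M0 (hmin psi ts).
have tn := testZ (-1) ts.
have v2 := variational_inequality Lu iu4 tn M0 (hmin _ tn).
have sp := test_smooth ts.
have Ei i : partial i (partial i (fun x => -1 * psi x)) = (fun x => -1 * partial i (partial i psi) x).
  by rewrite (partialZ i (-1) sp) (partialZ i (-1) (smooth_partial i sp)).
have i1 : intg (fun x => u x * \sum_(i < 4) partial i (partial i psi) x).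
  apply: (L2_mul mOm Lu); exact: L2_laplacian.
have i2 : intg (fun x => f (u x) * psi x).
  exact: intg_nonl_test.
have v3 : I (fun x => u x * \sum_(i < 4) partial i (partial i (fun x => -1 * psi x)) x) =
   - I (fun x => u x * \sum_(i < 4) partial i (partial i psi) x).
  rewrite -(IN mOm i1); apply: Ieq => x _; rewrite -mulrN; congr (_ * _).
  by rewrite -sumrN; apply: eq_bigr => i _; rewrite Ei mulN1r.
have v4 : I (fun x => f (u x) * (-1 * psi x)) = - I (fun x => f (u x) * psi x).
  by rewrite -(IN mOm i2); apply: Ieq => x _; rewrite mulN1r mulrN.
exact: (opposite_inequalities v1 v2 v3 v4).
Qed.

End variational_limit.

(** * The first eigenvalue *)

Section eigenvalue.
Variable R : realType.
Notation mR4 := (measurableTypeR R * measurableTypeR R *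
    measurableTypeR R * measurableTypeR R)%type.
Variable Om : set (R4 R).
Hypotheses (oOm : open Om) (Om0 : Om !=set0) (bOm : bounded_set Om).
Let mOm : @measurable _ mR4 Om := open_measurable_R4 oOm.
Let Om_fin : (@leb4 R Om < +oo)%E := bounded_set_fin mOm bOm.
Implicit Types (phi psi u v w f : R4 R -> R).
Notation I f := (\int[@leb4 R]_(x in Om) f x).
Notation N f := (N2 (@leb4 R) Om f).
Notation L2 := (L2 (@leb4 R) Om).
Notation test := (test_function Om).
Notation S := (sobolev_constant R).
Hypothesis S0 : 0 < S.

Lemma invn_small (e : R) : 0 < e -> exists k : nat, k.+1%:R^-1 <= e.
Proof.
move=> e0; exists (Num.bound e^-1); rewrite invf_ple ?posrE//; apply: ltW.
by apply: lt_le_trans (archi_boundP _) _; rewrite ?ler_nat// invr_ge0 ltW.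
Qed.

Lemma geometric_small (e : R) (K : nat) : 0 < e ->
  exists2 k, (K <= k)%N & 8 * 4^-1 ^+ k <= e.
Proof.
move=> e0.
have h : (fun n => 8 * 4^-1 ^+ n : R) @ \oo --> (0 : R).
  rewrite -[X in _ --> X](mulr0 8); apply: cvgMr; apply: cvg_expr.
  by rewrite ger0_norm// invf_lt1// ltr1n.
have [n0 _ hn] : \forall n \near \oo, `|8 * 4^-1 ^+ n : R| <= e.
  by move/cvgr0Pnorm_le: h => /(_ e e0).
exists (maxn K n0); first exact: leq_maxl.
apply: le_trans (ler_norm _) _; apply: hn; by rewrite /= leq_maxr.
Qed.

(** The Poincare inequality bounds the L2 norms, so Rellich's theorem applies. *)
Lemma energy_compact (phi : nat -> R4 R -> R) M : (forall n, test (phi n)) ->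
  (forall n, energy Om (phi n) <= M) -> exists2 u, L2 u &
  forall e k, 0 < e -> exists2 n, (k <= n)%N & N (fun x => u x - phi n x) <= e.
Proof.
move=> tphi EM; have [b [b0 Omb]] := bounded_box bOm.
pose c := Num.sqrt (vol Om) / S.
have c0 : 0 <= c by apply: divr_ge0 (sqrtr_ge0 _) (ltW S0).
have M0 : 0 <= M := le_trans (energy_ge0 _ _) (EM 0).
pose M' := (1 + c) * M.
have cM : c * M <= M' by rewrite /M' mulrDl mul1r lerDr.
have MM : M <= M' by rewrite /M' mulrDl mul1r lerDl mulr_ge0.
have EM' n : energy Om (phi n) <= M' := le_trans (EM n) MM.
have LM n : I (fun x => phi n x ^+ 2) <= M'.
  apply: le_trans (poincare_test mOm Om_fin S0 (tphi n)) _; apply: le_trans cM.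
  exact: ler_wpM2l.
have [u [n [Lu hn hI]]] := rellich mOm Om_fin b0 Omb tphi EM' LM.
exists u => // e k e0; have e20 : 0 < e ^+ 2 by rewrite exprn_gt0.
have [j kj hj] := geometric_small k e20.
exists (n j); first exact: leq_trans kj (hn j).
rewrite N2C -(@ler_pXn2r _ 2)// ?nnegrE ?N2_ge0// ?(ltW e0)// N2_sqr.
exact: le_trans (hI j) hj.
Qed.

Lemma square_primitive_lip (L x y : R) : 0 <= L ->
  `|L / 2 * x ^+ 2 - L / 2 * y ^+ 2| <= L * `|x - y| * (1 + x ^+ 2 + y ^+ 2).
Proof.
move=> L0; have -> : L / 2 * x ^+ 2 - L / 2 * y ^+ 2 = L * ((x - y) * ((x + y) / 2)) by field.
rewrite normrM (ger0_norm L0) -mulrA; apply: ler_wpM2l => //.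
rewrite normrM; apply: ler_wpM2l => //.
have := sqr_ge0 (x + 1); have := sqr_ge0 (x - 1).
have := sqr_ge0 (y + 1); have := sqr_ge0 (y - 1).
by rewrite ler_norml => *; apply/andP; split; nra.
Qed.

Definition rayleigh : R := inf [set energy Om phi | phi in
  [set phi | test phi /\ I (fun x => phi x ^+ 2) = 1]].

Let E := [set energy Om phi | phi in [set phi | test phi /\ I (fun x => phi x ^+ 2) = 1]].

Lemma intg_test_sqr phi : test phi -> intg (@leb4 R) Om (fun x => phi x ^+ 2).
Proof. by move=> tp; have [] := L2_test mOm Om_fin tp. Qed.

Lemma normalize phi : test phi -> 0 < I (fun x => phi x ^+ 2) ->
  E (energy Om phi / I (fun x => phi x ^+ 2)).
Proof.
move=> tp i0; pose s := Num.sqrt (I (fun x => phi x ^+ 2)).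
have s2 : s ^+ 2 = I (fun x => phi x ^+ 2) by rewrite sqr_sqrtr// ltW.
have s0 : 0 < s by rewrite sqrtr_gt0.
exists (fun x => s^-1 * phi x).
  split; first exact: testZ.
  transitivity (I (fun x => s^-1 ^+ 2 * phi x ^+ 2)); first by apply: Ieq => x _; rewrite exprMn.
  by rewrite (IZ mOm _ (intg_test_sqr tp)) -s2 exprVn mulVf// expf_neq0// gt_eqF.
by rewrite (energyZ mOm Om_fin _ tp) -s2 exprVn mulrC.
Qed.

Lemma has_inf_rayleigh : has_inf E.
Proof.
split; last by exists 0 => _ [phi _ <-]; exact: energy_ge0.
have [phi [tp i0]] := exists_nonzero_test oOm Om0 Om_fin S0.
by eexists; exact: normalize tp i0.
Qed.

Lemma rayleigh_ge0 : 0 <= rayleigh.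
Proof.
apply: lb_le_inf; first by case: has_inf_rayleigh.
by move=> _ [phi _ <-]; exact: energy_ge0.
Qed.

Lemma rayleigh_le phi : test phi -> rayleigh * I (fun x => phi x ^+ 2) <= energy Om phi.
Proof.
move=> tp; have := Ige0 (@leb4 R) (D := Om) (f := fun x => phi x ^+ 2) (fun x _ => sqr_ge0 _).
rewrite le_eqVlt => /orP[/eqP <-|i0]; first by rewrite mulr0 energy_ge0.
rewrite -ler_pdivlMr//; apply: ge_inf (normalize tp i0).
by case: has_inf_rayleigh.
Qed.

(** A normalized minimizing sequence converges in L2, and its limit is nonzero. Since
    the functional [energy - rayleigh * I (phi ^+ 2)] is nonnegative and tends to 0 along
    the sequence, the limit satisfies its Euler-Lagrange equation. *)
Lemma rayleigh_eigenvalue : dirichlet_eigenvalue Om rayleigh.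
Proof.
have L0 := rayleigh_ge0.
have hseq n : exists phi, [/\ test phi, I (fun x => phi x ^+ 2) = 1 &
    energy Om phi <= rayleigh + n.+1%:R^-1].
  have [_ [phi [tp i1] <-] /ltW] := inf_adherent (eps := n.+1%:R^-1 : R)
    (eq_ind_r is_true (ltr0Sn R n) (invr_gt0 (n.+1%:R : R))) has_inf_rayleigh.
  by exists phi.
have [phi hphi] := choice hseq.
have tphi n : test (phi n) by have [] := hphi n.
have M0 : 0 <= rayleigh + 1 by exact: addr_ge0.
have EM n : energy Om (phi n) <= rayleigh + 1.
  have [_ _ h] := hphi n; apply: le_trans h _; rewrite lerD2l invf_le1// ler1n//.
have [u Lu hu] := energy_compact tphi EM.
exists u.
  move=> /(ae_zero_intP mOm Lu) u0.
  have half : (0 : R) < 2^-1 by [].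
  have [n _ hn] := hu _ 0%N half.
  have [tp i1 _] := hphi n; have Lp := L2_test mOm Om_fin tp.
  have := N2B mOm Lp Lu (L2_0 (@leb4 R) mOm).
  have -> : N (fun x => phi n x - 0) = 1.
    by under eq_fun do rewrite subr0; rewrite /N2 i1 sqrtr1.
  have -> : N (fun x => u x - 0) = 0.
    by under eq_fun do rewrite subr0; rewrite /N2 u0 sqrtr0.
  by rewrite N2C addr0 => h; have := le_trans h hn; lra.
pose H (s : R) := rayleigh / 2 * s ^+ 2.
pose h (s : R) := rayleigh * s.
have HL x y : `|H x - H y| <= rayleigh * `|x - y| * (1 + x ^+ 2 + y ^+ 2).
  exact: square_primitive_lip.
have Hd (x : R) : is_derive x 1 H (h x).
  apply: is_derive_eq (is_deriveZ (rayleigh / 2) (is_deriveX 2 (is_derive_id x (1 : R)))) _.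
  by rewrite /h /GRing.scale /=; move: rayleigh => r; field.
have hb x : `|h x| <= rayleigh * (1 + x ^+ 2).
  rewrite /h normrM (ger0_norm L0); apply: ler_wpM2l => //.
  have := sqr_ge0 (x + 1); have := sqr_ge0 (x - 1).
  by rewrite ler_norml => *; apply/andP; split; nra.
have mh : measurable_fun setT h by exact: measurable_funM.
have Eact p : test p -> action Om 0 H p = energy Om p / 2 - rayleigh / 2 * I (fun x => p x ^+ 2).
  move=> tp; rewrite /action -(IZ mOm _ (intg_test_sqr tp)); congr (_ - _).
  by apply: Ieq => x _; rewrite /prim !mul0r add0r.
have act0 p : test p -> 0 <= action Om 0 H p.
  move=> tp; rewrite (Eact _ tp); have := rayleigh_le tp.
  by move: (energy _ _) (Rintegral _ _ _) rayleigh => a c r; lra.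
have sol : dirichlet_weak_solution Om u (fun x => nonl 0 h (u x)).
  apply: (variational_limit mOm Om_fin S0 (lexx 0) L0 HL Hd hb mh Lu M0) => psi ts.
  exists 1 => // e e0.
  have [k hk] := invn_small e0.
  have [n kn hn] := hu e k e0; exists (phi n); split => // t _.
  apply: le_trans (act0 _ (testDZ t (tphi n) ts)).
  have [tp i1 h1] := hphi n.
  have nk : (n.+1%:R^-1 : R) <= k.+1%:R^-1 by rewrite lef_pV2 ?posrE// ler_nat.
  have h2 := le_trans nk hk.
  rewrite (Eact _ tp) i1; move: h1 h2.
  move: (energy _ _) rayleigh (n.+1%:R^-1) => a r q h1 h2.
  have r2 : r / 2 * 1 = r / 2 by rewrite mulr1.
  by rewrite r2; lra.
have -> : (fun x => rayleigh * u x) = (fun x => nonl 0 h (u x)).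
  by apply/funext => x; rewrite /nonl mul0r add0r.
exact: sol.
Qed.

(** The infimum of the Rayleigh quotient is an eigenvalue, hence not below the first one.
    Testing an eigenfunction with itself shows that eigenvalues are bounded below, as the
    infimum that defines the first eigenvalue requires. *)
Lemma first_eigenvalue_le phi : test phi ->
  first_eigenvalue Om * I (fun x => phi x ^+ 2) <= energy Om phi.
Proof.
move=> tp; apply: le_trans (rayleigh_le tp).
apply: ler_wpM2r; first by apply: Ige0 => x _; exact: sqr_ge0.
apply: ge_inf; last exact: rayleigh_eigenvalue.
exists 0 => l [u nu [gu hu /(_ u gu hu)[_ he]]].
have [Lu _ _] := (H10P mOm Om_fin _ _).1 hu.
have u0 : 0 < I (fun x => u x ^+ 2).
  rewrite lt_def Ige0 ?andbT; last by move=> x _; exact: sqr_ge0.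
  by apply/eqP => /(ae_zero_intP mOm Lu).
rewrite -(pmulr_lge0 _ u0) -(IZ mOm) ?(proj2 Lu)//.
have -> : I (fun x => l * u x ^+ 2) = I (fun x => l * u x * u x).
  by apply: Ieq => x _; rewrite -mulrA.
rewrite -he; apply: Ige0 => x _; apply: sumr_ge0 => i _; rewrite -expr2; exact: sqr_ge0.
Qed.

End eigenvalue.

(** * The logarithmic nonlinearity *)

Section logarithm.
Variable R : realType.
Implicit Types s x y E : R.

(** The tangent line inequality for the exponential at [ln E - ln s]. *)
Lemma log_lower s E : 0 <= s -> 0 < E -> s - E <= s * (ln s - ln E).
Proof.
rewrite le_eqVlt => /predU1P[<- E0|s0 E0]; first by rewrite mul0r sub0r oppr_le0 ltW.
have := expR_ge1Dx (ln E - ln s).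
rewrite expRD expRN !lnK ?posrE// ler_pdivlMr// mulrDl mul1r.
by move: (ln E) (ln s) => a b; nra.
Qed.

Lemma slogs2_bound s : `|slogs2 s| <= 2 * (1 + s ^+ 2).
Proof.
have -> : `|slogs2 s| = `|slogs2 `|s| |.
  by rewrite /slogs2 real_normK ?num_real// !normrM normr_id.
rewrite -(real_normK (num_real s)); move: (normr_ge0 s); move: `|s| => a.
rewrite le_eqVlt => /predU1P[<-|a0].
  by rewrite /slogs2 mul0r normr0 mulr_ge0// addr_ge0.
rewrite /slogs2 lnXn// mulr2n.
have h1 := log_lower (ltW a0) ltr01; rewrite ln1 subr0 in h1.
have h2 := log_lower (@ler01 R) a0; rewrite ln1 mul1r sub0r in h2.
have h3 : a * ln a <= a * (a - 1) by apply: ler_wpM2l; [exact: ltW|lra].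
have a20 := sqr_ge0 a.
by rewrite ler_norml; move: (ln a) h1 h2 h3 => L *; apply/andP; split; nra.
Qed.

(** The parameter [E] in [log_lower] is taken of the order of [e]. *)
Lemma slogs2_small e : 0 < e -> exists2 d : R, 0 < d & forall s, `|s| <= d -> `|slogs2 s| <= e.
Proof.
move=> e0; pose E := e / 4; have E0 : 0 < E by rewrite divr_gt0.
have L0 : 0 < 1 + `|ln E| by rewrite ltr_pwDl.
pose d := Num.min 1 (E / (1 + `|ln E|)).
exists d; first by rewrite lt_min ltr01 divr_gt0.
move=> s.
have -> : `|slogs2 s| = `|slogs2 `|s| |.
  by rewrite /slogs2 real_normK ?num_real// !normrM normr_id.
move: (normr_ge0 s); move: `|s| => a.
rewrite le_eqVlt => /predU1P[<- _|a0].
  by rewrite /slogs2 mul0r normr0 ltW.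
rewrite le_min => /andP[a1 aE].
rewrite /slogs2 lnXn// mulr2n.
have h1 := log_lower (ltW a0) E0.
have h2 : ln a <= 0 by rewrite -ln1 ler_ln ?posrE.
have h3 : a * ln a <= 0 by rewrite pmulr_rle0.
have h4 : a * (1 + `|ln E|) <= E by rewrite -ler_pdivlMr.
have h5 : - (a * `|ln E|) <= a * ln E.
  by rewrite -mulrN; apply: ler_wpM2l; [exact: ltW|rewrite lerNl ler_normr lexx orbT].
have eE : e = 4 * E by rewrite /E; field.
rewrite eE ler_norml; move: (ln E) `|ln E| (ln a) h1 h2 h3 h4 h5 => L1 L2 L *.
by apply/andP; split; nra.
Qed.

(** At 0 the difference quotient is [slogs2 h], which tends to 0. *)
Lemma is_derive_sqr_log x : is_derive x 1 (fun s : R => s * slogs2 s) (2 * slogs2 x + 2 * x).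
Proof.
have [->|x0] := eqVneq x 0.
  have hc : (fun h : R => h^-1 *: (((fun s : R => s * slogs2 s) \o shift 0) (h *: (1 : R))
      - 0 * slogs2 0)) @ 0^' --> (0 : R).
    apply/cvgr0Pnorm_le => e e0; have [d d0 hd] := slogs2_small e0.
    near=> h; rewrite /= /GRing.scale /= mulr1 addr0 mul0r subr0 mulKf; last first.
      by near: h; exact: nbhs_dnbhs_neq.
    by apply: hd; near: h; exact: dnbhs0_le.
  have dd : derivable (fun s : R => s * slogs2 s) 0 1 by exact: (cvgP _ hc).
  have e0 : 2 * slogs2 0 + 2 * 0 = 0 :> R by rewrite /slogs2 mul0r !mulr0 addr0.
  by rewrite e0; apply: (DeriveDef dd); exact: cvg_lim hc.
have x2 : 0 < x ^+ 2 by rewrite exprn_even_gt0.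
have h2 := is_deriveX 2 (is_derive_id x (1 : R)).
have h3 : is_derive x 1 (fun s : R => ln (s ^+ 2)) (2 / x).
  have := @is_derive1_comp _ (@ln R) (fun s => s ^+ 2) x _ _ (is_derive1_ln x2) h2.
  move=> h; apply: is_derive_eq h _; rewrite /GRing.scale /=; by field.
have h4 := is_deriveM h2 h3.
have -> : (fun s : R => s * slogs2 s) = (fun s => s ^+ 2 * ln (s ^+ 2)).
  by apply/funext => s; rewrite /slogs2 mulrA -expr2.
apply: is_derive_eq h4 _; rewrite /GRing.scale /= /slogs2 -[(_ ^+ 2) x]/(x ^+ 2).
by move: (ln _) => L; field.
Unshelve. all: by end_near. Qed.

Variables (l t : R).

Definition logprim s := l / 2 * s ^+ 2 + t / 2 * (s * slogs2 s - s ^+ 2).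
Definition lognl s := l * s + t * slogs2 s.
Definition logbound := `|l| + 2 * `|t|.

Lemma logbound_ge0 : 0 <= logbound.
Proof. by rewrite addr_ge0// mulr_ge0. Qed.

Lemma is_derive_logprim x : is_derive x 1 logprim (lognl x).
Proof.
have h2 := is_deriveX 2 (is_derive_id x (1 : R)).
have h := is_deriveD (is_deriveZ (l / 2) h2) (is_deriveZ (t / 2) (is_deriveB (is_derive_sqr_log x) h2)).
apply: is_derive_eq h _; rewrite /GRing.scale /= /lognl.
by move: (slogs2 x) => L; field.
Qed.

Lemma lognl_bound x : `|lognl x| <= logbound * (1 + x ^+ 2).
Proof.
rewrite /lognl /logbound; apply: le_trans (ler_normD _ _) _; rewrite [leRHS]mulrDl.
apply: lerD; rewrite normrM.
  apply: ler_wpM2l => //; have := sqr_ge0 (x + 1); have := sqr_ge0 (x - 1).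
  by rewrite ler_norml => *; apply/andP; split; nra.
rewrite -[leRHS]mulrA [leRHS]mulrCA; apply: ler_wpM2l => //; exact: slogs2_bound.
Qed.

Lemma logprim_lip x y :
  `|logprim x - logprim y| <= logbound * `|x - y| * (1 + x ^+ 2 + y ^+ 2).
Proof.
wlog xy : x y / x <= y.
  move=> hw; have [/hw//|/ltW/hw] := leP x y.
  by move=> h; rewrite distrC [`|x - y|]distrC [X in _ * X]addrAC.
have cont : {within `[x, y], continuous logprim}.
  apply: continuous_subspaceT => z; apply: differentiable_continuous; apply/derivable1_diffP.
  by have [] := is_derive_logprim z.
have [c /[!in_itv]/= /andP[xc cy] e] := MVT_segment xy (fun z _ => is_derive_logprim z) cont.
rewrite distrC e normrM [`|y - x|]distrC [leRHS]mulrAC; apply: ler_wpM2r => //.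
apply: le_trans (lognl_bound c) _; apply: ler_wpM2l; first exact: logbound_ge0.
by have := sqr_ge0 x; have := sqr_ge0 y; have [c0|c0] := leP 0 c; nra.
Qed.

Lemma measurable_lognl : measurable_fun setT lognl.
Proof.
apply: measurable_funD; apply: measurable_funM => //.
apply: measurable_funM => //; apply: measurableT_comp; last exact: measurable_funX.
exact: measurable_ln.
Qed.

Lemma logprim_scale (a s : R) : 0 < a ->
  logprim (a * s) = a ^+ 2 * (logprim s + t * ln a * s ^+ 2).
Proof.
move=> a0; rewrite /logprim /slogs2 exprMn.
have [->|s0] := eqVneq s 0; first by ring.
have a2 : 0 < a ^+ 2 by rewrite exprn_gt0.
have s2 : 0 < s ^+ 2 by rewrite exprn_even_gt0.
rewrite (lnM a2 s2) (lnXn 2 a0) mulr2n.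
by move: (ln _) (ln _) => L1 L2; field.
Qed.

Lemma logprim_even s : logprim `|s| = logprim s.
Proof.
rewrite /logprim /slogs2 mulrA -expr2 real_normK ?num_real//.
by rewrite mulrA -expr2.
Qed.

Hypothesis t0 : t < 0.

(** [log_lower] with [E := expR ((a - l) / t)], the value that turns the coefficient [l]
    of the quadratic term into [a]. *)
Lemma logprim_le (a s : R) : logprim s <= a / 2 * s ^+ 2 - t / 2 * expR ((a - l) / t).
Proof.
have e0 := expR_gt0 ((a - l) / t).
have := log_lower (sqr_ge0 s) e0; rewrite expRK => h.
have h2 : t / 2 * (s ^+ 2 * (ln (s ^+ 2) - (a - l) / t)) <= t / 2 * (s ^+ 2 - expR ((a - l) / t)).
  by rewrite ler_nM2l// pmulr_llt0.
rewrite /logprim /slogs2 mulrA -expr2.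
have E : t / 2 * (s ^+ 2 * (ln (s ^+ 2) - (a - l) / t)) =
   t / 2 * (s ^+ 2 * ln (s ^+ 2)) - (a - l) / 2 * s ^+ 2 by field; rewrite lt_eqF.
rewrite E in h2; move: h2; move: (ln (s ^+ 2)) (expR ((a - l) / t)) (s ^+ 2) => L1 L2 L3; lra.
Qed.

End logarithm.

(** * The action with a logarithmic term *)

Section log_action.
Variable R : realType.
Notation mR4 := (measurableTypeR R * measurableTypeR R *
    measurableTypeR R * measurableTypeR R)%type.
Variable Om : set (R4 R).
Hypotheses (oOm : open Om) (Om0 : Om !=set0) (bOm : bounded_set Om).
Let mOm : @measurable _ mR4 Om := open_measurable_R4 oOm.
Let Om_fin : (@leb4 R Om < +oo)%E := bounded_set_fin mOm bOm.
Implicit Types (phi psi u v w f : R4 R -> R).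
Notation I f := (\int[@leb4 R]_(x in Om) f x).
Notation N f := (N2 (@leb4 R) Om f).
Notation L2 := (L2 (@leb4 R) Om).
Notation test := (test_function Om).
Notation intg := (intg (@leb4 R) Om).
Notation S := (sobolev_constant R).
Hypothesis S0 : 0 < S.
Variables (l m t : R).
Hypotheses (m0 : 0 < m) (t0 : t < 0).
Notation H := (logprim l t).
Notation K := (logbound l t).
Notation J := (action Om m H).
Let mp := ltW m0.
Let Kp := logbound_ge0 l t.
Let HL := logprim_lip l t.
Let Hd := is_derive_logprim l t.

Lemma intg_logprim phi : test phi -> intg (fun x => H (phi x)).
Proof.
move=> tp; apply: (intg_eq mOm _ (intg_prim_test mOm Om_fin (lexx 0) Kp HL Hd tp)) => x _.
by rewrite /prim !mul0r add0r.
Qed.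

Lemma actionE phi : test phi -> J phi =
  energy Om phi / 2 - m / 4 * I (fun x => phi x ^+ 4) - I (fun x => H (phi x)).
Proof.
move=> tp; rewrite /action -addrA -opprD; congr (_ - _).
have i4 := intg_testX mOm Om_fin 4 tp.
rewrite -(IZ mOm (m / 4) i4) -(ID mOm (intgZ mOm (m / 4) i4) (intg_logprim tp)).
by apply: Ieq => x _; rewrite /prim.
Qed.

Lemma energy_sabs e phi : 0 < e -> test phi -> energy Om (sabs e phi) <= energy Om phi.
Proof.
move=> e0 tp; apply: ler_sum => i _.
have [_ i1] := L2_partial mOm Om_fin i (test_sabs e0 tp).
have [_ i2] := L2_partial mOm Om_fin i tp.
apply: (Ile mOm i1 i2) => x _; exact: (partial_sabs_le e0 (test_smooth tp)).
Qed.

(** Smoothing the absolute value does not raise the energy and changes the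
    action arbitrarily little, so minimizing sequences may be taken nonnegative. *)
Lemma nonneg_competitor phi e : test phi -> 0 < e -> exists psi,
  [/\ test psi, forall x, 0 <= psi x, energy Om psi <= energy Om phi & J psi <= J phi + e].
Proof.
move=> tp e0.
pose D := m / 4 * (4 + 6 * 1 + 4 * 1 ^+ 2 + 1 ^+ 3) + K * (4 + 2 * 1 ^+ 2).
have D0 : 0 <= D.
  by rewrite /D !expr1n; apply: addr_ge0; apply: mulr_ge0; rewrite ?divr_ge0//; lra.
have i1 : intg (fun=> 1) by exact: intg_cst.
have i4 := intg_testX mOm Om_fin 4 tp.
have iZ := intgD mOm i1 i4.
have p4 x : 0 <= 1 + phi x ^+ 4 by rewrite addr_ge0// (exprM _ 2 2) sqr_ge0.
pose Z := D * I (fun x => 1 + phi x ^+ 4).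
have Z0 : 0 <= Z by apply: mulr_ge0 => //; apply: Ige0 => x _.
have Z1 : 0 < 1 + Z by rewrite ltr_wpDr.
pose d := Num.min 1 (e / (1 + Z)).
have d0 : 0 < d by rewrite lt_min ltr01 divr_gt0.
have d1 : d <= 1 by rewrite ge_min lexx.
have dZ : d * Z <= e.
  apply: (@le_trans _ _ (d * (1 + Z))); first by rewrite ler_pM2l// lerDr.
  by rewrite -ler_pdivlMr// ge_min lexx orbT.
have ts := test_sabs d0 tp.
exists (sabs d phi); split; [exact: ts|exact: (sabs_ge0 d0)|exact: energy_sabs|].
have hE := energy_sabs d0 tp.
have is' := intg_prim_test mOm Om_fin mp Kp HL Hd ts.
have ip := intg_prim_test mOm Om_fin mp Kp HL Hd tp.
have key : I (fun x => prim m H (phi x) - prim m H (sabs d phi x)) <= d * Z.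
  rewrite /Z mulrA -(IZ mOm _ iZ).
  apply: (Ile mOm (intgB mOm ip is') (intgZ mOm _ iZ)) => x _.
  apply: le_trans (ler_norm _) _.
  have -> : prim m H (phi x) = prim m H `|phi x|.
    rewrite /prim logprim_even; congr (_ * _ + _).
    by rewrite -normrX ger0_norm// (exprM _ 2 2) sqr_ge0.
  have kB := sabs_norm d0 phi x.
  have E : sabs d phi x = `|phi x| + (sabs d phi x - `|phi x|) by rewrite addrC subrK.
  rewrite distrC {1}E.
  apply: le_trans (prim_shift_bound mp Kp HL `|phi x| ler01 (le_trans kB d1)) _.
  rewrite -/D -normrX [`|phi x ^+ 4|]ger0_norm ?(exprM _ 2 2) ?sqr_ge0// -(exprM _ 2 2).
  rewrite -mulrA; apply: ler_wpM2r => //; exact: mulr_ge0.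
rewrite (IB mOm ip is') in key; have {}key := le_trans key dZ.
rewrite /action; move: key hE.
move: (energy Om phi) (energy Om (sabs d phi)) => a3 a4.
by move: (Rintegral _ _ _) (Rintegral _ _ _) => a1 a2; lra.
Qed.

Lemma action_scale a phi : 0 < a -> test phi -> J (fun x => a * phi x) <=
  a ^+ 2 * (energy Om phi / 2 - I (fun x => H (phi x)) - t * ln a * I (fun x => phi x ^+ 2)).
Proof.
move=> a0 tp; rewrite (actionE (testZ a tp)) (energyZ mOm Om_fin _ tp).
have -> : I (fun x => H (a * phi x)) =
    a ^+ 2 * (I (fun x => H (phi x)) + t * ln a * I (fun x => phi x ^+ 2)).
  have i2 := intg_test_sqr oOm bOm tp.
  have ih := intg_logprim tp.
  rewrite -(IZ mOm (t * ln a) i2) -(ID mOm ih (intgZ mOm (t * ln a) i2)).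
  rewrite -(IZ mOm (a ^+ 2) (intgD mOm ih (intgZ mOm (t * ln a) i2))).
  by apply: Ieq => x _; rewrite logprim_scale.
have : 0 <= m / 4 * I (fun x => (a * phi x) ^+ 4).
  apply: mulr_ge0; first exact: divr_ge0.
  by apply: Ige0 => x _; rewrite (exprM _ 2 2) sqr_ge0.
move: (m / 4 * _) (I (fun x => H (phi x))) (energy Om phi).
move: (I (fun x => phi x ^+ 2)) (t * ln a).
move=> a4 a5 a1 a2 a3 h; rewrite -subr_ge0.
have -> : a ^+ 2 * (a3 / 2 - a2 - a5 * a4) -
  (a ^+ 2 * a3 / 2 - a1 - a ^+ 2 * (a2 + a5 * a4)) = a1 by field.
exact: h.
Qed.

(** The logarithm is what makes small multiples of a test function have
    negative action. *)
Lemma action_neg r : 0 < r -> exists phi, [/\ test phi, energy Om phi <= r & J phi < 0].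
Proof.
move=> r0; have [phi [tp i0]] := exists_nonzero_test oOm Om0 Om_fin S0.
set B := energy Om phi / 2 - I (fun x => H (phi x)).
set i2 := I (fun x => phi x ^+ 2) in i0.
have A0 := energy_ge0 Om phi.
have q0 : 0 < - t * i2 by rewrite mulr_gt0// oppr_gt0.
pose k := `|B| / (- t * i2) + energy Om phi / r + 1.
have x10 : 0 <= `|B| / (- t * i2) by exact: divr_ge0 (normr_ge0 _) (ltW q0).
have x20 : 0 <= energy Om phi / r by exact: divr_ge0 A0 (ltW r0).
pose a := expR (- k).
have a0 : 0 < a by exact: expR_gt0.
have a1 : a * (1 + k) <= 1.
  rewrite /a expRN ler_pdivrMl ?expR_gt0// mulr1; exact: expR_ge1Dx.
have k0 : 0 <= k by rewrite /k addr_ge0// addr_ge0.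
have tZ := testZ a tp.
exists (fun x => a * phi x); split => //.
  rewrite (energyZ mOm Om_fin _ tp).
  have a1' : a <= 1 by apply: le_trans a1; rewrite mulrDr mulr1 lerDl; exact: mulr_ge0 (ltW a0) k0.
  apply: (@le_trans _ _ (a * energy Om phi)).
    by apply: ler_wpM2r => //; rewrite expr2 ler_piMl// ltW.
  apply: (@le_trans _ _ (a * ((1 + k) * r))); last by rewrite mulrA ler_piMl// ltW.
  apply: ler_wpM2l; first exact: ltW.
  rewrite -ler_pdivrMr//; move: x10 x20; rewrite /k.
  by move: (_ / _) (_ / r) => y1 y2; lra.
apply: le_lt_trans (action_scale a0 tp) _.
rewrite pmulr_rlt0 ?exprn_gt0// -/i2 -/B /a expRK.
have e1 : `|B| = `|B| / (- t * i2) * (- t * i2) by rewrite divfK// gt_eqF.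
have hB := ler_norm B; rewrite e1 in hB.
have : 0 <= energy Om phi / r * (- t * i2) by apply: mulr_ge0 => //; exact: ltW.
have -> : t * - k * i2 = k * (- t * i2) by ring.
rewrite /k !mulrDl mul1r; move: hB q0.
by move: (`|B| / (- t * i2) * (- t * i2)) (energy Om phi / r * (- t * i2)) (- t * i2) => y1 y2 y3; clearbody B; lra.
Qed.

(** By the Sobolev inequality the quartic term is dominated on small balls. *)
Lemma quartic_le phi r : test phi -> energy Om phi <= r * S ^+ 2 / m ->
  m / 4 * I (fun x => phi x ^+ 4) <= r / 4 * energy Om phi.
Proof.
move=> tp hr; have S2 : 0 < S ^+ 2 by rewrite exprn_gt0.
have A0 := energy_ge0 Om phi.
apply: (@le_trans _ _ (m / 4 * (energy Om phi ^+ 2 / S ^+ 2))).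
  by apply: ler_wpM2l; [exact: divr_ge0|exact: sobolev_L4].
rewrite expr2; move: hr; rewrite ler_pdivlMr// => hr.
rewrite mulrA ler_pdivrMr//; move: hr A0 S2.
move: (energy _ _) (S ^+ 2) => A s hr A0 s0.
have -> : m / 4 * (A * A) = (A * m) * (A / 4) by field.
have -> : r / 4 * A * s = (r * s) * (A / 4) by field.
by apply: ler_wpM2r => //; rewrite divr_ge0.
Qed.

(** The free coefficient [a] of the quadratic term is chosen in three ways below:
    large, to make the constant small; 0, to absorb the linear term in the
    logarithm; [l], to keep the linear term. *)
Lemma integral_logprim_le a phi : test phi ->
  I (fun x => H (phi x)) <=
  a / 2 * I (fun x => phi x ^+ 2) + - t / 2 * expR ((a - l) / t) * vol Om.
Proof.
move=> tp; have i2 := intg_test_sqr oOm bOm tp.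
have iq := intgZ mOm (a / 2) i2.
have ic : intg (fun=> - t / 2 * expR ((a - l) / t)) by exact: intg_cst.
have -> : - t / 2 * expR ((a - l) / t) * vol Om = I (fun=> - t / 2 * expR ((a - l) / t)).
  by rewrite Rintegral_cst.
rewrite -(IZ mOm (a / 2) i2) -(ID mOm iq ic).
apply: (Ile mOm (intg_logprim tp) (intgD mOm iq ic)) => x _.
by apply: le_trans (logprim_le l t0 a (phi x)) _; rewrite !mulNr.
Qed.

(** Where the functions are small in L2, the action is almost nonnegative:
    the weight a in the pointwise bound makes the constant term small. *)
Lemma action_liminf d : 0 < d -> exists2 e, 0 < e & forall phi, test phi ->
  energy Om phi <= S ^+ 2 / m -> N phi <= e -> - d <= J phi.
Proof.
move=> d0; have v0 : 0 <= vol Om by rewrite /vol fine_ge0.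
have q0 : 0 < d / (- t * (1 + vol Om)).
  by rewrite divr_gt0// mulr_gt0 ?oppr_gt0// ltr_pwDl.
set q := d / _ in q0.
pose a := Num.max 1 (l + t * ln q).
have a0 : 0 < a by rewrite lt_max ltr01.
have hq : expR ((a - l) / t) <= q.
  rewrite -[leRHS]lnK ?posrE// ler_expR ler_ndivrMr// mulrC lerBrDl.
  by rewrite le_max lexx orbT.
exists (Num.sqrt (d / a)); first by rewrite sqrtr_gt0 divr_gt0.
move=> phi tp hE hN; have i2 := intg_test_sqr oOm bOm tp.
have hI : a * I (fun x => phi x ^+ 2) <= d.
  have h2 : N phi ^+ 2 <= Num.sqrt (d / a) ^+ 2.
    by apply: lerXn2r => //; rewrite nnegrE ?sqrtr_ge0 ?N2_ge0.
  rewrite N2_sqr sqr_sqrtr in h2; last by apply: divr_ge0; exact: ltW.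
  by rewrite mulrC -ler_pdivlMr.
have hH : I (fun x => H (phi x)) <= a / 2 * I (fun x => phi x ^+ 2) + - t / 2 * q * vol Om.
  apply: le_trans (integral_logprim_le a tp) _; rewrite lerD2l; apply: ler_wpM2r => //.
  by apply: ler_wpM2l => //; rewrite divr_ge0// oppr_ge0 ltW.
have hv : - t / 2 * q * vol Om <= d / 2.
  have -> : d / 2 = - t / 2 * q * (1 + vol Om).
    have X0 : - t * (1 + vol Om) != 0.
      by rewrite gt_eqF// mulr_gt0 ?oppr_gt0// ltr_pwDl.
    have -> : - t / 2 * q * (1 + vol Om) = q * (- t * (1 + vol Om)) / 2 by field.
    by rewrite /q divfK.
  apply: ler_wpM2l; last by rewrite lerDr.
  by apply: mulr_ge0; [rewrite divr_ge0// oppr_ge0 ltW|exact: ltW].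
have h4 : m / 4 * I (fun x => phi x ^+ 4) <= 1 / 4 * energy Om phi.
  by apply: quartic_le => //; rewrite mul1r.
rewrite (actionE tp); have A0 := energy_ge0 Om phi.
have ha : a / 2 * I (fun x => phi x ^+ 2) <= d / 2 by rewrite mulrAC ler_pM2r// invr_gt0.
move: A0 h4 (le_trans hH (lerD ha hv)).
move: (energy _ _) (m / 4 * I (fun x => phi x ^+ 4)) (I (fun x => H (phi x))) => y1 y2 y3; lra.
Qed.

End log_action.

(** * A nonnegative solution of the single equation *)

Section comparisons.
Variable R : realType.
Implicit Types a b d e i j : R.

Lemma le_two_halves a b i d : b < i + d / 2 -> a <= b + d / 2 -> a <= i + d.
Proof. lra. Qed.

Lemma le_half a i d : a <= i + d -> d <= - i / 2 -> a <= i / 2.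
Proof. lra. Qed.

Lemma leB_of_leD j i d e : j <= i + d -> d <= e -> j - e <= i.
Proof. lra. Qed.

Lemma half_lt_quarter i j : j <= i / 2 -> i < 0 -> ~ (- (- i / 4) <= j).
Proof. lra. Qed.

End comparisons.

Section single_equation.
Variable R : realType.
Notation mR4 := (measurableTypeR R * measurableTypeR R *
    measurableTypeR R * measurableTypeR R)%type.
Variable Om : set (R4 R).
Hypotheses (oOm : open Om) (Om0 : Om !=set0) (bOm : bounded_set Om).
Let mOm : @measurable _ mR4 Om := open_measurable_R4 oOm.
Let Om_fin : (@leb4 R Om < +oo)%E := bounded_set_fin mOm bOm.
Implicit Types (phi psi u v w f : R4 R -> R).
Notation I f := (\int[@leb4 R]_(x in Om) f x).
Notation N f := (N2 (@leb4 R) Om f).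
Notation L2 := (L2 (@leb4 R) Om).
Notation test := (test_function Om).
Notation S := (sobolev_constant R).
Hypothesis S0 : 0 < S.
Variables (l m t : R).
Hypotheses (m0 : 0 < m) (t0 : t < 0).
Notation H := (logprim l t).
Notation J := (action Om m H).
Variables (c kappa : R).
Hypotheses (c0 : 0 < c) (c1 : c <= 1) (kappa0 : 0 <= kappa).
Hypothesis coercive : forall phi, test phi ->
  c * energy Om phi / 2 - kappa <= energy Om phi / 2 - I (fun x => H (phi x)).
Hypothesis gap : kappa < c ^+ 2 * S ^+ 2 / (4 * m).

(** The radius at which the lower bound [c * A / 2 - m * A ^+ 2 / (4 * S ^+ 2) - kappa] of
    the action, in terms of the energy [A], is maximal. *)
Let T0 := c * S ^+ 2 / m.

Lemma radius_gt0 : 0 < T0.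
Proof. by rewrite divr_gt0// mulr_gt0// exprn_gt0. Qed.

(** By [gap] the lower bound is positive at the radius [T0], hence nonnegative on a whole
    shell inside the ball of that radius. *)
Lemma barrier : exists2 T1, 0 <= T1 < T0 &
  forall phi, test phi -> T1 <= energy Om phi <= T0 -> 0 <= J phi.
Proof.
have S2 : 0 < S ^+ 2 by rewrite exprn_gt0.
pose G := c ^+ 2 * S ^+ 2 / (4 * m).
have G0 : 0 < G by exact: le_lt_trans kappa0 gap.
(* G - kappa is the maximum of the lower bound, which drops by G * r ^+ 2 at relative
   distance r from T0; as rho <= 1, G * rho ^+ 2 <= G - kappa. *)
pose rho := (G - kappa) / G.
have r0 : 0 < rho by rewrite divr_gt0// subr_gt0.
have r1 : rho <= 1 by rewrite ler_pdivrMr// mul1r gerBl.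
have T00 := radius_gt0.
exists (T0 * (1 - rho)).
  rewrite mulr_ge0 ?(ltW T00) ?subr_ge0//=.
  by rewrite gtr_pMr// gtrBl.
move=> phi tp /andP[h1 h2].
have h3 := coercive tp; have h4 := sobolev_L4 mOm Om_fin S0 tp.
have h5 : m / 4 * I (fun x => phi x ^+ 4) <= m / 4 * (energy Om phi ^+ 2 / S ^+ 2).
  by apply: ler_wpM2l => //; apply: divr_ge0 => //; exact: ltW.
rewrite (actionE oOm bOm l m t tp).
have E : c * energy Om phi / 2 - m / 4 * (energy Om phi ^+ 2 / S ^+ 2) =
    G - m / 4 * ((T0 - energy Om phi) ^+ 2 / S ^+ 2).
  rewrite /G /T0; move: (energy _ _) => A; field.
  by rewrite gt_eqF// gt_eqF.
have E2 (r : R) : m / 4 * ((T0 * r) ^+ 2 / S ^+ 2) = G * r ^+ 2.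
  by rewrite /G /T0; field; rewrite gt_eqF// gt_eqF.
have h6 : m / 4 * ((T0 - energy Om phi) ^+ 2 / S ^+ 2) <= G * rho ^+ 2.
  rewrite -E2; apply: ler_wpM2l; first by apply: divr_ge0 => //; exact: ltW.
  apply: ler_wpM2r; first by rewrite invr_ge0 ltW.
  have x0 : 0 <= T0 - energy Om phi by rewrite subr_ge0.
  have x1 : 0 <= T0 * rho by exact: mulr_ge0 (ltW T00) (ltW r0).
  apply: lerXn2r; rewrite ?nnegrE//.
  by rewrite mulrBr mulr1 in h1; rewrite lerBlDl -lerBlDr.
have h7 : G * rho ^+ 2 <= G - kappa.
  have e : G - kappa = G * rho by rewrite /rho mulrCA divff ?mulr1// gt_eqF.
  rewrite e; apply: ler_wpM2l; first exact: ltW.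
  by rewrite expr2 ler_piMl// ltW.
move: h3 h5 E h6 h7.
move: (m / 4 * (energy _ _ ^+ 2 / _)) (m / 4 * ((T0 - _) ^+ 2 / _)).
move: (m / 4 * Rintegral _ _ _) (I (fun x => H (phi x))) (c * energy Om phi / 2) (energy Om phi / 2) (G * _) => *.
lra.
Qed.

Lemma action_bounded phi : test phi -> energy Om phi <= T0 -> - kappa <= J phi.
Proof.
move=> tp hE; have h1 := quartic_le oOm bOm S0 m0 tp hE.
have h2 := coercive tp; have A0 := mulr_ge0 (ltW c0) (energy_ge0 Om phi).
rewrite (actionE oOm bOm l m t tp).
have e1 : c * energy Om phi / 2 = 2 * (c / 4 * energy Om phi) by move: (energy _ _) => A; field.
have e2 : c * energy Om phi = 4 * (c / 4 * energy Om phi) by move: (energy _ _) => A; field.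
rewrite e1 in h2; rewrite e2 in A0; move: h1 h2 A0.
move: (c / 4 * _) (m / 4 * Rintegral _ _ _) (I (fun x => H (phi x))) (energy Om phi / 2) => *; lra.
Qed.

Let E := [set J phi | phi in [set phi | test phi /\ energy Om phi <= T0]].

Lemma has_inf_action : has_inf E.
Proof.
split; last by exists (- kappa) => _ [phi [tp hE] <-]; exact: action_bounded.
exists (J (fun=> 0)); exists (fun=> 0); last by []; split; first exact: test0.
have -> : energy Om (fun=> 0) = 0; last exact: ltW radius_gt0.
have := energyZ mOm Om_fin 0 (@test0 R Om); by rewrite expr0n !mul0r.
Qed.

(** This excludes the limit 0 later, and keeps minimizing sequences away from the
    shell, where the action is nonnegative. *)
Lemma inf_action_lt0 : inf E < 0.
Proof.
have [phi [tp hE hJ]] := action_neg oOm Om0 bOm S0 l m0 t0 radius_gt0.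
apply: le_lt_trans hJ; apply: ge_inf; first by case: has_inf_action.
exists phi; last by []; split; [exact: tp|exact: hE].
Qed.

Lemma minimizing_sequence : exists phi : nat -> R4 R -> R, forall n,
  [/\ test (phi n), forall x, 0 <= phi n x, energy Om (phi n) <= T0,
      J (phi n) <= inf E / 2 & J (phi n) <= inf E + n.+1%:R^-1].
Proof.
have j0 := inf_action_lt0.
suff h n : exists phi, [/\ test phi, forall x, 0 <= phi x, energy Om phi <= T0,
    J phi <= inf E / 2 & J phi <= inf E + n.+1%:R^-1].
  by have [phi hphi] := choice h; exists phi.
pose d := Num.min (- inf E / 2) (n.+1%:R^-1).
have n0 : 0 < (n.+1%:R^-1 : R) by rewrite invr_gt0.
have d0 : 0 < d by rewrite lt_min n0 andbT divr_gt0// oppr_gt0.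
have d20 : 0 < d / 2 by rewrite divr_gt0.
have [_ [phi [tp hE] <-] hJ] := inf_adherent d20 has_inf_action.
have [psi [ts s0 hE' hJ']] := nonneg_competitor oOm bOm l t m0 tp d20.
have k1 : d <= - inf E / 2 by rewrite ge_min lexx.
have k2 : d <= n.+1%:R^-1 by rewrite ge_min lexx orbT.
have hh := le_two_halves hJ hJ'.
exists psi; split; [exact: ts|exact: s0|exact: le_trans hE' hE|exact: le_half hh k1|].
by apply: le_trans hh _; rewrite lerD2l.
Qed.

(** The cross term [2 * endot Om phi psi] is at most the sum of the two energies. *)
Lemma energy_perturb T1 phi psi : test phi -> test psi -> energy Om phi <= T1 -> T1 < T0 ->
  forall s, 0 < s -> s <= 1 -> s * (1 + T1 + 2 * energy Om psi) <= T0 - T1 ->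
  energy Om (fun x => phi x + s * psi x) <= T0.
Proof.
move=> tp ts h1 h2 s s0 s1 hs.
have A0 := energy_ge0 Om phi; have B0 := energy_ge0 Om psi.
have := energy_ge0 Om (fun x => phi x - psi x).
rewrite (energyB mOm Om_fin tp ts) (energyDZ mOm Om_fin s tp ts).
move: (energy Om phi) (energy Om psi) (endot _ _ _) A0 B0 h1 hs => A B D A0 B0 h1 hs hd.
have k1 : s * (2 * D) <= s * (A + B) by apply: ler_wpM2l; [exact: ltW|lra].
have k2 : s * A <= s * T1 by apply: ler_wpM2l => //; exact: ltW.
have k3 : s ^+ 2 * B <= s * B by apply: ler_wpM2r => //; rewrite expr2 ler_piMl// ltW.
clearbody T0; lra.
Qed.

(** The negative part of [u] is at most [`|u - phi|] when [phi] is nonnegative. *)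
Lemma limit_ae_nonneg u : L2 u ->
  (forall e, 0 < e -> exists phi, [/\ test phi, forall x, 0 <= phi x &
     N (fun x => u x - phi x) <= e]) -> ae_nonneg Om u.
Proof.
move=> Lu hu; pose w x := Num.min (u x) 0.
have mw : measurable_fun Om w by apply: measurable_minr => //; exact: Lu.1.
have Lw : L2 w.
  split => //; apply: (intg_le mOm _ Lu.2); first exact: measurable_funX.
  move=> x _; rewrite normrX -[leRHS]real_normK ?num_real//.
  apply: lerXn2r; rewrite ?nnegrE ?normr_ge0// /w.
  by case: (ltrP (u x) 0) => // _; rewrite normr0 normr_ge0.
have w0 : I (fun x => w x ^+ 2) = 0.
  rewrite -N2_sqr; apply/eqP; rewrite sqrf_eq0; apply/eqP.
  apply: (@eq0_small _ _ 1) => // e e0; rewrite mul1r (ger0_norm (N2_ge0 _ _ _)).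
  have [phi [tp p0 hN]] := hu e e0; apply: le_trans hN.
  have Lp := L2_test mOm Om_fin tp.
  rewrite -(@ler_pXn2r _ 2)// ?nnegrE ?N2_ge0// !N2_sqr.
  apply: (Ile mOm Lw.2 (L2B mOm Lu Lp).2) => x _.
  rewrite /w; have [ux|ux] := ltrP (u x) 0; last by rewrite expr0n sqr_ge0.
  by have := p0 x; move: ux; move: (u x) (phi x) => a b *; nra.
move/(ae_zero_intP mOm Lw): w0; apply: ae_leb4 => x h Ox.
by have := h Ox; rewrite /w; case: (ltrP (u x) 0) => // ux e; rewrite e ltxx in ux.
Qed.

(** The action is minimized over the test functions of energy at most [T0], along a
    nonnegative sequence. Minimizing sequences stay strictly inside the ball, so small
    perturbations are competitors and the L2 limit solves the equation. If the limit
    were 0, the action would have a nonnegative lower limit along the sequence. *)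
Theorem log_critical_solution : exists u,
  [/\ dirichlet_weak_solution Om u (fun x => nonl m (lognl l t) (u x)),
      ae_nonneg Om u & ~ ae_zero Om u].
Proof.
have [phi hphi] := minimizing_sequence.
have j0 := inf_action_lt0; have [T1 /andP[T10 T1T0] hb] := barrier.
have T00 := radius_gt0.
have tphi n : test (phi n) by have [] := hphi n.
have E0 n : energy Om (phi n) <= T0 by have [] := hphi n.
have Jneg n : J (phi n) < 0.
  by have [_ _ _ h _] := hphi n; apply: le_lt_trans h _; rewrite pmulr_llt0.
have E1 n : energy Om (phi n) <= T1.
  rewrite leNgt; apply/negP => h; have := hb _ (tphi n).
  by rewrite (ltW h) (E0 n) => /(_ isT); rewrite leNgt Jneg.
have [u Lu hu] := energy_compact oOm bOm S0 tphi E1.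
exists u; split.
- apply: (variational_limit mOm Om_fin S0 (ltW m0) (logbound_ge0 l t) (logprim_lip l t)
    (is_derive_logprim l t) (lognl_bound l t) (measurable_lognl l t) Lu T10) => psi ts.
  pose Q := 1 + T1 + 2 * energy Om psi.
  have Q0 : 0 < Q.
    rewrite /Q; have := energy_ge0 Om psi; move: T10; move: (energy _ _) => B *; lra.
  have dT : 0 < T0 - T1 by rewrite subr_gt0.
  exists (Num.min 1 ((T0 - T1) / Q)); first by rewrite lt_min ltr01 divr_gt0.
  move=> e e0.
  have [k hk] := invn_small e0.
  have [n kn hn] := hu e k e0; exists (phi n); split; [exact: tphi|exact: E1|exact: hn|move=> s /andP[s0]].
  rewrite le_min => /andP[s1 sQ].
  have nk : (n.+1%:R^-1 : R) <= k.+1%:R^-1 by rewrite lef_pV2 ?posrE// ler_nat.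
  have h2 := le_trans nk hk.
  have td := testDZ s (tphi n) ts.
  have hE : energy Om (fun x => phi n x + s * psi x) <= T0.
    apply: (energy_perturb (tphi n) ts (E1 n) T1T0 s0 s1).
    by rewrite -/Q -ler_pdivlMr.
  have hinf : inf E <= J (fun x => phi n x + s * psi x).
    apply: ge_inf; first by case: has_inf_action.
    exists (fun x => phi n x + s * psi x); last by []; split; [exact: td|exact: hE].
  apply: le_trans hinf; have [_ _ _ _ h1] := hphi n.
  exact: leB_of_leD h1 h2.
- apply: (limit_ae_nonneg Lu) => e e0; have [n _ hn] := hu e 0%N e0.
  by exists (phi n); have [tn pn _ _ _] := hphi n; split; [exact: tn|exact: pn|exact: hn].
move=> /(ae_zero_intP mOm Lu) u0.
have d0 : 0 < - inf E / 4 by rewrite divr_gt0// oppr_gt0.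
(* If u vanishes, the minimizing sequence tends to 0 in L2. *)
have [e e0 he] := action_liminf oOm bOm S0 l m0 t0 d0.
have [n _ hn] := hu e 0%N e0; have [tp _ _ h1 _] := hphi n.
have Lp := L2_test mOm Om_fin tp.
have hN : N (phi n) <= e.
  have := N2B mOm Lp Lu (L2_0 (@leb4 R) mOm).
  have -> : N (fun x => phi n x - 0) = N (phi n) by under eq_fun do rewrite subr0.
  have -> : N (fun x => u x - 0) = 0.
    by under eq_fun do rewrite subr0; rewrite /N2 u0 sqrtr0.
  by rewrite N2C addr0 => h; exact: le_trans h hn.
have hT : energy Om (phi n) <= S ^+ 2 / m.
  apply: le_trans (E0 n) _; rewrite /T0 -mulrA ler_piMl//.
  by apply: divr_ge0; [exact: sqr_ge0|exact: ltW].
exact: (half_lt_quarter h1 j0 (he _ tp hT hN)).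
Qed.

End single_equation.

(** * Semi-trivial solutions of the system *)

Section thresholds.
Variable R : realType.
Implicit Types S m M c v t w k : R.

Lemma ratio_sqr (x y z : R) : (x / y) ^+ 2 / z = x ^+ 2 / (y ^+ 2 * z).
Proof. by rewrite expr_div_n -mulrA -invfM. Qed.

Lemma gap_of_threshold S m c v t w : 0 < m ->
  - (2 * (t * w) * v) < c ^+ 2 * S ^+ 2 / m -> - t / 2 * w * v < c ^+ 2 * S ^+ 2 / (4 * m).
Proof.
move=> m0 h; have -> : c ^+ 2 * S ^+ 2 / (4 * m) = c ^+ 2 * S ^+ 2 / m / 4.
  by field; rewrite gt_eqF.
have -> : - t / 2 * w * v = - (2 * (t * w) * v) / 4 by field.
by rewrite ltr_pM2r// invr_gt0.
Qed.

(** In all three admissibility conditions the other component only makes the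
    threshold harder to meet. *)
Lemma component_threshold S m M q c v k k' : 0 < m -> m <= M -> 0 <= v -> k' <= 0 ->
  q <= c ^+ 2 -> 0 < q / M * S ^+ 2 + 2 * (k + k') * v -> - (2 * k * v) < c ^+ 2 * S ^+ 2 / m.
Proof.
move=> m0 mM v0 k0 qc h; have M0 := lt_le_trans m0 mM.
have S2 : 0 <= S ^+ 2 := sqr_ge0 _.
have k1 : k' * v <= 0 by exact: mulr_le0_ge0.
have k2 : q / M * S ^+ 2 <= c ^+ 2 * S ^+ 2 / m.
  rewrite mulrAC; apply: (@le_trans _ _ (c ^+ 2 * S ^+ 2 / M)).
    by apply: ler_wpM2r; [rewrite invr_ge0 ltW|exact: ler_wpM2r].
  by apply: ler_wpM2l; [rewrite mulr_ge0// sqr_ge0|rewrite lef_pV2 ?posrE].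
have e : 2 * (k + k') * v = 2 * k * v + 2 * (k' * v) by ring.
by rewrite e in h; move: h k1 k2; move: (q / M * _) (_ * _ / m) (2 * k * v) (k' * v) => *; lra.
Qed.

End thresholds.

Section system.
Variable R : realType.
Notation mR4 := (measurableTypeR R * measurableTypeR R *
    measurableTypeR R * measurableTypeR R)%type.
Variable Om : set (R4 R).
Hypotheses (oOm : open Om) (Om0 : Om !=set0) (bOm : bounded_set Om).
Let mOm : @measurable _ mR4 Om := open_measurable_R4 oOm.
Let Om_fin : (@leb4 R Om < +oo)%E := bounded_set_fin mOm bOm.
Notation I f := (\int[@leb4 R]_(x in Om) f x).
Notation test := (test_function Om).
Notation S := (sobolev_constant R).
Notation L1 := (first_eigenvalue Om).

Definition solvable (l m t : R) := exists u,
  [/\ dirichlet_weak_solution Om u (fun x => nonl m (lognl l t) (u x)),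
      ae_nonneg Om u & ~ ae_zero Om u].

Lemma vol_ge0 : 0 <= vol Om.
Proof. by rewrite /vol fine_ge0. Qed.

Lemma sobolev_gt0 (c m q : R) : 0 < m -> 0 <= q -> q < c ^+ 2 * S ^+ 2 / m -> 0 < S.
Proof.
move=> m0 q0 h; rewrite lt_def sobolev_ge0 andbT; apply/eqP => S0.
by move: (le_lt_trans q0 h); rewrite S0 expr0n /= mulr0 mul0r ltxx.
Qed.

Lemma weight_ge0 t w : t < 0 -> 0 <= w -> 0 <= - t / 2 * w * vol Om.
Proof.
move=> t0 w0; apply: mulr_ge0 vol_ge0; apply: mulr_ge0 w0.
by rewrite divr_ge0// oppr_ge0 ltW.
Qed.

Lemma threshold_ge0 t w : t < 0 -> 0 <= w -> 0 <= - (2 * (t * w) * vol Om).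
Proof.
move=> t0 w0; have := weight_ge0 t0 w0.
have -> : - (2 * (t * w) * vol Om) = 4 * (- t / 2 * w * vol Om) by field.
by move=> h; exact: mulr_ge0.
Qed.

(** The linear term is absorbed in the logarithm, at the cost of the factor
    [expR (- (l / t))]. *)
Lemma solvable_by_logarithm l m t : 0 < m -> t < 0 ->
  - (2 * (t * expR (- (l / t))) * vol Om) < 1 ^+ 2 * S ^+ 2 / m -> solvable l m t.
Proof.
move=> m0 t0 h; have w0 := expR_ge0 (- (l / t)).
have S0 := sobolev_gt0 m0 (threshold_ge0 t0 w0) h.
apply: (log_critical_solution oOm Om0 bOm S0 m0 t0 ltr01 (lexx 1) (weight_ge0 t0 w0) _
  (gap_of_threshold m0 h)) => phi tp.
have := integral_logprim_le oOm bOm l t0 0 tp.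
have -> : (0 - l) / t = - (l / t) by rewrite sub0r mulNr.
rewrite !mul0r add0r mul1r => h1.
by rewrite lerD2l lerN2.
Qed.

(** Below the first eigenvalue the linear term is absorbed in the energy. *)
Lemma solvable_by_eigenvalue l m t : 0 <= l < L1 -> 0 < m -> t < 0 ->
  - (2 * (t * 1) * vol Om) < ((L1 - l) / L1) ^+ 2 * S ^+ 2 / m -> solvable l m t.
Proof.
move=> /andP[l0 lL] m0 t0 h.
have S0 := sobolev_gt0 m0 (threshold_ge0 t0 ler01) h.
have L0 : 0 < L1 by exact: le_lt_trans lL.
have c0 : 0 < (L1 - l) / L1 by rewrite divr_gt0// subr_gt0.
have c1 : (L1 - l) / L1 <= 1 by rewrite ler_pdivrMr// mul1r gerBl.
apply: (log_critical_solution oOm Om0 bOm S0 m0 t0 c0 c1 (weight_ge0 t0 ler01) _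
  (gap_of_threshold m0 h)) => phi tp.
have := integral_logprim_le oOm bOm l t0 l tp; rewrite subrr mul0r expR0.
have hL := first_eigenvalue_le oOm Om0 bOm S0 tp.
have hl : l / L1 * (L1 * I (fun x => phi x ^+ 2)) <= l / L1 * energy Om phi.
  by apply: ler_wpM2l hL; exact: divr_ge0 l0 (ltW L0).
rewrite mulrA divfK ?gt_eqF// in hl.
have -> : (L1 - l) / L1 * energy Om phi / 2 = energy Om phi / 2 - l / L1 * energy Om phi / 2.
  by move: (energy _ _) => A; field; rewrite gt_eqF.
have e : l / 2 * I (fun x => phi x ^+ 2) = l * I (fun x => phi x ^+ 2) / 2 by rewrite mulrAC.
rewrite e; move: hl; move: (l * _) (l / L1 * _) (energy _ _ / 2) (_ * vol Om).
move: (I (fun x => logprim l t (phi x))) => y0 y1 y2 y3 y4; clear; lra.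
Qed.

(** In the first and the third case the first equation is solved, in the second case the
    second one, whose linear coefficient is then arbitrary. *)
Lemma admissible_solvable l1 m1 M1 t1 l2 m2 M2 t2 : 0 < m1 -> m1 <= M1 -> 0 < m2 -> m2 <= M2 ->
  admissible Om l1 M1 t1 l2 M2 t2 -> solvable l1 m1 t1 \/ solvable l2 m2 t2.
Proof.
move=> m10 mM1 m20 mM2; have v0 := vol_ge0.
have mm1 : m1 <= Num.max M1 M2 by rewrite le_max mM1.
have mm2 : m2 <= Num.max M1 M2 by rewrite le_max mM2 orbT.
case.
- move=> [[/andP[l10 l1L] /andP[l20 l2L]] _ [t10 t20] h]; left.
  apply: solvable_by_eigenvalue; [by rewrite l10|exact: m10|exact: t10|].
  have L0 : 0 < L1 by exact: le_lt_trans l1L.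
  apply: (@component_threshold _ S m1 (Num.max M1 M2)
    ((Num.min (L1 - l1) (L1 - l2) / L1) ^+ 2) _ (vol Om) (t1 * 1) t2) => //.
  + exact: ltW.
  + have x0 : 0 <= Num.min (L1 - l1) (L1 - l2) by rewrite le_min !subr_ge0 !ltW.
    apply: lerXn2r; rewrite ?nnegrE ?divr_ge0 ?subr_ge0 ?(ltW L0) ?(ltW l1L)//.
    by rewrite ler_pM2r ?invr_gt0// ge_min lexx.
  by rewrite mulr1 ratio_sqr.
- move=> [/andP[l10 l1L] _ [t10 t20] h]; right.
  apply: solvable_by_logarithm => //.
  have L0 : 0 < L1 by exact: le_lt_trans l1L.
  apply: (@component_threshold _ S m2 (Num.max M1 M2)
    (((L1 - l1) / L1) ^+ 2) 1 (vol Om) _ t1) => //.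
  + exact: ltW.
  + have x0 : 0 <= (L1 - l1) / L1 by rewrite divr_ge0 ?subr_ge0 ?ltW.
    apply: lerXn2r; rewrite ?nnegrE//.
    by rewrite ler_pdivrMr// mul1r gerBl.
  by rewrite ratio_sqr [_ + t1]addrC.
move=> [_ [t10 t20] h]; left.
apply: solvable_by_logarithm => //.
apply: (@component_threshold _ S m1 (Num.max M1 M2) 1 1 (vol Om) _ (t2 * expR (- (l2 / t2)))) => //.
- by rewrite nmulr_rle0// expR_ge0.
- by rewrite expr1n.
Qed.

Lemma dirichlet_zero : dirichlet_weak_solution Om (fun=> 0) (fun=> 0).
Proof.
have N0 : N2 (@leb4 R) Om (fun=> 0 - 0) = 0.
  rewrite /N2 (_ : I _ = 0) ?sqrtr0// -[RHS](I0 (@leb4 R) mOm).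
  by apply: Ieq => x _; rewrite subr0 expr0n.
exists (fun _ _ => 0).
  apply/(H10P mOm Om_fin); split; [exact: L2_0|by move=> i; exact: L2_0|].
  move=> e e0; exists (fun=> 0); split; first exact: test0.
    by rewrite N0 ltW.
  move=> i; have -> : partial i (fun=> 0 : R) = fun _ : R4 R => 0.
    by apply: is_derive_partial => x; exact: is_derive_cst.
  by rewrite N0 ltW.
move=> w gw _; split.
  have h : intg (@leb4 R) Om (fun x => 0 * w x).
    apply: (intg_eq mOm (f := fun=> 0)); first by move=> x _; rewrite mul0r.
    exact: intg0.
  exact: h.
by apply: Ieq => x _; rewrite mul0r big1// => i _; rewrite mul0r.
Qed.

(** The coupling term vanishes with the other component. *)
Lemma semitrivial_coupled (l m t b : R) u :
  (fun x => l * u x + m * `|u x| ^+ 2 * u x + b * `|(0 : R)| ^+ 2 * u x + t * slogs2 (u x)) =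
  (fun x : R4 R => nonl m (lognl l t) (u x)).
Proof.
apply/funext => x; rewrite /nonl /lognl normr0 real_normK ?num_real//.
by move: (slogs2 _) => s; ring.
Qed.

Lemma semitrivial_zero (l m t b : R) (u : R4 R -> R) :
  (fun x => l * 0 + m * `|(0 : R)| ^+ 2 * 0 + b * `|u x| ^+ 2 * 0 + t * slogs2 0) =
  (fun _ : R4 R => 0 : R).
Proof. by apply/funext => x; rewrite /slogs2 !(mul0r, mulr0) !addr0. Qed.

Lemma ae_nonneg0 : @ae_nonneg R Om (fun=> 0).
Proof. by apply: aeW => x _. Qed.

End system.

Unset Implicit Arguments.

Theorem theorem1p4 (R : realType) (Om : set (R4 R))
    (l1 m1 t1 l2 m2 t2 b : R)
    (hOm : bounded_smooth_domain Om)
    (hm1 : 0 < m1) (hm2 : 0 < m2) (ht1 : t1 < 0) (ht2 : t2 < 0) (hb : b != 0)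
    (hneg : b < 0 -> admissible Om l1 m1 t1 l2 m2 t2)
    (hpos : 0 < b -> exists eps : R,
       0 < eps /\ admissible Om l1 (m1 + b * eps) t1 l2 (m2 + b / eps) t2)
    (hrange : [\/ b < 0, 0 < b < Num.min m1 m2 | Num.max m1 m2 < b])
    (hR1 : 32 * expR (l1 / t1) / (m1 * inradius Om ^+ 2) < 1)
    (hR2 : 32 * expR (l2 / t2) / (m2 * inradius Om ^+ 2) < 1) :
  exists u v : R4 R -> R,
    [/\ system_weak_solution Om l1 m1 t1 l2 m2 t2 b u v,
        ae_nonneg Om u, ae_nonneg Om v & ~ (ae_zero Om u /\ ae_zero Om v)].
Proof.
case: hOm => oOm _ Om0 bOm _.
have : solvable Om l1 m1 t1 \/ solvable Om l2 m2 t2.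
  have [b0|b0|b0] := ltgtP b 0; last by rewrite b0 eqxx in hb.
    exact: (admissible_solvable oOm Om0 bOm hm1 (lexx _) hm2 (lexx _) (hneg b0)).
  have [eps [e0 had]] := hpos b0.
  apply: (admissible_solvable oOm Om0 bOm hm1 _ hm2 _ had).
    by rewrite lerDl mulr_ge0 ?ltW.
  by rewrite lerDl divr_ge0 ?ltW.
case=> -[u [su u0 un]].
  exists u, (fun=> 0); split; [|exact: u0|exact: ae_nonneg0|by case].
  split; first by rewrite semitrivial_coupled.
  by rewrite semitrivial_zero; exact: dirichlet_zero.
exists (fun=> 0), u; split; [|exact: ae_nonneg0|exact: u0|by case].
split; last by rewrite semitrivial_coupled.
by rewrite semitrivial_zero; exact: dirichlet_zero.
Qed.
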